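(* Let $I=[a,b]\subset\mathbb R$ be a closed bounded interval and let $w:I\times I\to\mathbb R\cup\{+\infty\}$ be a continuous symmetric function such that $F_{\rm OT}(\rho)<\infty$ for every $n\in\mathbb N$ and every non-atomic $\rho\in\mathcal P(I)$. Then the following are equivalent: (a) for every $n\in\mathbb N$ and every non-atomic $\rho\in\mathcal P(I)$, the Seidl plan $\gamma_\rho$ is a minimizer of $F_{\rm OT}(\rho)$; (b) $w$ is well-ordering on $I$. Moreover, if $w$ is strictly well-ordering, then for every $n$ and every non-atomic $\rho\in\mathcal P(I)$ the symmetrization $\frac{1}{n!}\sum_{\sigma\in S_n}\sigma^\#\gamma_\rho$ of $\gamma_\rho$ is the unique minimizer of $F_{\rm OT}(\rho)$ among symmetric (i.e. invariant under permutation of coordinates) measures in $\Pi(\rho)$.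
   Context: For $n\in\mathbb N$ and $x=(x_1,\dots,x_n)\in I^n$ let $c_n(x)=\sum_{i\neq j}w(x_i,x_j)$, the sum over ordered pairs of distinct indices. For $\rho\in\mathcal P(I)$, $\Pi(\rho)$ denotes the set of Borel probability measures on $I^n$ each of whose $n$ one-dimensional marginals equals $\rho$, and $F_{\rm OT}(\rho)=\min\{\int_{I^n}c_n\,d\gamma:\gamma\in\Pi(\rho)\}$ ($n$-marginal optimal transport problem). Well-ordering: a continuous symmetric $w:J\times J\to\mathbb R\cup\{+\infty\}$ is well-ordering on $J\subset\mathbb R$ if for all $x_1\le x_2\le x_3\le x_4$ in $J$, $w(x_1,x_3)+w(x_2,x_4)=\min\{w(x_{\sigma(1)},x_{\sigma(2)})+w(x_{\sigma(3)},x_{\sigma(4)}):\sigma\text{ a permutation of }\{1,2,3,4\}\}$. It is strictly well-ordering if in addition, for such $x_1\le\dots\le x_4$ and a permutation $\sigma$, the equality $w(x_1,x_3)+w(x_2,x_4)=w(x_{\sigma(1)},x_{\sigma(2)})+w(x_{\sigma(3)},x_{\sigma(4)})$ holds only if either $w(x_1,x_3)+w(x_2,x_4)=\infty$, or $\delta_{x_1}+\delta_{x_3}=\delta_{x_{\sigma(1)}}+\delta_{x_{\sigma(2)}}$, or $\delta_{x_1}+\delta_{x_3}=\delta_{x_{\sigma(3)}}+\delta_{x_{\sigma(4)}}$. Seidl plan: for non-atomic $\rho\in\mathcal P([a,b])$, choose $a=d_0<d_1<\dots<d_n=b$ with $\rho([d_i,d_{i+1}])=1/n$ for $i=0,\dots,n-1$;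 let $T:I\to I$ be the ($\rho$-a.e. unique) map which is increasing on each $(d_i,d_{i+1})$ and satisfies $T^\#(\mathbb 1_{[d_i,d_{i+1}]}\rho)=\mathbb 1_{[d_{i+1},d_{i+2}]}\rho$ for $i=0,\dots,n-2$ and $T^\#(\mathbb 1_{[d_{n-1},d_n]}\rho)=\mathbb 1_{[d_0,d_1]}\rho$. Then $\gamma_\rho=(\mathrm{id},T,T^{(2)},\dots,T^{(n-1)})^\#\rho\in\Pi(\rho)$, where $T^{(k)}$ is the $k$-fold composition of $T$. *)

(* Defs.v *)
From HB Require Import structures.
From mathcomp Require Import all_boot all_order all_algebra all_fingroup.
From mathcomp Require Import all_classical all_reals all_analysis.
Import Order.TTheory GRing.Theory Num.Theory.
Import numFieldNormedType.Exports.
Local Open Scope classical_set_scope.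
Local Open Scope ring_scope.

Section Defs.
Context {R : realType}.
Local Open Scope ereal_scope.

(* rho is (the extension by zero to R of) a Borel probability measure on I=[a,b] *)
Definition prob_on (a b : R) (rho : probability R R) : Prop :=
  rho `[a, b]%classic = 1.

Definition nonatomic (rho : probability R R) : Prop :=
  forall x : R, rho [set x] = 0.

Definition coord (n : nat) (i : 'I_n) : n.-tuple R -> R := fun x => tnth x i.

Definition Ibox (a b : R) (n : nat) : set (n.-tuple R) :=
  [set x | forall i : 'I_n, tnth x i \in `[a, b]%R].

Definition cost_fun (w : R -> R -> \bar R) (n : nat) (x : n.-tuple R) : \bar R :=
  \sum_(p : 'I_n * 'I_n | p.1 != p.2) w (tnth x p.1) (tnth x p.2).

Definition Pi (n : nat) (rho : probability R R)
    (g : {measure set (n.-tuple R) -> \bar R}) : Prop :=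
  forall (i : 'I_n) (A : set R), measurable A -> g (coord n i @^-1` A) = rho A.

Definition cost (a b : R) (w : R -> R -> \bar R) (n : nat)
    (g : {measure set (n.-tuple R) -> \bar R}) : \bar R :=
  \int[g]_(x in Ibox a b n) cost_fun w n x.

Definition F_OT (a b : R) (w : R -> R -> \bar R) (n : nat) (rho : probability R R)
  : \bar R :=
  ereal_inf [set cost a b w n g | g in [set g : {measure set (n.-tuple R) -> \bar R} | Pi n rho g]].

Definition is_minimizer (a b : R) (w : R -> R -> \bar R) (n : nat)
    (rho : probability R R) (g : {measure set (n.-tuple R) -> \bar R}) : Prop :=
  Pi n rho g /\ cost a b w n g = F_OT a b w n rho.

Definition is_seidl_map (a b : R) (n : nat) (rho : probability R R) (T : R -> R)
  : Prop :=
  exists d : nat -> R,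
    [/\ d 0%N = a, d n = b,
        (forall i, (i < n)%N -> (d i < d i.+1)%R),
        (forall i, (i < n)%N -> rho `[d i, d i.+1]%classic = (n%:R^-1)%:E) &
      [/\ (forall x, x \in `[a, b]%R -> T x \in `[a, b]%R),
          measurable_fun setT T,
          (forall i, (i < n)%N -> {in `](d i), (d i.+1)[%R &, {homo T : x y / (x <= y)%R}}),
          (forall i, (i.+2 <= n)%N -> forall A : set R, measurable A ->
             rho (`[d i, d i.+1]%classic `&` T @^-1` A)
             = rho (`[d i.+1, d i.+2]%classic `&` A)) &
          (forall A : set R, measurable A ->
             rho (`[d n.-1, d n]%classic `&` T @^-1` A)
             = rho (`[d 0%N, d 1%N]%classic `&` A))]].

Definition seidl_tuple (n : nat) (T : R -> R) (x : R) : n.-tuple R :=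
  [tuple iter i T x | i < n].

Definition is_seidl_plan (n : nat) (rho : probability R R) (T : R -> R)
    (g : {measure set (n.-tuple R) -> \bar R}) : Prop :=
  forall A : set (n.-tuple R), measurable A -> g A = rho (seidl_tuple n T @^-1` A).

Definition perm_tuple (n : nat) (s : {perm 'I_n}) (x : n.-tuple R) : n.-tuple R :=
  [tuple tnth x (s i) | i < n].

Definition symmetric_measure (n : nat) (g : {measure set (n.-tuple R) -> \bar R})
  : Prop :=
  forall (s : {perm 'I_n}) (A : set (n.-tuple R)), measurable A ->
    g (perm_tuple n s @^-1` A) = g A.

Definition is_seidl_symmetrization (n : nat) (rho : probability R R) (T : R -> R)
    (g : {measure set (n.-tuple R) -> \bar R}) : Prop :=
  forall A : set (n.-tuple R), measurable A ->
    g A = ((n`!%:R)^-1)%:E *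
          \sum_(s : {perm 'I_n}) rho (seidl_tuple n T @^-1` (perm_tuple n s @^-1` A)).

Definition pts4 (x1 x2 x3 x4 : R) (i : 'I_4) : R := nth 0%R [:: x1; x2; x3; x4] i.

Definition well_ordering (a b : R) (w : R -> R -> \bar R) : Prop :=
  forall x1 x2 x3 x4 : R,
    x1 \in `[a, b]%R -> x2 \in `[a, b]%R -> x3 \in `[a, b]%R -> x4 \in `[a, b]%R ->
    (x1 <= x2)%R -> (x2 <= x3)%R -> (x3 <= x4)%R ->
    w x1 x3 + w x2 x4 =
    \big[Order.min/+oo]_(s : {perm 'I_4})
       (w (pts4 x1 x2 x3 x4 (s (inord 0))) (pts4 x1 x2 x3 x4 (s (inord 1)))
      + w (pts4 x1 x2 x3 x4 (s (inord 2))) (pts4 x1 x2 x3 x4 (s (inord 3)))).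

Definition strictly_well_ordering (a b : R) (w : R -> R -> \bar R) : Prop :=
  well_ordering a b w /\
  forall x1 x2 x3 x4 : R,
    x1 \in `[a, b]%R -> x2 \in `[a, b]%R -> x3 \in `[a, b]%R -> x4 \in `[a, b]%R ->
    (x1 <= x2)%R -> (x2 <= x3)%R -> (x3 <= x4)%R ->
    forall s : {perm 'I_4},
    let y := fun k => pts4 x1 x2 x3 x4 (s (inord k)) in
    w x1 x3 + w x2 x4 = w (y 0%N) (y 1%N) + w (y 2%N) (y 3%N) ->
    [\/ w x1 x3 + w x2 x4 = +oo,
        (forall A : set R, measurable A ->
           @dirac _ _ x1 R A + @dirac _ _ x3 R A = \d_(y 0%N) A + \d_(y 1%N) A) |
        (forall A : set R, measurable A ->
           @dirac _ _ x1 R A + @dirac _ _ x3 R A = \d_(y 2%N) A + \d_(y 3%N) A)].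

End Defs.

(* Main.v *)
Require Import Defs.
From HB Require Import structures.
From mathcomp Require Import all_boot all_order all_algebra all_fingroup.
From mathcomp Require Import all_classical all_reals all_analysis.
From mathcomp Require Import measurable_realfun ring lra zify.
Import Order.TTheory GRing.Theory Num.Theory.
Import numFieldNormedType.Exports.
Local Open Scope classical_set_scope.
Local Open Scope ring_scope.

(** After clamping its arguments to [[a, b]] and adding a constant, [w] is continuous,
    symmetric and nonnegative on the plane, and well-ordering says that crossing
    pairs are cheapest: [w x1 x3 + w x2 x4] is at most [w x1 x2 + w x3 x4] and
    [w x1 x4 + w x2 x3] whenever [x1 <= x2 <= x3 <= x4].

    On a finite grid, summation by parts writes the cost of a configuration as an
    affine function of the counts [N_p = #{i | x_i <= z_p}] plus a nonnegative
    combination of the squares [N_p ^ 2] and [(N_p - N_q) ^ 2].  Replacing each square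
    by one of its integer chords gives a lower bound that is affine in the counts,
    hence depends on the marginal only, with equality when the counts and their
    differences take two consecutive values.  The Seidl plan has this property for
    every threshold.  For a general competitor one discretizes it on small boxes,
    transports the Seidl plan to the discretized marginal by its quantile function,
    and lets the mesh tend to zero with Fatou's lemma.

    Conversely, optimality for [n = 2] and a uniform measure on four short intervals
    forces the crossing inequalities by continuity.

    For uniqueness, draw two independent samples of a minimizer, sort their [2 n]
    points and deal them out alternately: this does not increase the total cost, so
    strictness forces any two samples to interleave almost surely.  Then the events
    [N_s > k] are nested up to null sets and their probabilities are determined by
    the marginal, which determines the law of the ordered sample. *)

(** * Affine lower bounds for the cost on a finite index set *)

(** The cost may be infinite on the diagonal and at the endpoint [b], whereas the finite bound needs
    real values. On a grid the value [+oo] is therefore replaced by a constant [K] exceeding every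
    sum of two costs between distinct grid points: the crossing inequalities survive, the modified
    cost stays below the true one at the competitor, and the two agree on configurations of distinct
    points below [b]. This needs a cost that is finite off the diagonal, which is extracted from the
    finiteness of the optimal cost for non-atomic measures strongly concentrated near one point.

    The affine bound sees a discretized competitor only through the average of its marginals. These
    may therefore differ from one another, and no discrete optimal plan has to be constructed. The
    same bound, with chords placed at half the merged counts, compares two configurations with their
    uncrossed versions, so optimality and uniqueness rest on one computation. *)

Section FiniteDual.
Context {R : realType} (v : nat -> nat -> R) (n L : nat).
Implicit Types (j : 'I_n -> nat) (p q : nat).

Definition nle j p : nat := (\sum_(i < n) (j i <= p))%N.

(** For [p < q] its sign is the crossing inequality at the indices [p], [p + 1], [q], [q + 1], with
    the outer and inner pairs as the dearer pairing. *)
Definition mixed_diff p q := v p q - v p.+1 q - v p q.+1 + v p.+1 q.+1.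

(** The crossing inequality at [0], [p], [p + 1], [L]; as a row sum of [mixed_diff] it becomes the
    coefficient of the square of the count at [p]. *)
Definition edge_diff p := v p 0%N + v p.+1 L - v p.+1 0%N - v p L.

Definition index_cost j := \sum_(i : 'I_n * 'I_n | i.1 != i.2) v (j i.1) (j i.2).

Lemma telescope_le (h : nat -> R) k : (k <= L)%N ->
  h k = h L + \sum_(p < L) (h p - h p.+1) * (k <= p)%:R.
Proof.
elim: L => [|M IH]; first by rewrite leqn0 => /eqP ->; rewrite big_ord0 addr0.
rewrite leq_eqVlt ltnS => /orP[/eqP ->|kM].
  rewrite big1 ?addr0// => -[p pM] _ /=.
  by rewrite leqNgt pM mulr0.
rewrite big_ord_recr /= kM (IH kM) mulr1; ring.
Qed.

Lemma sum_telescope_le (h : nat -> R) j : (forall i, (j i <= L)%N) ->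
  \sum_(i < n) h (j i) = n%:R * h L + \sum_(p < L) (h p - h p.+1) * (nle j p)%:R.
Proof.
move=> jL; under eq_bigr => i _ do rewrite (telescope_le h _ (jL i)).
rewrite big_split /= sumr_const card_ord -[h L *+ n]mulr_natl; congr (_ + _).
rewrite exchange_big /=; apply: eq_bigr => p _.
by rewrite -mulr_sumr /nle natr_sum.
Qed.

Hypothesis vC : forall p q, v p q = v q p.

(** Telescoping in both variables from the last index; summed over the entries, the indicators
    become counts. *)
Lemma mixed_decomposition k l : (k <= L)%N -> (l <= L)%N ->
  v k l = v L l + v k L - v L L +
    \sum_(p < L) \sum_(q < L) mixed_diff p q * (k <= p)%:R * (l <= q)%:R.
Proof.
move=> kL lL; rewrite (telescope_le (v ^~ l) _ kL) -addrA -addrA; congr (_ + _).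
rewrite (telescope_le (v ^~ L) _ kL) [LHS](_ : _ = \sum_(p < L)
    ((v p L - v p.+1 L) * (k <= p)%:R + \sum_(q < L) mixed_diff p q * (k <= p)%:R * (l <= q)%:R)).
  by rewrite big_split /=; ring.
apply: eq_bigr => p _.
have := telescope_le (fun x => v p x - v p.+1 x) _ lL => /= ->.
rewrite mulrDl; congr (_ + _); rewrite mulr_suml; apply: eq_bigr => q _.
rewrite /mixed_diff; ring.
Qed.

Lemma mixed_diffC p q : mixed_diff p q = mixed_diff q p.
Proof.
rewrite /mixed_diff (vC p q) (vC p.+1 q) (vC p q.+1) (vC p.+1 q.+1); ring.
Qed.

(** Telescoping absorbs the diagonal term [q = p], to which the sign condition on [mixed_diff] does
    not apply. *)
Lemma sum_mixed_diff p : \sum_(q < L) mixed_diff p q = edge_diff p.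
Proof.
rewrite /edge_diff; elim: L => [|M IH]; first by rewrite big_ord0; ring.
rewrite big_ord_recr /= IH /mixed_diff; ring.
Qed.

(** Polarization, [N_p N_q = (N_p ^ 2 + N_q ^ 2 - (N_p - N_q) ^ 2) / 2], turns the bilinear form in
    the counts into squares; the row sums of [mixed_diff] supply the coefficients [edge_diff]. *)
Lemma index_cost_quadratic : exists C (be : nat -> R), forall j, (forall i, (j i <= L)%N) ->
  index_cost j = C + \sum_(p < L) be p * (nle j p)%:R
    + \sum_(p < L) edge_diff p * (nle j p)%:R ^+ 2
    + 2^-1 * \sum_(p < L) \sum_(q < L) - mixed_diff p q * ((nle j p)%:R - (nle j q)%:R) ^+ 2.
Proof.
(* [h] gathers what a single entry contributes: the boundary terms of the double telescoping and the
   diagonal term omitted by a sum over distinct indices. *)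
pose h k := 2 * n%:R * v k L - v k k.
exists (n%:R * h L - n%:R ^+ 2 * v L L), (fun p => h p - h p.+1) => j jL.
have diagE : index_cost j = \sum_(i < n) \sum_(i' < n) v (j i) (j i') - \sum_(i < n) v (j i) (j i).
  apply/eqP; rewrite eq_sym subr_eq; apply/eqP.
  rewrite pair_big /= (bigID (fun i : 'I_n * 'I_n => i.1 != i.2)) /=; congr (_ + _).
  under eq_bigl => i do rewrite negbK.
  rewrite -(pair_big_dep predT (fun i i' => i == i') (fun i i' => v (j i) (j i'))) /=.
  by apply: eq_bigr => i _; rewrite (eq_bigl (pred1 i)) ?big_pred1_eq// => i'; rewrite eq_sym.
have quadE : \sum_(i < n) \sum_(i' < n) v (j i) (j i') =
    2 * n%:R * \sum_(i < n) v (j i) L - n%:R ^+ 2 * v L L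
    + \sum_(p < L) \sum_(q < L) mixed_diff p q * (nle j p)%:R * (nle j q)%:R.
  rewrite (eq_bigr (fun i => \sum_(i' < n) v L (j i') + n%:R * (v (j i) L - v L L) +
     \sum_(p < L) \sum_(q < L) mixed_diff p q * (j i <= p)%:R * (nle j q)%:R)); last first.
    move=> i _; under eq_bigr => i' _ do rewrite (mixed_decomposition _ _ (jL i) (jL i')) -!addrA.
    rewrite big_split /= -addrA; congr (_ + _).
    under eq_bigr => i' _ do rewrite addrA.
    rewrite big_split /= sumr_const card_ord -[(_ - _) *+ n]mulr_natl; congr (_ + _).
    rewrite exchange_big /=; apply: eq_bigr => p _; rewrite exchange_big /=.
    by apply: eq_bigr => q _; rewrite -mulr_sumr /nle natr_sum.
  rewrite !big_split /= sumr_const card_ord -[(\sum_(_ < n) _) *+ n]mulr_natl; congr (_ + _).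
    rewrite -mulr_sumr sumrB sumr_const card_ord -[v L L *+ n]mulr_natl.
    under eq_bigr => i _ do rewrite vC; ring.
  rewrite exchange_big /=; apply: eq_bigr => p _; rewrite exchange_big /=.
  apply: eq_bigr => q _; by rewrite -mulr_suml -mulr_sumr /nle !natr_sum.
have sqE : \sum_(p < L) \sum_(q < L) mixed_diff p q * (nle j p)%:R * (nle j q)%:R =
    \sum_(p < L) edge_diff p * (nle j p)%:R ^+ 2
    + 2^-1 * \sum_(p < L) \sum_(q < L) - mixed_diff p q * ((nle j p)%:R - (nle j q)%:R) ^+ 2.
  have half : \sum_(p < L) edge_diff p * (nle j p)%:R ^+ 2 =
      2^-1 * (\sum_(p < L) \sum_(q < L) mixed_diff p q * (nle j p)%:R ^+ 2 +
              \sum_(p < L) \sum_(q < L) mixed_diff p q * (nle j q)%:R ^+ 2).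
    rewrite [X in _ + X]exchange_big /=.
    rewrite [X in _ + X](eq_bigr (fun q : 'I_L => \sum_(p < L) mixed_diff q p * (nle j q)%:R ^+ 2)); last first.
      by move=> q _; apply: eq_bigr => p _; rewrite mixed_diffC.
    under [in RHS]eq_bigr => p _ do rewrite -mulr_suml sum_mixed_diff.
    by field.
  rewrite half -mulrDr -!big_split /= mulr_sumr; apply: eq_bigr => p _.
  rewrite -!big_split /= mulr_sumr; apply: eq_bigr => q _; by field.
have := sum_telescope_le h j jL; rewrite {1}/h sumrB -mulr_sumr => hE.
rewrite diagE quadE sqE; lra.
Qed.

Hypothesis edge_ge0 : forall p, (p < L)%N -> 0 <= edge_diff p.
Hypothesis mixed_le0 : forall p q, (p < L)%N -> (q < L)%N -> p != q -> mixed_diff p q <= 0.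

Definition consecutive (m k : int) := (k == m) || (k == m + 1).

Definition balanced (m1 : nat -> int) (m2 : nat -> nat -> int) j :=
  (forall p, (p < L)%N -> consecutive (m1 p) (nle j p)%:Z) /\
  (forall p q, (p < L)%N -> (q < L)%N -> p != q ->
     consecutive (m2 p q) ((nle j p)%:Z - (nle j q)%:Z)).

(* The chord of [k ^ 2] between the consecutive integers [m] and [m + 1]; it lies
   below [k ^ 2] at every integer. *)
Definition sq_chord (m : int) (x : R) := (2 * m%:~R + 1) * x - m%:~R * (m%:~R + 1).

(** The gap is a product of two consecutive integers; this is where integrality of the counts
    enters. *)
Lemma sq_chord_eq m (k : int) : k%:~R ^+ 2 - sq_chord m k%:~R = ((k - m) * (k - m - 1))%:~R.
Proof. rewrite /sq_chord !(intrM,intrD,intrB); ring. Qed.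

Lemma sq_chord_le m (k : int) : sq_chord m k%:~R <= k%:~R ^+ 2.
Proof.
rewrite -subr_ge0 sq_chord_eq ler0z; have [?|?] : k - m <= 0 \/ 1 <= k - m by lia.
- by rewrite mulr_le0 //; lia.
- by rewrite mulr_ge0 //; lia.
Qed.

Lemma consecutive_sq_chord m (k : int) :
  consecutive m k = (k%:~R ^+ 2 - sq_chord m k%:~R <= 0 :> R).
Proof.
rewrite sq_chord_eq lerz0 /consecutive; apply/idP/idP.
- by move=> /orP[]/eqP ->; lia.
- apply: contraTT => /norP[/eqP km /eqP km1]; rewrite -ltNge.
  have [?|?] : k - m < 0 \/ 1 < k - m by lia.
  + by rewrite nmulr_rgt0 //; lia.
  + by rewrite mulr_gt0 //; lia.
Qed.

(** The cost is an affine function of the counts plus [defect], a nonnegative combination of gaps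
    between squares and chords. The free choice of [m1] and [m2] selects the configurations at which
    the bound is attained. *)
Lemma dual_index_cost (m1 : nat -> int) (m2 : nat -> nat -> int) :
  exists C (be : nat -> R),
  [/\ forall j, (forall i, (j i <= L)%N) ->
        C + \sum_(p < L) be p * (nle j p)%:R <= index_cost j,
      forall j, (forall i, (j i <= L)%N) -> balanced m1 m2 j ->
        index_cost j = C + \sum_(p < L) be p * (nle j p)%:R &
      (forall p, (p < L)%N -> 0 < edge_diff p) ->
      (forall p q, (p < L)%N -> (q < L)%N -> p != q -> mixed_diff p q < 0) ->
      forall j, (forall i, (j i <= L)%N) ->
        index_cost j <= C + \sum_(p < L) be p * (nle j p)%:R -> balanced m1 m2 j].
Proof.
have [C [be cE]] := index_cost_quadratic.
pose z (a : nat) : R := (a%:Z)%:~R.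
pose defect j := \sum_(p < L) edge_diff p * (z (nle j p) ^+ 2 - sq_chord (m1 p) (z (nle j p)))
  + 2^-1 * \sum_(p < L) \sum_(q < L | p != q)
      - mixed_diff p q * (((nle j p)%:Z - (nle j q)%:Z)%:~R ^+ 2 -
           sq_chord (m2 p q) ((nle j p)%:Z - (nle j q)%:Z)%:~R).
(* A chord evaluated at [N_p - N_q] is affine in both counts, so the coefficient of [N_p] collects
   the terms with [p] as first index minus those with [p] as second index. *)
have chord_affine : exists C' (be' : nat -> R), forall j,
  C' + \sum_(p < L) be' p * (nle j p)%:R =
  \sum_(p < L) edge_diff p * sq_chord (m1 p) (z (nle j p))
  + 2^-1 * \sum_(p < L) \sum_(q < L | p != q)
      - mixed_diff p q * sq_chord (m2 p q) ((nle j p)%:Z - (nle j q)%:Z)%:~R.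
  pose c1 p := edge_diff p * (2 * (m1 p)%:~R + 1).
  pose c2 p q := - mixed_diff p q * (2 * (m2 p q)%:~R + 1).
  pose k1 p := - (edge_diff p * ((m1 p)%:~R * ((m1 p)%:~R + 1))).
  pose k2 p q := - (- mixed_diff p q * ((m2 p q)%:~R * ((m2 p q)%:~R + 1))).
  exists (\sum_(p < L) k1 p + 2^-1 * \sum_(p < L) \sum_(q < L | p != q) k2 p q).
  exists (fun p => c1 p + 2^-1 * (\sum_(q < L | p != q :> nat) c2 p q
                                  - \sum_(q < L | q != p :> nat) c2 q p)) => j.
  have -> : \sum_(p < L) (c1 p + 2^-1 * (\sum_(q < L | p != q :> nat) c2 p q
       - \sum_(q < L | q != p :> nat) c2 q p)) * (nle j p)%:R =
     \sum_(p < L) c1 p * (nle j p)%:R + 2^-1 * \sum_(p < L) \sum_(q < L | p != q)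
         c2 p q * ((nle j p)%:R - (nle j q)%:R).
    rewrite [X in _ + _ * X](_ : _ = \sum_(p < L) \sum_(q < L | p != q) c2 p q * (nle j p)%:R
       - \sum_(p < L) \sum_(q < L | q != p) c2 q p * (nle j p)%:R).
      rewrite mulrBr !mulr_sumr -sumrB -big_split /=; apply: eq_bigr => p _.
      by rewrite -!mulr_suml; ring.
    rewrite [X in _ - X](exchange_big_dep xpredT) //= -sumrB; apply: eq_bigr => p _.
    by rewrite -sumrB; apply: eq_bigr => q _; ring.
  rewrite addrACA -big_split /= -mulrDr -big_split /=; congr (_ + _ * _).
    by apply: eq_bigr => p _; rewrite /k1 /c1 /sq_chord /z; ring.
  apply: eq_bigr => p _; rewrite -big_split /=; apply: eq_bigr => q _.
  by rewrite /k2 /c2 /sq_chord intrB; ring.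
have [C' [be' bE]] := chord_affine.
have costE j : (forall i, (j i <= L)%N) ->
    index_cost j = C + C' + \sum_(p < L) (be p + be' p) * (nle j p)%:R + defect j.
  move=> jL; rewrite cE //.
  under [in RHS]eq_bigr => p _ do rewrite mulrDl.
  rewrite big_split /= /defect.
  under [X in _ = _ + (X + _)]eq_bigr => p _ do rewrite mulrBr.
  rewrite sumrB.
  under [X in _ = _ + (_ + 2^-1 * X)]eq_bigr => p _ do
    (under eq_bigr => q _ do rewrite mulrBr; rewrite sumrB).
  rewrite sumrB.
  have -> : \sum_(p < L) \sum_(q < L) - mixed_diff p q * ((nle j p)%:R - (nle j q)%:R) ^+ 2 =
     \sum_(p < L) \sum_(q < L | p != q) - mixed_diff p q * ((nle j p)%:Z - (nle j q)%:Z)%:~R ^+ 2.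
    apply: eq_bigr => p _; rewrite (bigD1 p) //= subrr expr0n mulr0 add0r.
    by apply: eq_big => q; [rewrite eq_sym | rewrite intrB].
  have := bE j; rewrite /z; lra.
have term1_ge0 j p : (p < L)%N ->
    0 <= edge_diff p * (z (nle j p) ^+ 2 - sq_chord (m1 p) (z (nle j p))).
  by move=> pL; rewrite mulr_ge0 ?edge_ge0// subr_ge0 sq_chord_le.
have term2_ge0 j p q : (p < L)%N -> (q < L)%N -> p != q ->
    0 <= - mixed_diff p q * (((nle j p)%:Z - (nle j q)%:Z)%:~R ^+ 2 -
           sq_chord (m2 p q) ((nle j p)%:Z - (nle j q)%:Z)%:~R).
  by move=> pL qL pq; rewrite mulr_ge0 ?oppr_ge0 ?mixed_le0// subr_ge0 sq_chord_le.
exists (C + C'), (fun p => be p + be' p); split.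
- move=> j jL; rewrite costE // lerDl addr_ge0 //; first by apply: sumr_ge0 => p _; exact: term1_ge0.
  rewrite mulr_ge0 ?invr_ge0//; apply: sumr_ge0 => p _; apply: sumr_ge0 => q pq; exact: term2_ge0.
- move=> j jL [b1 b2]; rewrite costE // [defect j](_ : _ = 0) ?addr0//.
  have zero m (k : int) : consecutive m k -> k%:~R ^+ 2 - sq_chord m k%:~R = 0.
    by move=> H; apply/eqP; rewrite eq_le -consecutive_sq_chord H subr_ge0 sq_chord_le.
  rewrite /defect !big1 ?mulr0 ?addr0// => p _; last by rewrite zero ?mulr0// b1.
  by rewrite big1 // => q pq; rewrite zero ?mulr0// b2.
- move=> edge_gt0 mixed_lt0 j jL; rewrite costE // gerDl => dle0.
  have [s1 s2] : \sum_(p < L) edge_diff p * (z (nle j p) ^+ 2 - sq_chord (m1 p) (z (nle j p))) = 0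
    /\ \sum_(p < L) \sum_(q < L | p != q)
      - mixed_diff p q * (((nle j p)%:Z - (nle j q)%:Z)%:~R ^+ 2 -
           sq_chord (m2 p q) ((nle j p)%:Z - (nle j q)%:Z)%:~R) = 0.
    move: dle0; rewrite /defect.
    set S1 := (X in X + _ <= 0); set S2 := (X in _ + _ * X <= 0) => dle0.
    have S1_ge0 : 0 <= S1 by apply: sumr_ge0 => p _; exact: term1_ge0.
    have S2_ge0 : 0 <= S2 by apply: sumr_ge0 => p _; apply: sumr_ge0 => q pq; exact: term2_ge0.
    rewrite -/S1 -/S2; move: (S1 : R) (S2 : R) dle0 S1_ge0 S2_ge0 => s1 s2 ? ? ?; split; lra.
  split => [p pL|p q pL qL pq].
    have := psumr_eq0P (P := xpredT) (fun (i : 'I_L) _ => term1_ge0 j i (ltn_ord i)) s1.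
    move=> /(_ (Ordinal pL) isT)/eqP; rewrite mulf_eq0 gt_eqF ?edge_gt0//= => /eqP H.
    by rewrite consecutive_sq_chord H.
  have := psumr_eq0P (P := xpredT) (fun (i : 'I_L) _ => sumr_ge0 _ (fun (k : 'I_L) ik =>
     term2_ge0 j i k (ltn_ord i) (ltn_ord k) ik)) s2.
  move=> /(_ (Ordinal pL) isT) s3.
  have := psumr_eq0P (fun (k : 'I_L) ik => term2_ge0 j p k pL (ltn_ord k) ik) s3.
  move=> /(_ (Ordinal qL) pq)/eqP; rewrite mulf_eq0 oppr_eq0 lt_eqF ?mixed_lt0//= => /eqP H.
  by rewrite consecutive_sq_chord H.
Qed.

End FiniteDual.

(** * Crossing inequalities and bounds on a grid of points *)

Definition cnt {R : realType} (x : seq R) (s : R) : nat := count (fun y => y <= s) x.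

Definition crossing_minimal {R : realType} (w : R -> R -> \bar R) :=
  forall x1 x2 x3 x4 : R, x1 <= x2 -> x2 <= x3 -> x3 <= x4 ->
  (w x1 x3 + w x2 x4 <= w x1 x2 + w x3 x4)%E /\
  (w x1 x3 + w x2 x4 <= w x1 x4 + w x2 x3)%E.

(** Strictness is demanded only where the two pairings differ: [x2 = x3] identifies those of the
    first inequality, [x1 = x2] or [x3 = x4] those of the second. It is confined to [[a, b]] because
    clamping destroys it outside. *)
Definition crossing_strict {R : realType} (a b : R) (w : R -> R -> \bar R) :=
  forall x1 x2 x3 x4 : R, a <= x1 -> x1 <= x2 -> x2 <= x3 -> x3 <= x4 -> x4 <= b ->
  (w x1 x3 + w x2 x4 < +oo)%E ->
  (x2 < x3 -> (w x1 x3 + w x2 x4 < w x1 x2 + w x3 x4)%E) /\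
  (x1 < x2 -> x3 < x4 -> (w x1 x3 + w x2 x4 < w x1 x4 + w x2 x3)%E).

(** Only the value [+oo] is replaced; finite values above [K] are kept, so this is not a
    truncation. *)
Definition cap {R : realType} (w : R -> R -> \bar R) (K : R) (x y : R) : R :=
  if w x y == +oo%E then K else fine (w x y).

Definition cap_cost {R : realType} (w : R -> R -> \bar R) (K : R) n (x : n.-tuple R) : R :=
  \sum_(i : 'I_n * 'I_n | i.1 != i.2) cap w K (tnth x i.1) (tnth x i.2).

Section DualCost.
Context {R : realType} (a b : R) (w : R -> R -> \bar R).
Hypothesis wC : forall x y, w x y = w y x.
Hypothesis w_ge0 : forall x y, (0 <= w x y)%E.
Hypothesis w_cross : crossing_minimal w.
Hypothesis w_fin : forall x y, a <= x -> x < y -> y < b -> (w x y < +oo)%E.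

Lemma cap_le K (x y : R) : 0 <= K -> ((cap w K x y)%:E <= w x y)%E.
Proof.
move=> K0; rewrite /cap; case: ifPn => [/eqP ->|woo]; first by rewrite leey.
by rewrite fineK // ge0_fin_numE // lt_neqAle woo leey.
Qed.

Lemma cap_ge0 K (x y : R) : 0 <= K -> 0 <= cap w K x y.
Proof. by move=> K0; rewrite /cap; case: ifP => // _; exact: fine_ge0. Qed.

Lemma cap_fin K (x y : R) : (w x y < +oo)%E -> (cap w K x y)%:E = w x y.
Proof.
move=> wf; rewrite /cap; case: ifPn => [/eqP woo|_]; first by rewrite woo ltxx in wf.
by rewrite fineK // ge0_fin_numE.
Qed.

Lemma capC K (x y : R) : cap w K x y = cap w K y x.
Proof. by rewrite /cap wC. Qed.

(** An infinite value on the right is replaced by [K], which exceeds the left-hand side; without one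
    nothing has changed. *)
Lemma cap_add_le K (x1 y1 x2 y2 x3 y3 x4 y4 : R) :
  (w x1 y1 < +oo)%E -> (w x2 y2 < +oo)%E ->
  cap w K x1 y1 + cap w K x2 y2 < K -> 0 <= K ->
  (w x1 y1 + w x2 y2 <= w x3 y3 + w x4 y4)%E ->
  cap w K x1 y1 + cap w K x2 y2 <= cap w K x3 y3 + cap w K x4 y4.
Proof.
move=> f1 f2 ltK K0.
have [/eqP w3|w3] := boolP (w x3 y3 == +oo%E).
  by move=> _; rewrite (le_trans (ltW ltK))// {1}/cap w3 eqxx lerDl cap_ge0.
have [/eqP w4|w4] := boolP (w x4 y4 == +oo%E).
  by move=> _; rewrite (le_trans (ltW ltK))// {2}/cap w4 eqxx lerDr cap_ge0.
rewrite -(cap_fin K x1 y1) // -(cap_fin K x2 y2) // -(cap_fin K x3 y3); last first.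
  by rewrite lt_neqAle w3 leey.
rewrite -(cap_fin K x4 y4); last by rewrite lt_neqAle w4 leey.
by rewrite -!EFinD lee_fin.
Qed.

Lemma cap_add_lt K (x1 y1 x2 y2 x3 y3 x4 y4 : R) :
  (w x1 y1 < +oo)%E -> (w x2 y2 < +oo)%E ->
  cap w K x1 y1 + cap w K x2 y2 < K -> 0 <= K ->
  (w x1 y1 + w x2 y2 < w x3 y3 + w x4 y4)%E ->
  cap w K x1 y1 + cap w K x2 y2 < cap w K x3 y3 + cap w K x4 y4.
Proof.
move=> f1 f2 ltK K0.
have [/eqP w3|w3] := boolP (w x3 y3 == +oo%E).
  by move=> _; rewrite (lt_le_trans ltK)// {1}/cap w3 eqxx lerDl cap_ge0.
have [/eqP w4|w4] := boolP (w x4 y4 == +oo%E).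
  by move=> _; rewrite (lt_le_trans ltK)// {2}/cap w4 eqxx lerDr cap_ge0.
rewrite -(cap_fin K x1 y1) // -(cap_fin K x2 y2) // -(cap_fin K x3 y3); last first.
  by rewrite lt_neqAle w3 leey.
rewrite -(cap_fin K x4 y4); last by rewrite lt_neqAle w4 leey.
by rewrite -!EFinD lte_fin.
Qed.

Section Grid.
Variable z : seq R.
Hypothesis z_sorted : sorted <%R z.
Hypothesis z_ge : forall x, x \in z -> a <= x.
Hypothesis z_lt : forall x, x \in z -> x < b.
Let L := (size z).-1.

Let zn_lt p q : (p < q)%N -> (q < size z)%N -> z`_p < z`_q.
Proof. by move=> pq qz; rewrite (lt_sorted_ltn_nth 0) // inE// (ltn_trans pq). Qed.

Let zn_le p q : (p <= q)%N -> (q < size z)%N -> z`_p <= z`_q.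
Proof. by rewrite leq_eqVlt => /orP[/eqP ->//|pq qz]; rewrite ltW// zn_lt. Qed.

Let wz_fin p q : (p < q)%N -> (q < size z)%N -> (w z`_p z`_q < +oo)%E.
Proof.
move=> pq qz; apply: w_fin; [|exact: zn_lt|].
- by rewrite z_ge// mem_nth// (ltn_trans pq).
- by rewrite z_lt// mem_nth.
Qed.

(** The factor 2 leaves room for two costs, possibly the same one, and the summand 1 makes the bound
    strict. Infinite diagonal values are sent to 0 by [fine]; only costs between distinct grid
    points have to be dominated. *)
Definition grid_bound : R :=
  1 + \sum_(p < size z) \sum_(q < size z) 2 * fine (w z`_p z`_q).

Lemma grid_bound_ge0 : 0 <= grid_bound.
Proof.
rewrite addr_ge0 //; apply: sumr_ge0 => p _; apply: sumr_ge0 => q _.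
by rewrite mulr_ge0// fine_ge0.
Qed.

Lemma grid_bound_gt K p q p' q' : grid_bound <= K ->
  (p < q)%N -> (q < size z)%N -> (p' < q')%N -> (q' < size z)%N ->
  cap w K z`_p z`_q + cap w K z`_p' z`_q' < K.
Proof.
move=> leK pq qz pq' qz'.
have half i k : (i < k)%N -> (k < size z)%N ->
    2 * cap w K z`_i z`_k <= \sum_(p < size z) \sum_(q < size z) 2 * fine (w z`_p z`_q).
  move=> ik kz; have iz := ltn_trans ik kz.
  rewrite (bigD1 (Ordinal iz)) //= (bigD1 (Ordinal kz)) //=.
  have -> : cap w K z`_i z`_k = fine (w z`_i z`_k).
    by apply: EFin_inj; rewrite cap_fin ?wz_fin// fineK// ge0_fin_numE// wz_fin.
  rewrite -addrA lerDl addr_ge0 ?sumr_ge0// => *; rewrite ?sumr_ge0 // => *.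
    by rewrite mulr_ge0// fine_ge0.
  by rewrite mulr_ge0// fine_ge0.
move: leK (half _ _ pq qz) (half _ _ pq' qz'); rewrite /grid_bound; lra.
Qed.

Definition zv K p q := cap w K z`_p z`_q.

(** The cheap pairing joins [z_0] to [z_(p+1)] and [z_p] to [z_L], distinct points of finite cost;
    the other one meets the diagonal when [p = 0] or [p + 1 = L]. *)
Lemma zv_edge_ge0 K p : grid_bound <= K -> (p < L)%N -> 0 <= edge_diff (zv K) L p.
Proof.
move=> leK pL; have Lz : (L < size z)%N by move: pL; rewrite /L; lia.
have pz : (p.+1 < size z)%N by apply: leq_ltn_trans Lz.
rewrite /edge_diff -addrA -opprD subr_ge0 /zv (capC _ z`_p.+1) (capC _ z`_p z`_0).
apply: cap_add_le; rewrite ?wz_fin// ?grid_bound_gt//.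
  exact: le_trans grid_bound_ge0 leK.
have [] := w_cross z`_0 z`_p z`_p.+1 z`_L => //; apply: zn_le => //.
exact: ltn_trans pz.
Qed.

Lemma zv_mixed_lt_aux K p q : grid_bound <= K -> (p < q)%N -> (q < L)%N ->
  mixed_diff (zv K) p q <= 0.
Proof.
move=> leK pq qL; have Lz : (L < size z)%N by move: qL; rewrite /L; lia.
have qz : (q.+1 < size z)%N by apply: leq_ltn_trans Lz.
have qz' : (q < size z)%N by apply: ltn_trans qz.
rewrite [mixed_diff _ _ _](_ : _ =
   (zv K p q + zv K p.+1 q.+1) - (zv K p q.+1 + zv K p.+1 q)); last first.
  by rewrite /mixed_diff; ring.
rewrite subr_le0 /zv; apply: cap_add_le; rewrite ?wz_fin// ?grid_bound_gt//.
  exact: le_trans grid_bound_ge0 leK.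
have [] := w_cross z`_p z`_p.+1 z`_q z`_q.+1 => //; apply: zn_le => //.
exact: leq_ltn_trans qz'.
Qed.

Lemma zvC K p q : zv K p q = zv K q p. Proof. exact: capC. Qed.

Lemma zv_mixed_le0 K p q : grid_bound <= K -> (p < L)%N -> (q < L)%N -> p != q ->
  mixed_diff (zv K) p q <= 0.
Proof.
move=> leK pL qL; rewrite neq_ltn => /orP[pq|qp]; first exact: zv_mixed_lt_aux.
rewrite mixed_diffC; last exact: zvC.
exact: zv_mixed_lt_aux.
Qed.

Hypothesis w_strict : crossing_strict a b w.

Lemma zv_edge_gt0 K p : grid_bound <= K -> (p < L)%N -> 0 < edge_diff (zv K) L p.
Proof.
move=> leK pL; have Lz : (L < size z)%N by move: pL; rewrite /L; lia.
have pz : (p.+1 < size z)%N by apply: leq_ltn_trans Lz.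
have z0 : (0 < size z)%N by apply: leq_ltn_trans pz.
rewrite /edge_diff -addrA -opprD subr_gt0 /zv (capC _ z`_p.+1) (capC _ z`_p z`_0).
apply: cap_add_lt; rewrite ?wz_fin// ?grid_bound_gt//.
  exact: le_trans grid_bound_ge0 leK.
have [||||||+ _] := w_strict z`_0 z`_p z`_p.+1 z`_L => //.
- by rewrite z_ge// mem_nth.
- by rewrite zn_le// (ltn_trans _ pz).
- exact: zn_le.
- exact: zn_le.
- by rewrite ltW// z_lt// mem_nth.
- by rewrite lte_add_pinfty ?wz_fin.
- by apply; exact: zn_lt.
Qed.

Lemma zv_mixed_lt_aux2 K p q : grid_bound <= K -> (p < q)%N -> (q < L)%N ->
  mixed_diff (zv K) p q < 0.
Proof.
move=> leK pq qL; have Lz : (L < size z)%N by move: qL; rewrite /L; lia.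
have qz : (q.+1 < size z)%N by apply: leq_ltn_trans Lz.
have qz' : (q < size z)%N by apply: ltn_trans qz.
have pz : (p < size z)%N by apply: ltn_trans qz'.
rewrite [mixed_diff _ _ _](_ : _ =
   (zv K p q + zv K p.+1 q.+1) - (zv K p q.+1 + zv K p.+1 q)); last first.
  by rewrite /mixed_diff; ring.
rewrite subr_lt0 /zv; apply: cap_add_lt; rewrite ?wz_fin// ?grid_bound_gt//.
  exact: le_trans grid_bound_ge0 leK.
have [||||||_] := w_strict z`_p z`_p.+1 z`_q z`_q.+1 => //.
- by rewrite z_ge// mem_nth.
- by rewrite zn_le// (leq_ltn_trans pq).
- exact: zn_le.
- exact: zn_le.
- by rewrite ltW// z_lt// mem_nth.
- by rewrite lte_add_pinfty ?wz_fin.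
- by apply; apply: zn_lt => //; exact: leq_ltn_trans qz'.
Qed.

Lemma zv_mixed_lt0 K p q : grid_bound <= K -> (p < L)%N -> (q < L)%N -> p != q ->
  mixed_diff (zv K) p q < 0.
Proof.
move=> leK pL qL; rewrite neq_ltn => /orP[pq|qp]; first exact: zv_mixed_lt_aux2.
rewrite mixed_diffC; last exact: zvC.
exact: zv_mixed_lt_aux2.
Qed.

End Grid.

Definition balanced_on (z : seq R) (m1 : nat -> int) (m2 : nat -> nat -> int) (x : seq R) :=
  (forall p, (p < (size z).-1)%N -> consecutive (m1 p) (cnt x z`_p)%:Z) /\
  (forall p q, (p < (size z).-1)%N -> (q < (size z).-1)%N -> p != q ->
     consecutive (m2 p q) ((cnt x z`_p)%:Z - (cnt x z`_q)%:Z)).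

Lemma nle_index (z : seq R) n (x : n.-tuple R) p : sorted <%R z -> (p < size z)%N ->
  {subset x <= z} -> nle n (fun i => index (tnth x i) z) p = cnt x z`_p.
Proof.
move=> zs pz xz; rewrite /nle /cnt -sum1_count big_tuple big_mkcond /=.
rewrite [RHS]big_mkcond /=; apply: eq_bigr => i _.
have iz : tnth x i \in z by rewrite xz// mem_tnth.
rewrite -{2}(nth_index 0 iz) (lt_sorted_leq_nth 0) ?inE ?index_mem//.
Qed.

(** Stated for arbitrary [m1] and [m2] because it is used twice: with the counts along a Seidl orbit
    for optimality, and with the halved counts of two merged configurations for uncrossing. *)
Lemma dual_cap_cost (z : seq R) (n : nat) (K : R) (m1 : nat -> int) (m2 : nat -> nat -> int) :
  sorted <%R z -> (forall x, x \in z -> a <= x) -> (forall x, x \in z -> x < b) ->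
  grid_bound z <= K ->
  exists C (be : nat -> R),
  [/\ forall x : n.-tuple R, {subset x <= z} ->
        C + \sum_(p < (size z).-1) be p * (cnt x z`_p)%:R <= cap_cost w K n x,
      forall x : n.-tuple R, {subset x <= z} -> balanced_on z m1 m2 x ->
        cap_cost w K n x = C + \sum_(p < (size z).-1) be p * (cnt x z`_p)%:R &
      crossing_strict a b w -> forall x : n.-tuple R, {subset x <= z} ->
        cap_cost w K n x <= C + \sum_(p < (size z).-1) be p * (cnt x z`_p)%:R ->
        balanced_on z m1 m2 x].
Proof.
move=> zs zge zlt leK.
have [C [be [H1 H2 H3]]] := dual_index_cost (zv z K) n (size z).-1 (zvC z K)
  (fun p => zv_edge_ge0 z zs zge zlt K p leK)
  (fun p q => zv_mixed_le0 z zs zge zlt K p q leK) m1 m2.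
pose idx (x : n.-tuple R) := (fun i => index (tnth x i) z).
have idx_le x : {subset x <= z} -> forall i, (idx x i <= (size z).-1)%N.
  move=> xz i; have := xz _ (mem_tnth i x); rewrite -index_mem => xiz.
  by rewrite /idx -ltnS prednK// (leq_ltn_trans _ xiz).
have costE x : {subset x <= z} -> index_cost (zv z K) n (idx x) = cap_cost w K n x.
  move=> xz; apply: eq_bigr => i _; rewrite /zv /idx !nth_index// xz// mem_tnth //.
have cntE (x : n.-tuple R) p : {subset x <= z} -> (p < (size z).-1)%N ->
    nle n (idx x) p = cnt x z`_p.
  by move=> xz pz; rewrite nle_index//; lia.
have sumE (x : n.-tuple R) : {subset x <= z} -> \sum_(p < (size z).-1) be p * (nle n (idx x) p)%:R =
   \sum_(p < (size z).-1) be p * (cnt x z`_p)%:R.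
  by move=> xz; apply: eq_bigr => p _; rewrite cntE.
have balE (x : n.-tuple R) : {subset x <= z} ->
    balanced n (size z).-1 m1 m2 (idx x) <-> balanced_on z m1 m2 x.
  move=> xz; split => -[b1 b2]; split=> [p pL|p q pL qL pq].
  - by rewrite -cntE// b1.
  - by rewrite -!cntE// b2.
  - by rewrite cntE// b1.
  - by rewrite !cntE// b2.
exists C, be; split.
- by move=> x xz; rewrite -sumE// -costE// H1// => i; exact: idx_le.
- move=> x xz /balE xb; rewrite -sumE// -costE// H2//; last exact: xb.
  by move=> i; exact: idx_le.
- move=> strict x xz; rewrite -sumE// -costE// => H; apply/balE => //; apply: H3 => //.
  + by move=> p pL; exact: zv_edge_gt0.
  + by move=> p q pL qL pq; exact: zv_mixed_lt0.
  + exact: idx_le.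
Qed.

End DualCost.

(** * Distribution functions and Seidl maps *)

Section NonatomicCdf.
Context {R : realType} (a b : R) (rho : probability R R).
Hypothesis rho_ab : prob_on a b rho.
Hypothesis rho_na : nonatomic rho.

Definition rho_cdf (s : R) : R := fine (rho `]-oo, s]%classic).
Local Notation F := rho_cdf.

Lemma rho_fin (A : set R) : measurable A -> rho A \is a fin_num.
Proof. by move=> mA; exact: fin_num_measure. Qed.

Lemma rho_cdfE s : rho `]-oo, s]%classic = (F s)%:E.
Proof. by rewrite fineK// rho_fin. Qed.

Lemma rho_cdf_nd : {homo F : x y / x <= y}.
Proof.
move=> x y xy; rewrite -lee_fin -!rho_cdfE; apply: le_measure; rewrite ?inE//.
by apply: subset_itv; rewrite // bnd_simp.
Qed.

Lemma rho_cdf_ge0 s : 0 <= F s.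
Proof. exact: fine_ge0. Qed.

Lemma rho_cdf_le1 s : F s <= 1.
Proof. by rewrite -lee_fin -rho_cdfE probability_le1. Qed.

Lemma rho_itvoc x y : x <= y -> rho `]x, y]%classic = (F y - F x)%:E.
Proof.
move=> xy.
have -> : `]x, y]%classic = `]-oo, y]%classic `\` `]-oo, x]%classic.
  apply/seteqP; split => t /=; rewrite !in_itv/=.
    by move=> /andP[xt ty]; split => //; apply/negP; rewrite -ltNge.
  by move=> [ty /negP]; rewrite -ltNge => ->.
rewrite measureD//; last by rewrite -ge0_fin_numE ?measure_ge0//; exact: rho_fin.
rewrite setIidr; last by apply: subset_itv; rewrite // bnd_simp.
by rewrite /= !rho_cdfE.
Qed.

Lemma rho_setU1 (A : set R) x : measurable A -> rho (A `|` [set x]) = rho A.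
Proof. by move=> mA; apply: measureU0 => //; exact: rho_na. Qed.

Lemma rho_itvcc x y : x <= y -> rho `[x, y]%classic = (F y - F x)%:E.
Proof.
move=> xy; rewrite -rho_itvoc// -(rho_setU1 `]x, y]%classic x)//.
by rewrite setUC setU1itv// bnd_simp.
Qed.

Lemma rho_itvco x y : x <= y -> rho `[x, y[%classic = (F y - F x)%:E.
Proof.
move=> xy; rewrite -rho_itvcc// -(rho_setU1 `[x, y[%classic y)//.
by rewrite setUitv1// bnd_simp.
Qed.

Lemma rho_itvNyo s : rho `]-oo, s[%classic = (F s)%:E.
Proof. by rewrite -rho_cdfE -(rho_setU1 `]-oo, s[%classic s)// setUitv1. Qed.

Lemma rho_out (A : set R) : measurable A -> (A `&` `[a, b]%classic = set0) -> rho A = 0%E.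
Proof.
move=> mA A0; have mI : measurable (`[a, b]%classic : set R) by [].
have : (rho (A `|` `[a, b]%classic) = rho A + rho `[a, b]%classic)%E by rewrite measureU.
rewrite rho_ab => H; apply/eqP; rewrite eq_le measure_ge0 andbT.
have : (rho (A `|` `[a, b]%classic) <= 1)%E by apply: probability_le1; exact: measurableU.
by rewrite H -[leRHS]add0e leeD2rE.
Qed.

Lemma rho_cdf_a : F a = 0.
Proof.
apply: EFin_inj; rewrite -rho_itvNyo rho_out// -subset0 => t [] /=; rewrite !in_itv/=; lra.
Qed.

Lemma rho_cdf_b : a <= b -> F b = 1.
Proof.
move=> ab; have := rho_itvcc a b ab; rewrite rho_cdf_a subr0 => H.
by apply: EFin_inj; rewrite -H -rho_ab.
Qed.

(** The intervals around [s] shrink to a point, which carries no mass; this is where atoms are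
    excluded. *)
Lemma rho_cdf_cont (s e : R) : 0 < e -> exists2 d : R, 0 < d & F (s + d) - F (s - d) < e.
Proof.
move=> e0; pose A (k : nat) : set R := `]s - k.+1%:R^-1, s + k.+1%:R^-1]%classic.
have mA k : measurable (A k) by rewrite /A.
have capA : \bigcap_k A k = [set s].
  apply/seteqP; split => [t|t ->] /=; last first.
    move=> k _; rewrite /A /= in_itv /= ltrBlDr ltrDl invr_gt0 ltr0n /=.
    by rewrite lerDl invr_ge0 ler0n.
  move=> tA; apply/eqP; apply: contraT => ts.
  have d0 : 0 < `|t - s| by rewrite normr_gt0 subr_eq0.
  have [k] := ltr_add_invr d0; rewrite add0r => kd.
  have := tA k I; rewrite /A /= in_itv/= => /andP[t1 t2].
  move: (k.+1%:R^-1) kd t1 t2 => q; rewrite ltNge => /negP kd t1 t2.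
  by case: kd; rewrite ler_norml; apply/andP; split; lra.
have cvgA : (rho \o A) @ \oo --> rho (\bigcap_k A k).
  apply: nonincreasing_cvg_mu => //.
  - by rewrite -ge0_fin_numE ?measure_ge0//; exact: (rho_fin _ (mA 0%N)).
  - by rewrite capA.
  - move=> k l kl; apply/subsetPset; apply: subset_itv; rewrite bnd_simp.
      by rewrite lerB// lef_pV2 ?posrE// ler_nat.
    by rewrite lerD2l lef_pV2 ?posrE// ler_nat.
rewrite capA rho_na in cvgA.
have /cvgA [N _ /(_ N (leqnn _))] : nbhs (0%E : \bar R) [set y | (y < e%:E)%E].
  apply: open_nbhs_nbhs; split; first exact: open_ereal_lt_ereal.
  by rewrite /= lte_fin.
rewrite /= /A rho_itvoc; last first.
  have : 0 < N.+1%:R^-1 :> R by rewrite invr_gt0.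
  by move: (N.+1%:R^-1) => q; lra.
by rewrite lte_fin => H; exists N.+1%:R^-1 => //; rewrite invr_gt0.
Qed.

(** Probability integral transform: by continuity [F] takes the value [c] at the supremum of the
    sublevel set, which is therefore a half-line of mass [c]. *)
Lemma rho_cdf_unif (c : R) : a <= b -> 0 <= c <= 1 -> rho [set x | F x <= c] = c%:E.
Proof.
move=> ab /andP[c0]; rewrite le_eqVlt => /orP[/eqP ->|c1].
  rewrite [X in rho X](_ : _ = setT) ?probability_setT//.
  by apply/seteqP; split => // x _; exact: rho_cdf_le1.
pose S := [set x | F x <= c].
have Sa : S a by rewrite /S /= rho_cdf_a.
have Sub x : S x -> x <= b.
  move=> Sx; rewrite leNgt; apply/negP => bx.
  by have := rho_cdf_nd _ _ (ltW bx); rewrite rho_cdf_b// => /le_trans/(_ Sx); lra.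
have hasS : has_sup S by split; [exists a|exists b => x; exact: Sub].
set s := sup S.
have Fs : F s = c.
  apply/eqP; rewrite -subr_eq0 -normr_le0; apply/ler_addgt0Pl => e e0.
  have [d d0 Fd] := rho_cdf_cont s e e0.
  have lo : F (s - d) <= c.
    have [x Sx /ltW sx] := sup_adherent d0 hasS.
    exact: le_trans (rho_cdf_nd _ _ sx) Sx.
  have hi : c < F (s + d).
    rewrite ltNge; apply/negP => /(ub_le_sup (proj2 hasS)); rewrite -/s; lra.
  have := rho_cdf_nd (s - d) s; have := rho_cdf_nd s (s + d).
  move=> /(_ ltac:(lra)) H1 /(_ ltac:(lra)) H2.
  rewrite addr0 ler_norml; apply/andP; split; lra.
rewrite -[X in X%:E]Fs -rho_cdfE; congr (rho _).
apply/seteqP; split => x /=; rewrite in_itv/= => xs.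
  by apply: ub_le_sup => //; exact: (proj2 hasS).
by rewrite -Fs; exact: rho_cdf_nd.
Qed.

Lemma measurable_rho_cdf : measurable_fun setT F.
Proof. by apply: nondecreasing_measurable => //; exact: rho_cdf_nd. Qed.

Lemma measurable_rho_cdf_le c : measurable [set x | F x <= c].
Proof.
rewrite [X in measurable X](_ : _ = setT `&` F @^-1` `]-oo, c]%classic).
  by apply: measurable_rho_cdf.
by rewrite setTI; apply/seteqP; split=> x /=; rewrite in_itv.
Qed.

(** The level set lies between the sublevel sets at [c - e] and [c], whose masses differ by [e].
    Flat pieces of [F], where quantiles are ambiguous, are thus negligible. *)
Lemma rho_cdf_level (c : R) : a <= b -> rho [set x | F x = c] = 0%E.
Proof.
move=> ab.
have mc : measurable [set x | F x = c].
  rewrite [X in measurable X](_ : _ = setT `&` F @^-1` [set c]).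
    by apply: measurable_rho_cdf.
  by rewrite setTI.
have [c01|c01] := boolP (0 <= c <= 1); last first.
  rewrite [X in rho X](_ : _ = set0) ?measure0//; apply/seteqP; split => // x /= Fx.
  by move: c01; rewrite -Fx rho_cdf_ge0 rho_cdf_le1.
apply/eqP; rewrite eq_le measure_ge0 andbT; apply/lee_addgt0Pr => e e0.
rewrite add0e.
have [ce|ce] := leP c e.
  rewrite (le_trans _ (_ : rho [set x | (F x <= c)%R] <= _)%E) //.
    by apply: le_measure; rewrite ?inE//; [exact: measurable_rho_cdf_le|move=> x /= ->].
  by rewrite rho_cdf_unif// lee_fin.
have c'01 : 0 <= c - e <= 1 by lra.
have : (rho [set x | F x = c] + rho [set x | (F x <= c - e)%R] <= rho [set x | (F x <= c)%R])%E.
  rewrite -measureU//; last 2 first.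
  - exact: measurable_rho_cdf_le.
  - by rewrite -subset0 => x [/= -> ]; lra.
  apply: le_measure; rewrite ?inE//.
  - by apply: measurableU => //; exact: measurable_rho_cdf_le.
  - exact: measurable_rho_cdf_le.
  - by move=> x [/= ->//|/=]; lra.
rewrite !rho_cdf_unif// -leeBrDr// -EFinB => /le_trans; apply.
by rewrite lee_fin; lra.
Qed.

End NonatomicCdf.

Lemma measure_le {R : realType} d (X : measurableType d) (mu : {measure set X -> \bar R})
    (A B : set X) : measurable A -> measurable B -> A `<=` B -> (mu A <= mu B)%E.
Proof. by move=> mA mB AB; apply: le_measure; rewrite ?inE. Qed.

Lemma ae_pullback {R : realType} d (X : measurableType d) (mu : {measure set X -> \bar R})
    (f : X -> X) (P : X -> Prop) :
  measurable_fun setT f -> (forall A, measurable A -> mu (f @^-1` A) = mu A) ->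
  {ae mu, forall x, P x} -> {ae mu, forall x, P (f x)}.
Proof.
move=> mf muf [N [mN N0 PN]]; exists (f @^-1` N); split.
- by rewrite -[X in measurable X]setTI; exact: mf.
- by rewrite muf.
- by move=> x /= nP; apply: PN.
Qed.

Section SeidlMap.
Context {R : realType} (a b : R) (rho : probability R R) (n : nat) (T : R -> R) (d : nat -> R).
Hypothesis ab : a < b.
Hypothesis rho_ab : prob_on a b rho.
Hypothesis rho_na : nonatomic rho.
Hypothesis n_gt0 : (0 < n)%N.
Hypothesis d0 : d 0%N = a.
Hypothesis dn : d n = b.
Hypothesis d_lt : forall i, (i < n)%N -> d i < d i.+1.
Hypothesis rho_d : forall i, (i < n)%N -> rho `[d i, d i.+1]%classic = (n%:R^-1)%:E.
Hypothesis mT : measurable_fun setT T.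
Hypothesis T_nd : forall i, (i < n)%N -> {in `](d i), (d i.+1)[ &, {homo T : x y / x <= y}}.
Hypothesis T_push : forall i, (i.+2 <= n)%N -> forall A : set R, measurable A ->
  rho (`[d i, d i.+1]%classic `&` T @^-1` A) = rho (`[d i.+1, d i.+2]%classic `&` A).
Hypothesis T_push_last : forall A : set R, measurable A ->
  rho (`[d n.-1, d n]%classic `&` T @^-1` A) = rho (`[d 0%N, d 1%N]%classic `&` A).

Local Notation F := (rho_cdf rho).
Let nxt k := if (k.+1 < n)%N then k.+1 else 0%N.
Let cell k : set R := `[d k, d k.+1]%classic.

Let mcell k : measurable (cell k). Proof. by rewrite /cell. Qed.

Let n_gt0R : 0 < n%:R :> R. Proof. by rewrite ltr0n. Qed.

Let nxt_lt k : (nxt k < n)%N. Proof. by rewrite /nxt; case: ifP. Qed.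

Let push k A : (k < n)%N -> measurable A ->
  rho (cell k `&` T @^-1` A) = rho (cell (nxt k) `&` A).
Proof.
move=> kn mA; rewrite /nxt; case: ifPn => [kn1|kn1]; first exact: T_push.
have nk : n = k.+1 by lia.
by have := T_push_last _ mA; rewrite nk.
Qed.

Let F_d k : (k <= n)%N -> F (d k) = k%:R / n%:R.
Proof.
elim: k => [_|k IH kn]; first by rewrite d0 (rho_cdf_a _ b)// mul0r.
have := rho_d _ kn; rewrite (rho_itvcc _ rho_na) ?ltW ?d_lt// IH ?(ltnW kn)// => -[H].
by rewrite -[LHS](subrK (k%:R / n%:R)) H -natr1; ring.
Qed.

(** Closed cells share endpoints; half-open ones are disjoint and have the same masses. *)
Let rho_cell B k : (k < n)%N -> measurable B ->
  rho (cell k `&` B) = rho (`]d k, d k.+1]%classic `&` B).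
Proof.
move=> kn mB; apply/eqP; rewrite eq_le; apply/andP; split; last first.
  apply: measure_le; [exact: measurableI|exact: measurableI|].
  by apply: setSI; apply: subset_itv; rewrite bnd_simp.
rewrite -[leRHS](rho_setU1 _ rho_na _ (d k)); last exact: measurableI.
apply: measure_le; [exact: measurableI| |].
  by apply: measurableU => //; exact: measurableI.
move=> x [+ Bx]; rewrite /cell /= in_itv/= => /andP[dx xd].
have [xdk|xdk] := eqVneq x (d k); [by right|left; split => //].
by rewrite /= in_itv/= xd lt_neqAle eq_sym xdk dx.
Qed.

Let rho_cells B : measurable B -> rho B = (\sum_(k < n) rho (cell k `&` B))%E.
Proof.
move=> mB.
have part k : (k <= n)%N -> rho (`]-oo, d k]%classic `&` B) = (\sum_(i < k) rho (cell i `&` B))%E.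
  elim: k => [_|k IH kn].
    rewrite big_ord0; apply/eqP; rewrite eq_le measure_ge0 andbT.
    rewrite -(_ : rho `]-oo, a]%classic = 0%E); last by rewrite rho_cdfE (rho_cdf_a _ b).
    by rewrite d0; apply: measure_le => //; exact: measurableI.
  rewrite big_ord_recr /= -IH ?(ltnW kn)// rho_cell// -measureU; first last.
  - rewrite -subset0 => x [[] /=]; rewrite in_itv/= => xd _ []; rewrite in_itv/=; lra.
  - exact: measurableI.
  - exact: measurableI.
  congr (rho _); rewrite -setIUl; congr (_ `&` _).
  have := d_lt _ kn => dk.
  by apply/seteqP; split => x /=; rewrite !in_itv/=;
    [move=> xd; have [?|?] := leP x (d k); [left|right]| case; lra].
rewrite -part// dn.
apply/eqP; rewrite eq_le; apply/andP; split; last first.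
  by apply: measure_le => //; exact: measurableI.
have -> : rho (`]-oo, b]%classic `&` B) = rho (`]-oo, b]%classic `&` B `|` (B `&` `]b, +oo[%classic)).
  rewrite measureU0//; [exact: measurableI|exact: measurableI|].
  apply: (rho_out a b) => //; first exact: measurableI.
  by rewrite -subset0 => x [[_ ]] /=; rewrite !in_itv/=; lra.
apply: measure_le => //; first by apply: measurableU; exact: measurableI.
by move=> x Bx; have [?|?] := leP x b; [left|right]; split => //=; rewrite in_itv//= andbT.
Qed.

(** After splitting over the cells, [T] only rotates the summands. *)
Lemma seidl_invariant A : measurable A -> rho (T @^-1` A) = rho A.
Proof.
move=> mA; have mTA : measurable (T @^-1` A) by rewrite -[X in measurable X]setTI; exact: mT.
rewrite [LHS]rho_cells// [RHS]rho_cells//.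
under eq_bigr => k _ do rewrite push//.
rewrite /nxt; case: n n_gt0 => // m _; rewrite big_ord_recr big_ord_recl /= ltnn addeC; congr (_ + _)%E.
by apply: eq_bigr => i _; rewrite ltnS ltn_ord.
Qed.

(** In the coordinate [F] the Seidl map is the rotation by [1 / n]; the cell index [k] is kept
    explicit and the strict inequalities stay away from cell boundaries. *)
Let seidl_good x := exists k, [/\ (k < n)%N, k%:R / n%:R < F x, F x < k.+1%:R / n%:R &
  F (T x) = F x + (nxt k)%:R / n%:R - k%:R / n%:R].

Let seidl_good_ae : {ae rho, forall x, seidl_good x}.
Proof.
(* The exceptional points of a cell: those that [T] sends outside the next cell, the left endpoint,
   and a level set of [F] at a multiple of [1 / n]. *)
pose bad k : set R := (cell k `&` T @^-1` (~` cell (nxt k))) `|`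
   [set d k] `|` [set x | F x = k%:R / n%:R].
have mlev c : measurable [set x | F x = c].
  rewrite [X in measurable X](_ : _ = setT `&` F @^-1` [set c]).
    by apply: measurable_rho_cdf.
  by rewrite setTI.
have mTA A : measurable A -> measurable (T @^-1` A).
  by move=> mA; rewrite -[X in measurable X]setTI; exact: mT.
have mbad k : measurable (bad k).
  apply: measurableU; last exact: mlev.
  apply: measurableU => //; apply: measurableI => //; apply: mTA; exact: measurableC.
have bad0 k : (k < n)%N -> rho (bad k) = 0%E.
  move=> kn; rewrite /bad measureU0//; first last.
  - exact: rho_cdf_level (ltW ab).
  - by apply: measurableU => //; apply: measurableI => //; apply: mTA; exact: measurableC.
  rewrite /= (rho_setU1 _ rho_na)//; last by apply: measurableI => //; apply: mTA; exact: measurableC.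
  by rewrite push//; [rewrite setICr measure0|exact: measurableC].
pose N : set R := \bigcup_(k < n) bad k `|` [set b] `|` [set x | F x = 1] `|` ~` `[a, b]%classic.
exists N; split.
- apply: measurableU; last exact: measurableC.
  apply: measurableU => //; apply: measurableU => //.
  by apply: bigcup_measurable => k _.
- have mbads : measurable (\bigcup_(k < n) bad k) by apply: bigcup_measurable => k _.
  have mbads1 : measurable (\bigcup_(k < n) bad k `|` [set b]) by exact: measurableU.
  rewrite measureU0//; first last.
  + apply: (rho_out a b) => //; first exact: measurableC.
    by rewrite setICl.
  + exact: measurableC.
  + exact: measurableU.
  rewrite measureU0//; last exact: rho_cdf_level (ltW ab).
  rewrite /= (rho_setU1 _ rho_na)//.
  apply/negligibleP => //.
  apply: (@negligibleS _ _ _ _ (\bigcup_k (if (k < n)%N then bad k else set0))).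
    by move=> y [k /= kn bky]; exists k => //; rewrite kn.
  apply: negligible_bigcup => k; case: ifPn => kn; last exact: negligible_set0.
  by apply/negligibleP => //; exact: bad0.
- move=> x /=; apply: contra_notP => xN.
  have xab : a < x < b.
    have : x \in `[a, b] by apply: contrapT => xI; apply: xN; right; exact: xI.
    rewrite in_itv/= => /andP[]; rewrite le_eqVlt => /orP[/eqP ax|ax].
      by exfalso; apply: xN; left; left; left; exists 0%N => //; left; right; rewrite d0.
    rewrite le_eqVlt => /orP[/eqP xb|xb]; last by rewrite ax.
    by exfalso; apply: xN; left; left; right.
  have [k kn /andP[dx xd]] : exists2 k, (k < n)%N & d k < x < d k.+1.
    have H m : (m <= n)%N -> x < d m -> exists2 k, (k < n)%N & d k < x < d k.+1.
      elim: m => [_|m IH mn xm]; first by rewrite d0; lra.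
      have [xdm|dmx|xdm] := ltgtP x (d m).
      - by apply: IH => //; exact: ltnW.
      - by exists m => //; rewrite dmx.
      - by exfalso; apply: xN; left; left; left; exists m => //; left; right.
    by apply: (H n) => //; rewrite dn; lra.
  have xc : cell k x by rewrite /cell /= in_itv/= !ltW.
  have Txc : cell (nxt k) (T x).
    apply: contrapT => nT; apply: xN; left; left; left; exists k => //; left; left.
    by split.
  have Fk c : (c <= n)%N -> F x <> c%:R / n%:R.
    rewrite leq_eqVlt => /orP[/eqP ->|cn] Fx; apply: xN; last first.
      by left; left; left; exists c => //; right.
    by left; right; rewrite /= Fx divff ?gt_eqF.
  have Fdk := F_d _ (ltnW kn); have Fdk1 := F_d _ kn; have Fdn := F_d _ (ltnW (nxt_lt k)).
  move: (Txc); rewrite /cell /= in_itv/= => /andP[dT Td].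
  exists k; split => //.
  + by rewrite lt_neqAle -Fdk rho_cdf_nd ?ltW// andbT Fdk eq_sym; apply/eqP/Fk/ltnW.
  + by rewrite lt_neqAle -Fdk1 rho_cdf_nd ?ltW// andbT Fdk1; apply/eqP/Fk.
  (* By monotonicity [T] maps the part of the cell up to [x] below [T x], so the mass before [x] is
     at most the mass before [T x] in the next cell. *)
  have le1 : F x - F (d k) <= F (T x) - F (d (nxt k)).
    rewrite -lee_fin -(rho_itvoc _ _ _ (ltW dx)) -(rho_itvcc _ rho_na _ _ dT).
    have -> : `[d (nxt k), T x]%classic = cell (nxt k) `&` `]-oo, T x]%classic.
      rewrite /cell; apply/seteqP; split => y /=; rewrite !in_itv/=; last by move=> [/andP[-> _] ->].
      by move=> /andP[dy yT]; split => //; apply/andP; split; lra.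
    rewrite -push//.
    apply: measure_le => //.
      by apply: measurableI => //; exact: mTA.
    move=> y /=; rewrite in_itv/= => /andP[dy yx]; split.
      by rewrite /cell /= in_itv/=; apply/andP; split; lra.
    by rewrite /= in_itv/=; apply: (T_nd _ kn) => //; rewrite in_itv/=; apply/andP; split; lra.
  (* Conversely, points of the cell whose image is strictly below [T x] do not lie beyond [x]; the
     right endpoint, where monotonicity is not given, is added as a null set. *)
  have le2 : F (T x) - F (d (nxt k)) <= F x - F (d k).
    rewrite -lee_fin -(rho_itvco _ rho_na _ _ dT) -(rho_itvcc _ rho_na _ _ (ltW dx)).
    have -> : `[d (nxt k), T x[%classic = cell (nxt k) `&` `]-oo, T x[%classic.
      rewrite /cell; apply/seteqP; split => y /=; rewrite !in_itv/=; last by move=> [/andP[-> _] ->].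
      by move=> /andP[dy yT]; split => //; apply/andP; split; lra.
    rewrite -push// -(rho_setU1 _ rho_na `[d k, x]%classic (d k.+1))//.
    apply: measure_le => //.
    - by apply: measurableI => //; exact: mTA.
    - exact: measurableU.
    move=> y []; rewrite /cell /= !in_itv/= => /andP[dy yd] TyTx.
    have [xy|yx] := ltP x y; last by left; apply/andP.
    move: yd; rewrite le_eqVlt => /orP[/eqP ->|yd]; first by right.
    suff : T x <= T y by lra.
    by apply: (T_nd _ kn); rewrite ?in_itv/=; [apply/andP; split; lra|apply/andP; split; lra|lra].
  by move: le1 le2; rewrite Fdk Fdn; lra.
Qed.

Lemma measurable_iter i : measurable_fun setT (iter i T).
Proof. by elim: i => [|i IH]; [exact: measurable_id|exact: (measurableT_comp mT IH)]. Qed.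

Lemma iter_invariant i A : measurable A -> rho (iter i T @^-1` A) = rho A.
Proof.
elim: i A => [|i IH] A mA //.
rewrite (_ : iter i.+1 T @^-1` A = iter i T @^-1` (T @^-1` A)) // IH ?seidl_invariant//.
by rewrite -[X in measurable X]setTI; exact: mT.
Qed.

(** The rotation preserves the fractional part [r] of [n * F] and advances the cell index modulo
    [n], so one offset [r] describes the whole orbit. *)
Lemma seidl_orbit : {ae rho, forall x, exists k0 r, [/\ (k0 < n)%N, 0 < r < 1 &
  forall i, n%:R * F (iter i T x) = ((k0 + i) %% n)%:R + r]}.
Proof.
have good i : {ae rho, forall x, seidl_good (iter i T x)}.
  by apply: ae_pullback seidl_good_ae; [exact: measurable_iter|exact: iter_invariant].
have /ae_foralln := good; apply: filterS => x gx.
have [k0 [k0n lo hi _]] := gx 0%N.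
exists k0, (n%:R * F x - k0%:R); split => //.
  by rewrite subr_gt0 ltrBlDr [1 + _]addrC natr1 -ltr_pdivrMl// mulrC lo/= -ltr_pdivlMl// mulrC.
elim=> [|i IH]; first by rewrite addn0 modn_small// addrC subrK.
have [k [kn klo khi ->]] := gx i.
have kE : k = ((k0 + i) %% n)%N.
  have r01 : 0 < n%:R * F x - k0%:R < 1.
    by rewrite subr_gt0 ltrBlDr [1 + _]addrC natr1 -ltr_pdivrMl// mulrC lo/= -ltr_pdivlMl// mulrC.
  move: klo khi; rewrite ltr_pdivrMr// ltr_pdivlMr// [F _ * _]mulrC IH => klo khi.
  have : (k < ((k0 + i) %% n).+1)%N by rewrite -(ltr_nat R) -natr1; lra.
  have : (((k0 + i) %% n) < k.+1)%N by rewrite -(ltr_nat R) -natr1 ; lra.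
  lia.
rewrite mulrBr mulrDr IH -kE.
have -> : ((k0 + i.+1) %% n)%N = nxt k.
  rewrite addnS -addn1 -modnDml -kE addn1 /nxt; case: ifPn => [kn1|]; first by rewrite modn_small.
  by rewrite -leqNgt => nk; rewrite (_ : k.+1 = n) ?modnn//; lia.
by rewrite ![n%:R * (_ / _)]mulrC !divfK ?gt_eqF//; ring.
Qed.

End SeidlMap.

Lemma sum_nat_modn (G : nat -> nat) n k : (0 < n)%N ->
  (\sum_(i < n) G ((k + i) %% n) = \sum_(i < n) G i)%N.
Proof.
case: n => // n _.
rewrite [RHS](reindex_inj (addrI (inZp k : 'I_n.+1))) /=.
by apply: eq_bigr => i _; rewrite modnDml.
Qed.

(** With [m] and [f] the integer and fractional parts of [n * W], every [j < m] is counted, [j = m]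
    is counted exactly when [r <= f], and no larger [j] is. *)
Lemma count_shifted {R : realType} n (W : R) : (0 < n)%N -> 0 <= W <= 1 ->
  exists (m : nat) (f : R), forall r : R, 0 < r < 1 ->
  (\sum_(j < n) (j%:R + r <= n%:R * W)%R = m + (r <= f)%R)%N.
Proof.
move=> n0 /andP[W0 W1]; have nW0 : 0 <= n%:R * W by rewrite mulr_ge0.
pose m := Num.truncn (n%:R * W); pose f := n%:R * W - m%:R.
have /andP[mW Wm] := truncn_itv nW0; rewrite -/m in mW Wm.
have mn : (m <= n)%N.
  by rewrite -(ler_nat R) (le_trans mW)// -[leRHS]mulr1 ler_wpM2l.
exists m, f => r /andP[r0 r1].
have E (j : nat) : (j%:R + r <= n%:R * W) = (j < m)%N || ((j == m) && (r <= f)).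
  have [jm|mj|->] := ltngtP j m => /=.
  - have : j.+1%:R <= m%:R :> R by rewrite ler_nat.
    by rewrite -natr1; lra.
  - have : m.+1%:R <= j%:R :> R by rewrite ler_nat.
    move=> H; apply/negbTE; rewrite -ltNge; lra.
  - by rewrite /f; apply/idP/idP; lra.
under eq_bigr => j _ do rewrite E.
have H (k : nat) : (\sum_(j < k) ((j < m) || ((j == m :> nat) && (r <= f)%R)) =
    if (k <= m)%N then k else m + (r <= f)%R)%N.
  elim: k => [|k IH]; first by rewrite big_ord0.
  rewrite big_ord_recr /= IH; have [km|mk|->] := ltngtP k m => /=.
  - by rewrite addn1.
  - by rewrite addn0.
  - by case: (r <= f).
(* When [m = n] the index [j = m] does not exist, but then [f <= 0 < r] and the indicator vanishes
   too. *)
rewrite H; move: mn; rewrite leq_eqVlt => /orP[/eqP mn|mn]; last by rewrite leqNgt mn.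
rewrite -mn leqnn [r <= f](_ : _ = false) ?addn0//; apply/negbTE; rewrite -ltNge.
have : n%:R * W <= n%:R by rewrite -[leRHS]mulr1 ler_wpM2l.
by rewrite /f -mn; lra.
Qed.

Section SeidlCount.
Context {R : realType} (a b : R) (rho : probability R R) (n : nat) (T : R -> R).
Hypothesis ab : a < b.
Hypothesis rho_ab : prob_on a b rho.
Hypothesis rho_na : nonatomic rho.
Hypothesis n_gt0 : (0 < n)%N.
Hypothesis seidlT : is_seidl_map a b n rho T.

Lemma seidl_measurable i : measurable_fun setT (iter i T).
Proof. by have [d [_ _ _ _ [_ mT _ _ _]]] := seidlT; exact: measurable_iter. Qed.

Lemma seidl_iter_invariant i A : measurable A -> rho (iter i T @^-1` A) = rho A.
Proof.
have [d [d0 dn dlt drho [_ mT Tnd Tp Tl]]] := seidlT.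
exact: (@iter_invariant R a b rho n T d).
Qed.

Lemma seidl_cdf_distinct : {ae rho, forall x, forall i j, (i < j)%N -> (j < n)%N ->
  rho_cdf rho (iter i T x) != rho_cdf rho (iter j T x)}.
Proof.
have [d [d0 dn dlt drho [_ mT Tnd Tp Tl]]] := seidlT.
have := @seidl_orbit R a b rho n T d ab rho_ab rho_na n_gt0 d0 dn dlt drho mT Tnd Tp Tl.
apply: filterS => x [k0 [r [k0n r01 H]]] i j ij jn; apply/eqP => Fij.
have := H i; rewrite Fij H => /addIr/eqP; rewrite eqr_nat => /eqP.
by move/eqP; rewrite eq_sym eqn_modDl !modn_small ?(ltn_trans ij)// => /eqP; lia.
Qed.

(** One offset [r] serves all thresholds, so a difference of two counts varies only with the
    difference of two indicators [r <= f p] and [r <= f q], which takes two consecutive values. The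
    sequences [m] and [f] do not depend on the orbit. *)
Lemma seidl_count (W : nat -> R) : (forall p, 0 <= W p <= 1) ->
  exists (m : nat -> nat) (f : nat -> R), {ae rho, forall x, exists r, forall p,
    (\sum_(i < n) (rho_cdf rho (iter i T x) <= W p)%R = m p + (r <= f p)%R)%N}.
Proof.
move=> W01.
have [m mP] := choice (fun p => count_shifted n (W p) n_gt0 (W01 p)).
have [f fP] := choice mP.
exists m, f.
have [d [d0 dn dlt drho [_ mT Tnd Tp Tl]]] := seidlT.
have := @seidl_orbit R a b rho n T d ab rho_ab rho_na n_gt0 d0 dn dlt drho mT Tnd Tp Tl.
apply: filterS => x [k0 [r [k0n r01 H]]]; exists r => p.
rewrite -(fP p r r01) -(sum_nat_modn (fun j => (j%:R + r <= n%:R * W p)%R) n k0)//.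
by apply: eq_bigr => i _; rewrite -H ler_pM2l// ltr0n.
Qed.

End SeidlCount.

(** * Measurability of the cost and averaging *)

Lemma cvg_real_pair {R : realType} (X : Type) (G : set_system X) {FG : Filter G}
    (u v : X -> R) (x y : R) :
  u @ G --> x -> v @ G --> y -> (u k, v k) @[k --> G] --> (x, y).
Proof. by move=> ux vy; exact: (@cvg_pair _ _ _ _ (nbhs x) (nbhs y) _ _ _ u v ux vy). Qed.

(** Rounding both arguments down to multiples of [1 / (k + 1)] gives functions constant on countably
    many products of intervals, and these converge pointwise to [f]. *)
Lemma continuous2_measurable {R : realType} (f : R * R -> \bar R) :
  continuous f -> measurable_fun setT f.
Proof.
move=> cf; pose pi k (x : R) : R := (Num.floor (k.+1%:R * x))%:~R / k.+1%:R.
have pi_near k x : `|x - pi k x| <= k.+1%:R^-1.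
  have k0 : 0 < k.+1%:R :> R by rewrite ltr0n.
  have /andP[lo hi] := floor_itv (k.+1%:R * x).
  have -> : x - pi k x = (k.+1%:R * x - (Num.floor (k.+1%:R * x))%:~R) / k.+1%:R.
    by rewrite /pi mulrBl [_ * x]mulrC mulfK// gt_eqF.
  rewrite normrM [`|_^-1|]gtr0_norm ?invr_gt0// ler_piMl ?invr_ge0 ?ltW//.
  by rewrite intrD in hi; rewrite ger0_norm; lra.
have pi_cvg x : pi k x @[k --> \oo] --> x.
  apply/cvgrPdist_le => e e0; near=> k.
  apply: (le_trans (pi_near k x)); apply: ltW; near: k.
  exact: near_infty_natSinv_lt (PosNum e0).
apply: (emeasurable_fun_cvg (fun k p => f (pi k p.1, pi k p.2))); last first.
  move=> [x y] _ /=.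
  have pixy : (pi k x, pi k y) @[k --> \oo] --> (x, y) by apply: cvg_real_pair; exact: pi_cvg.
  exact: (cvg_comp _ _ pixy (cf (x, y))).
move=> k _ A mA; rewrite setTI.
have mfl (i : int) : measurable [set x : R | Num.floor (k.+1%:R * x) = i].
  apply: is_interval_measurable => x y /= xi yi z /andP[xz zy].
  have k0 : 0 <= k.+1%:R :> R by rewrite ler0n.
  apply/eqP; rewrite eq_le -{1}yi -xi; apply/andP; split; apply: le_floor;
    exact: ler_wpM2l.
rewrite [X in measurable X](_ : _ = \bigcup_(ij : int * int)
   (if pselect (A (f (ij.1%:~R / k.+1%:R, ij.2%:~R / k.+1%:R))) then
     [set x : R | Num.floor (k.+1%:R * x) = ij.1] `*` [set x : R | Num.floor (k.+1%:R * x) = ij.2]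
    else set0)); last first.
  apply/seteqP; split => [[x y] /= Af|[x y] [[i j] _] /=].
    exists (Num.floor (k.+1%:R * x), Num.floor (k.+1%:R * y)) => //=.
    by case: pselect.
  by case: pselect => // Af [/= xi yj]; rewrite /pi xi yj.
apply: countable_bigcupT_measurable => // ij.
by case: ifP => // _; apply: measurableX; exact: mfl.
Unshelve. all: by end_near. Qed.

Lemma measurable_cost_fun {R : realType} (w : R -> R -> \bar R) n :
  measurable_fun setT (fun p : R * R => w p.1 p.2) ->
  measurable_fun setT (cost_fun w n).
Proof.
move=> mw; rewrite /cost_fun.
under eq_fun => x do rewrite -big_filter.
apply: emeasurable_sum => -[i j].
apply: (@measurableT_comp _ _ _ _ _ _ (fun p : R * R => w p.1 p.2) _ (fun x : n.-tuple R => (tnth x i, tnth x j))) => //.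
by apply/measurable_fun_pairP; split; exact: measurable_tnth.
Qed.

(** If [f] exceeded its average everywhere on [B], the difference would be positive with zero
    integral, so [B] would be null. Multiplying by [mu B] instead of dividing covers null sets as
    well. *)
Lemma exists_le_average {R : realType} d (X : measurableType d) (mu : {measure set X -> \bar R})
    (B : set X) (f : X -> \bar R) :
  measurable B -> (mu B < +oo)%E -> measurable_fun B f -> (forall x, (0 <= f x)%E) ->
  (\int[mu]_(x in B) f x < +oo)%E -> B !=set0 ->
  exists2 x, B x & (mu B * f x <= \int[mu]_(x in B) f x)%E.
Proof.
move=> mB Bfin mf f0 fi [x0 Bx0]; apply: contrapT => /forall2NP H.
have gtx x : B x -> (\int[mu]_(x in B) f x < mu B * f x)%E.
  by move=> Bx; have [//|/negP] := H x; rewrite -ltNge.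
have [B0|B0] := eqVneq (mu B) 0%E.
  have := gtx _ Bx0; rewrite B0 mul0e ltNge integral_ge0// => *; exact: f0.
have ffin : (\int[mu]_(x in B) f x)%E \is a fin_num.
  by rewrite ge0_fin_numE// integral_ge0// => *; exact: f0.
have mBfin : mu B \is a fin_num by rewrite ge0_fin_numE.
set I := fine (\int[mu]_(x in B) f x)%E; set m := fine (mu B).
have IE : (\int[mu]_(x in B) f x)%E = I%:E by rewrite fineK.
have mE : mu B = m%:E by rewrite fineK.
have m0 : 0 < m.
  by rewrite -lte_fin -mE lt0e B0 measure_ge0.
have fgt x : B x -> ((I / m)%:E < f x)%E.
  move=> /gtx; rewrite IE mE; case: (f x) => [r||].
  - by rewrite -EFinM !lte_fin ltr_pdivrMr// mulrC.
  - by rewrite ltry.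
  - by rewrite gt0_muleNy ?lte_fin// ltNge leNye.
have fint : mu.-integrable B f.
  apply/integrableP; split => //.
  by under eq_integral => x _ do rewrite gee0_abs//; exact: fi.
have cint : mu.-integrable B (cst (I / m)%:E).
  apply/integrableP; split; first exact: measurable_cst.
  rewrite integral_cst//= mE -EFinM ltry//.
have : (\int[mu]_(x in B) `|(f \- cst (I / m)%:E) x| = 0)%E.
  rewrite (eq_integral (f \- cst (I / m)%:E)%E); last first.
    by move=> x /[!inE] /fgt fx; rewrite gee0_abs// sube_ge0 ?ltW//.
  rewrite integralB// integral_cst// IE mE -EFinM divfK ?gt_eqF// -EFinB subrr //.
move/ae_eq_integral_abs => /(_ mB (emeasurable_funB mf (measurable_cst _))) ae0.
have nB : mu.-negligible B.
  apply: negligibleS ae0 => x Bx /= /(_ Bx) fx0.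
  have : (0 < f x - (I / m)%:E)%E by rewrite sube_gt0 fgt.
  by rewrite fx0 ltxx.
by move/eqP: B0; apply; apply/(negligibleP _ mB).
Qed.

Lemma integral_affine_indic {R : realType} d (X : measurableType d) (P : probability X R)
    (I : finType) (C : R) (be : I -> R) (A : I -> set X) : (forall p, measurable (A p)) ->
  (\int[P]_x (C + \sum_(p : I) be p * \1_(A p) x)%R%:E =
   (C + \sum_(p : I) be p * fine (P (A p)))%R%:E)%E.
Proof.
move=> mA.
have iA p : P.-integrable setT (EFin \o \1_(A p)).
  exact: integrable_indic.
have ibA p : P.-integrable setT (fun x => (be p)%:E * (\1_(A p) x)%:E)%E.
  exact: (integrableZl measurableT _ (iA p)).
under eq_integral => x _.
  rewrite EFinD -sumEFin.
  under eq_bigr => p _ do rewrite EFinM.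
  over.
rewrite integralD//; last 2 first.
- exact: finite_measure_integrable_cst.
- exact: integrable_sum.
rewrite integral_cst//= probability_setT mule1 EFinD; congr (_ + _)%E.
rewrite integral_sum// -sumEFin; apply: eq_bigr => p _.
rewrite (integralZl measurableT (iA p)) integral_indic// setIT EFinM fineK//.
exact: fin_num_measure.
Qed.

Lemma Pi_setT {R : realType} n (rho : probability R R)
    (g : {measure set (n.-tuple R) -> \bar R}) : (0 < n)%N -> Pi n rho g -> g setT = 1%E.
Proof.
move=> n0 /(_ (Ordinal n0) setT measurableT); rewrite preimage_setT => ->.
exact: probability_setT.
Qed.

(** * Discretization of a competitor and optimality of Seidl plans *)

Section Boxes.
Context {R : realType} (a b : R) (n : nat) (rho : probability R R).
Variable gam : {measure set (n.-tuple R) -> \bar R}.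
Hypothesis ab : a < b.
Hypothesis rho_ab : prob_on a b rho.
Hypothesis rho_na : nonatomic rho.
Hypothesis gam_Pi : Pi n rho gam.
Variable N : nat.

Definition knot (k : nat) : R := a + (b - a) * (k%:R / N.+1%:R).

Lemma knot0 : knot 0 = a. Proof. by rewrite /knot mul0r mulr0 addr0. Qed.

Lemma knotN : knot N.+1 = b.
Proof. by rewrite /knot divff ?mulr1 ?pnatr_eq0// addrC subrK. Qed.

Lemma knotS k : knot k.+1 = knot k + (b - a) / N.+1%:R.
Proof. by rewrite /knot -natr1; ring. Qed.

Lemma knot_le k l : (k <= l)%N -> knot k <= knot l.
Proof.
move=> kl; have ba : 0 <= b - a by rewrite subr_ge0 ltW.
by rewrite /knot lerD2l ler_wpM2l// ler_wpM2r ?invr_ge0// ler_nat.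
Qed.

Lemma knot_cell y : a <= y -> y < b -> exists k : 'I_N.+1, knot k <= y < knot k.+1.
Proof.
move=> ay yb.
have H m : (m <= N.+1)%N -> y < knot m -> exists k : 'I_N.+1, knot k <= y < knot k.+1.
  elim: m => [_|m IH mN ym]; first by rewrite knot0; lra.
  have [my|ym'] := leP (knot m) y; last by apply: IH => //; exact: ltnW.
  by exists (Ordinal mN); rewrite /= my.
by apply: (H N.+1); rewrite ?knotN.
Qed.

(** Half-open cells make the boxes disjoint; the configurations they miss have a coordinate outside
    [[a, b[] and are negligible. *)
Definition box (ka : {ffun 'I_n -> 'I_N.+1}) : set (n.-tuple R) :=
  [set x | forall i, knot (ka i) <= tnth x i < knot (ka i).+1].

Lemma measurable_box ka : measurable (box ka).
Proof.
rewrite [X in measurable X](_ : _ =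
   \bigcap_(i in [set: 'I_n]) (Defs.coord n i @^-1` `[knot (ka i), knot (ka i).+1[%classic)); last first.
  apply/seteqP; split => x /= bx i; first by move=> _; rewrite /Defs.coord /= in_itv/=.
  by have := bx i I; rewrite /Defs.coord /= in_itv/=.
apply: fin_bigcap_measurable; first exact: finite_finset.
move=> i _; rewrite -[X in measurable X]setTI.
exact: (measurable_tnth i).
Qed.

Lemma trivIset_box : trivIset setT box.
Proof.
move=> ka ka' _ _ [x [/= bx bx']]; apply/ffunP => i; apply/val_inj => /=.
have /andP[l1 u1] := bx i; have /andP[l2 u2] := bx' i.
have [lt|lt|//] := ltngtP (ka i) (ka' i).
- by exfalso; have := knot_le _ _ lt; lra.
- by exfalso; have := knot_le _ _ lt; lra.
Qed.

Lemma rho_not_ab : rho (~` `[a, b[%classic) = 0%E.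
Proof.
have mC : measurable (~` `[a, b]%classic : set R) by exact: measurableC.
rewrite (_ : ~` _ = ~` `[a, b]%classic `|` [set b]) ?(rho_setU1 _ rho_na)//.
  by apply: (rho_out a b) => //; rewrite setICl.
apply/seteqP; split => x /=; rewrite !in_itv/=.
  by move=> xab; have [->|xb] := eqVneq x b; [right|left => -[/andP[ax xb']]; apply: xab; rewrite ax lt_neqAle xb].
by case => [xab|->]; [apply: contra_not xab => /andP[-> /ltW ->]|rewrite ltxx andbF].
Qed.

Lemma gam_out : gam.-negligible (~` [set x : n.-tuple R | forall i, a <= tnth x i < b]).
Proof.
have nul (i : 'I_n) : gam.-negligible (Defs.coord n i @^-1` (~` `[a, b[%classic)).
  have m1 : measurable (~` `[a, b[%classic : set R) by exact: measurableC.
  apply/negligibleP; last by rewrite -rho_not_ab; exact: gam_Pi.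
  by rewrite -[X in measurable X]setTI; exact: (measurable_tnth i).
apply: (@negligibleS _ _ _ _ (\bigcup_k (if insub k is Some i then Defs.coord n i @^-1` (~` `[a, b[%classic) else set0))).
  move=> x /= /existsNP[i xi]; exists i => //; rewrite valK /=.
  by rewrite /Defs.coord /= in_itv/=.
apply: negligible_bigcup => k; case: insubP => [i _ _|_]; [exact: nul|exact: negligible_set0].
Qed.

Lemma gam_box_split A : measurable A -> gam A = (\sum_ka gam (A `&` box ka))%E.
Proof.
move=> mA.
have mAb ka : measurable (A `&` box ka) by apply: measurableI => //; exact: measurable_box.
have tAb : trivIset setT (fun ka => A `&` box ka).
  by apply: trivIset_setIl; exact: trivIset_box.
rewrite (fsbig_seq _ _ (index_enum_uniq _)) -measure_fin_bigcup//; last first.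
  exact: sub_trivIset tAb.
rewrite -setI_bigcupr; set U := (X in _ = gam (A `&` X)).
have mU : measurable U by apply: fin_bigcup_measurable => // ka _; exact: measurable_box.
have mAU : measurable (A `\` U) by exact: measurableD.
have AU0 : gam (A `\` U) = 0%E.
  apply/negligibleP => //; apply: negligibleS gam_out => x [Ax nU] /= xab; apply: nU.
  have [ka kaP] := choice (fun i => knot_cell (tnth x i) (proj1 (andP (xab i))) (proj2 (andP (xab i)))).
  exists [ffun i => ka i]; first by rewrite /= mem_index_enum.
  by move=> i; rewrite ffunE.
by rewrite (measureDI gam mA mU) [X in (X + _)%E](_ : _ = 0%E) ?add0e.
Qed.

(** Each box contributes a point of at most average cost, so discretizing never raises the total
    cost, whatever the mesh. *)
Lemma quantize_points (c : n.-tuple R -> \bar R) :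
  (forall x, (0 <= c x)%E) -> measurable_fun setT c -> gam setT = 1%E ->
  (\int[gam]_x c x < +oo)%E ->
  exists xx : {ffun 'I_n -> 'I_N.+1} -> n.-tuple R, (forall ka, box ka (xx ka)) /\
    (\sum_ka gam (box ka) * c (xx ka) <= \int[gam]_x c x)%E.
Proof.
move=> c0 mc g1 ci.
have mcb ka : measurable_fun (box ka) c by exact: measurable_funTS.
have le_box ka : (\int[gam]_(x in box ka) c x <= \int[gam]_x c x)%E.
  by apply: ge0_subset_integral => //; exact: measurable_box.
have pts ka : exists x, box ka x /\ (gam (box ka) * c x <= \int[gam]_(x in box ka) c x)%E.
  have [|||||x bx cx] := exists_le_average _ _ gam (box ka) c (measurable_box ka) => //.
  - rewrite (@le_lt_trans _ _ 1%E) ?ltry// -g1.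
    by apply: measure_le => //; exact: measurable_box.
  - exact: le_lt_trans (le_box ka) ci.
  - exists [tuple knot (ka i) | i < n] => i; rewrite tnth_mktuple lexx knotS ltrDl.
    by rewrite divr_gt0// subr_gt0.
  - by exists x.
have [xx xxP] := choice pts.
exists xx; split => [ka|]; first by have [] := xxP ka.
apply: (@le_trans _ _ (\sum_ka \int[gam]_(x in box ka) c x)%E).
  by apply: lee_sum => ka _; have [] := xxP ka.
rewrite -(ge0_integral_bigsetU gam measurable_box (index_enum_uniq _)) => //.
- apply: ge0_subset_integral => //; apply: bigsetU_measurable => ka _; exact: measurable_box.
- exact: sub_trivIset trivIset_box.
- exact: measurable_funTS.
Qed.

End Boxes.

Lemma cntE {R : realType} n (x : n.-tuple R) s : cnt x s = (\sum_(i < n) (tnth x i <= s)%R)%N.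
Proof. by rewrite /cnt -sum1_count big_tuple big_mkcond; apply: eq_bigr => i _; case: ifP. Qed.

Lemma cap_cost_fin {R : realType} (w : R -> R -> \bar R) K n (x : n.-tuple R) :
  (forall u v, (0 <= w u v)%E) ->
  (forall i j, i != j -> (w (tnth x i) (tnth x j) < +oo)%E) ->
  (cap_cost w K n x)%:E = cost_fun w n x.
Proof.
move=> w0 wf; rewrite /cap_cost /cost_fun -sumEFin; apply: eq_bigr => -[i j] /= ij.
by rewrite cap_fin// wf.
Qed.

Lemma cap_cost_le {R : realType} (w : R -> R -> \bar R) K n (x : n.-tuple R) :
  0 <= K -> (forall u v, (0 <= w u v)%E) -> ((cap_cost w K n x)%:E <= cost_fun w n x)%E.
Proof.
move=> K0 w0; rewrite /cap_cost /cost_fun -sumEFin; apply: lee_sum => -[i j] /= ij.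
by rewrite cap_le.
Qed.

Section Quantized.
Context {R : realType} (a b : R) (w : R -> R -> \bar R) (n : nat) (rho : probability R R) (T : R -> R).
Variable gam : {measure set (n.-tuple R) -> \bar R}.
Hypothesis ab : a < b.
Hypothesis w_cont : continuous (fun p : R * R => w p.1 p.2).
Hypothesis wC : forall x y, w x y = w y x.
Hypothesis w_ge0 : forall x y, (0 <= w x y)%E.
Hypothesis w_cross : crossing_minimal w.
Hypothesis w_fin : forall x y, a <= x -> x < y -> y < b -> (w x y < +oo)%E.
Hypothesis rho_ab : prob_on a b rho.
Hypothesis rho_na : nonatomic rho.
Hypothesis n_gt0 : (0 < n)%N.
Hypothesis seidlT : is_seidl_map a b n rho T.
Hypothesis gam_Pi : Pi n rho gam.
Variable N : nat.

Local Notation F := (rho_cdf rho).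
Local Notation knot := (knot a b N).
Local Notation box := (box a b n N).

Variable xx : {ffun 'I_n -> 'I_N.+1} -> n.-tuple R.
Hypothesis xx_box : forall ka, box ka (xx ka).

(** The discretized competitor puts mass [G ka] at [xx ka]. Its marginals need not coincide; [W] is
    the distribution function of their average and [Wlt] its left-continuous version. *)
Let G ka : R := fine (gam (box ka)).
Let W s : R := n%:R^-1 * \sum_ka G ka * (cnt (xx ka) s)%:R.
Let Wlt s : R := n%:R^-1 * \sum_ka G ka * (count (fun y => y < s) (xx ka))%:R.

Let gamT : gam setT = 1%E. Proof. exact: Pi_setT gam_Pi. Qed.

Let GE ka : gam (box ka) = (G ka)%:E.
Proof.
rewrite fineK// ge0_fin_numE// (@le_lt_trans _ _ 1%E) ?ltry// -gamT.
by apply: measure_le => //; exact: measurable_box.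
Qed.

Let G_ge0 ka : 0 <= G ka. Proof. exact: fine_ge0. Qed.

Let sumG : \sum_ka G ka = 1.
Proof.
apply: EFin_inj; rewrite -sumEFin -gamT (gam_box_split a b n rho gam ab rho_ab rho_na gam_Pi N)//.
by apply: eq_bigr => ka _; rewrite setTI GE.
Qed.

Let n_gt0R : 0 < n%:R :> R. Proof. by rewrite ltr0n. Qed.

Let W_nd : {homo W : x y / x <= y}.
Proof.
move=> x y xy; rewrite /W ler_wpM2l ?invr_ge0//; apply: ler_sum => ka _.
rewrite ler_wpM2l// ler_nat; apply: sub_count => t /= tx; exact: le_trans xy.
Qed.

Let W_ge0 s : 0 <= W s.
Proof. by rewrite mulr_ge0 ?invr_ge0// sumr_ge0// => ka _; rewrite mulr_ge0. Qed.

Let W_top s : (forall ka, cnt (xx ka) s = n) -> W s = 1.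
Proof.
move=> H; rewrite /W; under eq_bigr => ka _ do rewrite H.
by rewrite -mulr_suml sumG mul1r mulVf// gt_eqF.
Qed.

Let W_le1 s : W s <= 1.
Proof.
rewrite /W mulrC ler_pdivrMr// mul1r.
rewrite [leRHS](_ : _ = \sum_ka G ka * n%:R); last by rewrite -mulr_suml sumG mul1r.
apply: ler_sum => ka _; rewrite ler_wpM2l// ler_nat.
by rewrite (leq_trans (count_size _ _))// size_tuple.
Qed.

(** Discretization moves mass only inside the cells between knots, so each marginal keeps the same
    mass to the left of a knot. *)
Let Wlt_knot k : (k <= N.+1)%N -> Wlt (knot k) = F (knot k).
Proof.
move=> kN.
have cntlt ka : count (fun y => y < knot k) (xx ka) = (\sum_(i < n) (ka i < k))%N.
  rewrite -sum1_count big_tuple big_mkcond; apply: eq_bigr => i _.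
  have /andP[lo hi] := xx_box ka i.
  have [kk|kk] := ltnP (ka i) k.
    by rewrite ifT// (lt_le_trans hi)// knot_le.
  by rewrite ifF//; apply/negbTE; rewrite -leNgt (le_trans _ lo)// knot_le.
have col i : \sum_ka G ka * (ka i < k)%:R = F (knot k).
  apply: EFin_inj; rewrite -sumEFin -(rho_itvNyo _ rho_na) -(gam_Pi i)//.
  rewrite (gam_box_split a b n rho gam ab rho_ab rho_na gam_Pi N); last first.
    by rewrite -[X in measurable X]setTI; exact: (measurable_tnth i).
  apply: eq_bigr => ka _.
  have [kk|kk] := ltnP (ka i) k.
    rewrite mulr1 -GE; congr (gam _); apply/seteqP; split => [x bx|x []//]; split => //.
    have /andP[lo hi] := bx i; have := knot_le a b ab N _ _ kk.
    by rewrite /Defs.coord /= in_itv/=; lra.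
  rewrite mulr0 [X in gam X](_ : _ = set0) ?measure0//; apply/seteqP; split => // x [xk bx].
  have /andP[lo hi] := bx i; have := knot_le a b ab N _ _ kk.
  by move: xk; rewrite /Defs.coord /= in_itv/=; lra.
rewrite /Wlt.
under eq_bigr => ka _ do rewrite cntlt natr_sum mulr_sumr.
rewrite exchange_big /=; under eq_bigr => i _ do rewrite col.
by rewrite sumr_const card_ord -[F _ *+ n]mulr_natl mulrA mulVf ?mul1r// gt_eqF.
Qed.

Let z : seq R := sort <=%R (undup (flatten [seq tval (xx ka) | ka <- enum {ffun 'I_n -> 'I_N.+1}])).

Let z_sorted : sorted <%R z. Proof. by rewrite /z sort_lt_sorted undup_uniq. Qed.

Let mem_zP y : reflect (exists ka, y \in tval (xx ka)) (y \in z).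
Proof.
rewrite /z mem_sort mem_undup; apply: (iffP flatten_mapP) => [[ka _ yka]|[ka yka]]; exists ka => //.
by rewrite mem_enum.
Qed.

Let z_ge y : y \in z -> a <= y.
Proof.
move=> /mem_zP[ka /tnthP[i ->]]; have /andP[lo _] := xx_box ka i.
by apply: le_trans lo; rewrite -[leLHS](knot0 a b N) knot_le.
Qed.

Let z_lt y : y \in z -> y < b.
Proof.
move=> /mem_zP[ka /tnthP[i ->]]; have /andP[_ hi] := xx_box ka i.
by apply: lt_le_trans hi _; rewrite -[leRHS](knotN a b N) knot_le.
Qed.

Let z_gt0 : (0 < size z)%N.
Proof.
have : tnth (xx [ffun=> ord0]) (Ordinal n_gt0) \in z.
  by apply/mem_zP; exists [ffun=> ord0]; exact: mem_tnth.
by case: z.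
Qed.

Let zn_le p q : (p <= q)%N -> (q < size z)%N -> z`_p <= z`_q.
Proof.
move=> pq qz; rewrite (lt_sorted_leq_nth 0)// inE//; exact: leq_ltn_trans qz.
Qed.

Let W_last : W z`_(size z).-1 = 1.
Proof.
apply: W_top => ka; rewrite /cnt -[RHS](size_tuple (xx ka)); apply/eqP.
rewrite -all_count; apply/allP => y yka /=.
have yz : y \in z by apply/mem_zP; exists ka.
rewrite -(nth_index 0 yz) zn_le//; last by rewrite prednK.
by rewrite -ltnS prednK// index_mem.
Qed.

(** Quantile function of [W] applied to [F y], as a grid index; [P] below is the resulting monotone
    map from [rho] to the averaged marginal. *)
Let idx y := find (fun s => F y <= W s) z.

Let has_idx y : has (fun s => F y <= W s) z.
Proof.
apply/hasP; exists z`_(size z).-1; first by rewrite mem_nth// prednK.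
by rewrite W_last; exact: rho_cdf_le1.
Qed.

Let idx_lt y : (idx y < size z)%N. Proof. by rewrite -has_find. Qed.

Let idx_le y p : (p < size z)%N -> (idx y <= p)%N = (F y <= W z`_p).
Proof.
move=> pz; apply/idP/idP => [ip|Fp]; last first.
  by rewrite leqNgt; apply/negP => /(before_find 0); rewrite Fp.
by apply: le_trans (nth_find 0 (has_idx y)) _; apply: W_nd; exact: zn_le.
Qed.

Let P y := z`_(idx y).

Let P_z y : P y \in z. Proof. exact: mem_nth. Qed.

Let P_le y p : (p < size z)%N -> (P y <= z`_p) = (F y <= W z`_p).
Proof. by move=> pz; rewrite -idx_le// /P (lt_sorted_leq_nth 0)// inE. Qed.

(** Since [F] and [Wlt] agree at the knots, [P] cannot leave the cell of [y]; the excluded points,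
    at the level of a knot, form a null set. *)
Let P_near y : a <= y -> y < b -> (forall k, (k <= N.+1)%N -> F y != F (knot k)) ->
  `|P y - y| <= (b - a) / N.+1%:R.
Proof.
move=> ay yb yk.
have [k /andP[lo hi]] := knot_cell a b N y ay yb.
have Plo : knot k <= P y.
  rewrite leNgt; apply/negP => Pk.
  have : F y <= F (knot k).
    rewrite -Wlt_knot ?(ltnW (ltn_ord k))//.
    apply: (@le_trans _ _ (W (P y))); first by rewrite -P_le.
    rewrite /W /Wlt ler_wpM2l ?invr_ge0//; apply: ler_sum => ka _.
    rewrite ler_wpM2l// ler_nat; apply: sub_count => t /= tP; exact: le_lt_trans Pk.
  have := rho_cdf_nd rho _ _ lo; have := yk _ (ltnW (ltn_ord k)).
  by rewrite neq_lt => /orP[]; lra.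
have Fy0 : 0 < F y.
  rewrite lt_neqAle rho_cdf_ge0 andbT eq_sym.
  by have := yk 0%N isT; rewrite knot0 (rho_cdf_a a b rho rho_ab rho_na).
have Phi : P y < knot k.+1.
  rewrite ltNge; apply/negP => kP.
  have : F y <= Wlt (knot k.+1) by rewrite Wlt_knot ?ltn_ord//; apply: rho_cdf_nd; exact: ltW.
  apply/negP; rewrite -ltNge.
  (* If [P y] were beyond the next knot, its predecessor on the grid would already account for all
     of [Wlt (knot k.+1)], although [W] there is still below [F y]. *)
  have below ka t : t \in tval (xx ka) -> t < knot k.+1 -> (index t z < idx y)%N.
    move=> tka tk; have tz : t \in z by apply/mem_zP; exists ka.
    have : t < P y by exact: lt_le_trans kP.
    by rewrite -{1}(nth_index 0 tz) /P (lt_sorted_ltn_nth 0) ?inE ?index_mem.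
  case Eq : (idx y) => [|q].
    rewrite [Wlt _](_ : _ = 0)//; rewrite /Wlt big1 ?mulr0// => ka _.
    rewrite [count _ _](_ : _ = 0%N) ?mulr0//; apply/eqP; rewrite -leqn0 leqNgt -has_count.
    by apply/negP => /hasP[t tka tk]; have := below _ _ tka tk; rewrite Eq.
  have qz : (q < size z)%N by have := idx_lt y; rewrite Eq; exact: ltnW.
  have : W z`_q < F y by rewrite ltNge -idx_le// Eq ltnn.
  apply: le_lt_trans; rewrite /W /Wlt ler_wpM2l ?invr_ge0//; apply: ler_sum => ka _.
  rewrite ler_wpM2l// ler_nat.
  rewrite (@eq_in_count _ _ (fun t => (t < knot k.+1) && (t <= z`_q))).
    by apply: sub_count => t /= /andP[].
  move=> t tka /=; have [tk|] := boolP (t < knot k.+1) => //=.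
  have := below _ _ tka tk; rewrite Eq ltnS => tq.
  have tz : t \in z by apply/mem_zP; exists ka.
  by rewrite -(nth_index 0 tz) zn_le.
rewrite ler_norml; move: hi Phi; rewrite knotS; move: ((b - a) / _) => e; lra.
Qed.

Let Y x : n.-tuple R := [tuple P (iter i T x) | i < n].

Let Y_z x : {subset Y x <= z}.
Proof. by move=> y /tnthP[i ->]; rewrite tnth_mktuple P_z. Qed.

Let cnt_Y x p : (p < size z)%N -> cnt (Y x) z`_p = (\sum_(i < n) (F (iter i T x) <= W z`_p)%R)%N.
Proof.
by move=> pz; rewrite cntE; apply: eq_bigr => i _; rewrite tnth_mktuple P_le.
Qed.

Let level (q : 'I_(size z).-1 * 'I_n) : set R := [set x | F (iter q.2 T x) <= W z`_q.1].

Let m_level q : measurable (level q).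
Proof.
rewrite -[X in measurable X]setTI.
exact: (seidl_measurable a b rho n T seidlT q.2 measurableT _
  (measurable_rho_cdf_le rho (W z`_q.1))).
Qed.

Let rho_level q : rho (level q) = (W z`_q.1)%:E.
Proof.
have ab' := ltW ab.
rewrite -(rho_cdf_unif a b rho rho_ab rho_na _ ab'); last by rewrite W_ge0 W_le1.
exact: (seidl_iter_invariant a b rho n T ab rho_ab rho_na n_gt0 seidlT q.2 _
  (measurable_rho_cdf_le rho (W z`_q.1))).
Qed.

(** The affine bound is an equality along the rearranged orbit [Y x] and an inequality at the points
    [xx ka]; its two averages agree because every coordinate of [Y] has distribution function
    [W]. *)
Lemma quantized_bound :
  (\sum_ka gam (box ka) * cost_fun w n (xx ka) <= \int[gam]_x cost_fun w n x)%E ->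
  exists K (h : R -> \bar R), [/\ 0 <= K, measurable_fun setT h, forall x, (0 <= h x)%E,
    (\int[rho]_x h x <= \int[gam]_x cost_fun w n x)%E &
    {ae rho, forall x, exists y : n.-tuple R,
      [/\ forall i, `|tnth y i - iter i T x| <= (b - a) / N.+1%:R,
          forall i, a <= tnth y i < b & h x = (cap_cost w K n y)%:E]}].
Proof.
move=> xx_cost.
pose K := grid_bound w z.
have K0 : 0 <= K by exact: grid_bound_ge0.
have W01 p : 0 <= W z`_p <= 1 by rewrite W_ge0 W_le1.
have [m [f mf]] := seidl_count a b rho n T ab rho_ab rho_na n_gt0 seidlT (fun p => W z`_p) W01.
pose m1 p := (m p)%:Z.
(* The difference of the indicators [r <= f p] and [r <= f q] lies in [{-1, 0}] when [f p < f q],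
   and in [{0, 1}] otherwise. *)
pose m2 p q := (m p)%:Z - (m q)%:Z + (if f p < f q then -1 else 0).
have [C [be [dual_le dual_eq _]]] := dual_cap_cost a b w wC w_ge0 w_cross w_fin z n K m1 m2
  z_sorted z_ge z_lt (lexx _).
pose h0 x : R := C + \sum_(q : 'I_(size z).-1 * 'I_n) be q.1 * \1_(level q) x.
(* The affine function agrees with a nonnegative cost only almost everywhere; the maximum makes it
   nonnegative everywhere, as the use of Fatou's lemma requires. *)
pose h x : \bar R := (Num.max 0 (h0 x))%:E.
have mh0 : measurable_fun setT h0.
  apply: measurable_funD => //; apply: measurable_sum => q.
  by apply: measurable_funM => //; exact: measurable_indic.
have mh : measurable_fun setT h.
  by apply/measurable_EFinP; apply: measurable_maxr.
have h0E x : h0 x = C + \sum_(p < (size z).-1) be p * (cnt (Y x) z`_p)%:R.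
  congr (_ + _); rewrite -(pair_big xpredT xpredT (fun (p : 'I_(size z).-1) (i : 'I_n) => be p * \1_(level (p, i)) x)) /=.
  apply: eq_bigr => p _; rewrite cnt_Y; last by have := ltn_ord p; lia.
  rewrite natr_sum mulr_sumr; apply: eq_bigr => i _; congr (_ * _).
  by rewrite indicE /level; case: (boolP (F _ <= _)) => H; [rewrite mem_set|rewrite memNset//; apply/negP].
have h0_cap : {ae rho, forall x, h0 x = cap_cost w K n (Y x)}.
  apply: filterS mf => x [r rP]; rewrite h0E -dual_eq//.
  have cE p : (p < (size z).-1)%N -> cnt (Y x) z`_p = (m p + (r <= f p)%R)%N.
    by move=> pz; rewrite cnt_Y ?rP//; lia.
  split => [p pz|p q pz qz pq].
    by rewrite /consecutive /m1 cE//; case: (r <= f p); lia.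
  rewrite /consecutive /m2 !cE//.
  case: (ltP (f p) (f q)) => fpq; case: (leP r (f p)) => rp; case: (leP r (f q)) => rq; try lia.
    by have := lt_trans (le_lt_trans rp fpq) rq; rewrite ltxx.
  by have := le_lt_trans (le_trans rq fpq) rp; rewrite ltxx.
have hE : {ae rho, forall x, h x = (cap_cost w K n (Y x))%:E}.
  apply: filterS h0_cap => x h0x; rewrite /h h0x; congr EFin; apply/max_idPr.
  by apply: sumr_ge0 => i _; exact: cap_ge0.
exists K, h; split => //.
- by move=> x; rewrite lee_fin le_max lexx.
- have -> : (\int[rho]_x h x = \int[rho]_x (h0 x)%:E)%E.
    apply: ae_eq_integral => //; first exact/measurable_EFinP.
    apply: filterS2 hE h0_cap => x hx h0x _.
    by rewrite hx -h0x.
  rewrite integral_affine_indic//; apply: le_trans xx_cost.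
  apply: (@le_trans _ _ (\sum_ka G ka * cap_cost w K n (xx ka))%:E); last first.
    rewrite -sumEFin; apply: lee_sum => ka _; rewrite EFinM GE lee_wpmul2l ?lee_fin//.
    exact: cap_cost_le.
  rewrite lee_fin.
  (* Each level set has mass [W]; summing over the [n] coordinates cancels the factor [1 / n] in [W]
     and restores the counts of the points [xx ka]. *)
  have -> : C + \sum_(q : 'I_(size z).-1 * 'I_n) be q.1 * fine (rho (level q)) =
     \sum_ka G ka * (C + \sum_(p < (size z).-1) be p * (cnt (xx ka) z`_p)%:R).
    under [RHS]eq_bigr => ka _ do rewrite mulrDr mulr_sumr.
    rewrite big_split /= -mulr_suml sumG mul1r; congr (_ + _).
    rewrite -(pair_big xpredT xpredT (fun (p : 'I_(size z).-1) (i : 'I_n) => be p * fine (rho (level (p, i))))) /=.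
    rewrite [RHS]exchange_big /=; apply: eq_bigr => p _.
    under eq_bigr => i _ do rewrite rho_level /=.
    under [RHS]eq_bigr => ka _ do rewrite mulrCA.
    rewrite -[RHS]mulr_sumr sumr_const card_ord -[(_ * _) *+ n]mulr_natl mulrCA /W; congr (_ * _).
    by rewrite mulrA divff ?mul1r// gt_eqF.
  apply: ler_sum => ka _; rewrite ler_wpM2l//; apply: dual_le => y yka.
  by apply/mem_zP; exists ka.
- have near1 : {ae rho, forall y, a <= y < b /\ forall k : nat, (k <= N.+1)%N -> F y != F (knot k)}.
    have ae1 : {ae rho, forall y, a <= y < b}.
      exists (~` `[a, b[%classic); split; [exact: measurableC|exact: rho_not_ab|].
      by move=> y /= yab; rewrite in_itv/=.
    have ae2 : {ae rho, forall y, forall k : nat, F y != F (knot k)}.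
      apply/ae_foralln => k; exists [set y | F y = F (knot k)]; split.
      - rewrite [X in measurable X](_ : _ = setT `&` F @^-1` [set F (knot k)]); last by rewrite setTI.
        by apply: measurable_rho_cdf.
      - exact: (rho_cdf_level a b rho rho_ab rho_na _ (ltW ab)).
      - by move=> y /= /negP; rewrite negbK => /eqP.
    by apply: filterS2 ae1 ae2 => y yab yk; split => // k _.
  have near2 : {ae rho, forall x, forall i, a <= iter i T x < b /\
      forall k : nat, (k <= N.+1)%N -> F (iter i T x) != F (knot k)}.
    apply/ae_foralln => i; apply: ae_pullback near1; first exact: (seidl_measurable a b rho n T seidlT).
    exact: (seidl_iter_invariant a b rho n T).
  apply: filterS2 hE near2 => x hx near_x; exists (Y x); split => // i.
  + by rewrite tnth_mktuple; have [/andP[ai ib] nk] := near_x i; exact: P_near.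
  + have yz : tnth (Y x) i \in z by apply: (Y_z x); exact: mem_tnth.
    by rewrite z_ge// z_lt.
Qed.

End Quantized.

(** * Passage to the limit in the mesh *)

Lemma cost_fun_ge0 {R : realType} (w : R -> R -> \bar R) n x :
  (forall u v, (0 <= w u v)%E) -> (0 <= cost_fun w n x)%E.
Proof. by move=> w0; apply: sume_ge0. Qed.

Lemma cost_fun_cvg {R : realType} (w : R -> R -> \bar R) n (y : nat -> n.-tuple R) (x : n.-tuple R) :
  continuous (fun p : R * R => w p.1 p.2) -> (forall u v, (0 <= w u v)%E) ->
  (forall i, tnth (y k) i @[k --> \oo] --> tnth x i) ->
  cost_fun w n (y k) @[k --> \oo] --> cost_fun w n x.
Proof.
move=> cw w0 yx; apply: cvg_nnesum => [[i j] _|[i j] _ /=]; first exact: nearW.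
have yij : (tnth (y k) i, tnth (y k) j) @[k --> \oo] --> (tnth x i, tnth x j).
  by apply: cvg_real_pair; exact: yx.
exact: (cvg_comp _ _ yij (cw (tnth x i, tnth x j))).
Qed.

Lemma limn_einf_le {R : realType} (u : nat -> \bar R) (M : \bar R) :
  (forall k, (u k <= M)%E) -> (limn_einf u <= M)%E.
Proof.
move=> uM; rewrite limn_einf_lim; apply: lime_le; first exact: is_cvg_einfs.
apply: nearW => k; apply: le_trans (uM k); apply: ereal_inf_lbound.
by exists k => //=.
Qed.

Lemma measurable_limn_einf {R : realType} d (X : measurableType d) (f : nat -> X -> \bar R) :
  (forall k, measurable_fun setT (f k)) -> measurable_fun setT (fun x => limn_einf (f ^~ x)).
Proof.
move=> mf; rewrite /limn_einf.
apply: measurableT_comp => //.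
by apply: (@measurable_fun_limn_esup _ _ _ _ (fun k x => - f k x)%E) => k; exact: measurableT_comp.
Qed.

Section Optimal.
Context {R : realType} (a b : R) (w : R -> R -> \bar R) (n : nat) (rho : probability R R) (T : R -> R).
Hypothesis ab : a < b.
Hypothesis w_cont : continuous (fun p : R * R => w p.1 p.2).
Hypothesis wC : forall x y, w x y = w y x.
Hypothesis w_ge0 : forall x y, (0 <= w x y)%E.
Hypothesis w_cross : crossing_minimal w.
Hypothesis w_fin : forall x y, a <= x -> x < y -> y < b -> (w x y < +oo)%E.
Hypothesis rho_ab : prob_on a b rho.
Hypothesis rho_na : nonatomic rho.
Hypothesis n_gt0 : (0 < n)%N.
Hypothesis seidlT : is_seidl_map a b n rho T.

Lemma measurable_seidl_tuple : measurable_fun setT (seidl_tuple n T).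
Proof.
apply/measurable_fun_tnthP => i; apply: eq_measurable_fun (seidl_measurable a b rho n T seidlT i).
by move=> x _ /=; rewrite tnth_mktuple.
Qed.

Lemma seidl_optimal (gam : {measure set (n.-tuple R) -> \bar R}) : Pi n rho gam ->
  (\int[rho]_x cost_fun w n (seidl_tuple n T x) <= \int[gam]_x cost_fun w n x)%E.
Proof.
move=> gam_Pi.
have mw : measurable_fun setT (fun p : R * R => w p.1 p.2) by exact: continuous2_measurable.
have mc : measurable_fun setT (cost_fun w n) by exact: measurable_cost_fun.
have c0 x : (0 <= cost_fun w n x)%E by exact: cost_fun_ge0.
have [ci|] := ltP (\int[gam]_x cost_fun w n x)%E +oo%E; last by rewrite leye_eq => /eqP ->; rewrite leey.
have quant N : exists Kh : R * (R -> \bar R), [/\ 0 <= Kh.1, measurable_fun setT Kh.2,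
    forall x, (0 <= Kh.2 x)%E, (\int[rho]_x Kh.2 x <= \int[gam]_x cost_fun w n x)%E &
    {ae rho, forall x, exists y : n.-tuple R,
      [/\ forall i, `|tnth y i - iter i T x| <= (b - a) / N.+1%:R,
          forall i, a <= tnth y i < b & Kh.2 x = (cap_cost w Kh.1 n y)%:E]}].
  have [xx [xx_box xx_cost]] := quantize_points a b n gam ab N
    (cost_fun w n) c0 mc (Pi_setT n rho gam n_gt0 gam_Pi) ci.
  have [K [h [? ? ? ? ?]]] := quantized_bound a b w n rho T gam ab wC w_ge0 w_cross w_fin
    rho_ab rho_na n_gt0 seidlT gam_Pi N xx xx_box xx_cost.
  by exists (K, h).
have ba : 0 < b - a by rewrite subr_gt0.
have [Kh KhP] := choice quant; pose h N := (Kh N).2.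
have mh N : measurable_fun setT (h N) by have [_ mhN _ _ _] := KhP N; exact: mhN.
have h0 N x : (0 <= h N x)%E by have [_ _ h0N _ _] := KhP N; exact: h0N.
have hlim : {ae rho, forall x, h N x @[N --> \oo] --> cost_fun w n (seidl_tuple n T x)}.
  have near_all : {ae rho, forall x, forall N, exists y : n.-tuple R,
      [/\ forall i, `|tnth y i - iter i T x| <= (b - a) / N.+1%:R,
          forall i, a <= tnth y i < b & h N x = (cap_cost w (Kh N).1 n y)%:E]}.
    by apply/ae_foralln => N; have [_ _ _ _ aeN] := KhP N; exact: aeN.
  apply: filterS2 near_all (seidl_cdf_distinct a b rho n T ab rho_ab rho_na n_gt0 seidlT) => x nx dx.
  have [y yP] := choice nx.
  have ycvg i : tnth (y k) i @[k --> \oo] --> tnth (seidl_tuple n T x) i.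
    rewrite tnth_mktuple; apply/cvgrPdist_le => e e0; near=> k.
    have [/(_ i) yi _ _] := yP k; rewrite distrC (le_trans yi)//.
    rewrite mulrC -ler_pdivlMr//; apply: ltW; near: k.
    have e'0 : 0 < e / (b - a) by rewrite divr_gt0.
    exact: near_infty_natSinv_lt (PosNum e'0).
  (* The constant replacing [+oo] varies with [N] without control. It drops out because the orbit
     consists of distinct points: eventually the approximations are distinct too, and all their
     pairwise costs are finite. *)
  have ydist : \forall k \near \oo, forall ij : 'I_n * 'I_n, ij.1 != ij.2 ->
      tnth (y k) ij.1 != tnth (y k) ij.2.
    apply: filter_forall => -[i j] /=; have [->|ij] := eqVneq i j; first exact: nearW.
    have : tnth (seidl_tuple n T x) i - tnth (seidl_tuple n T x) j != 0.
      rewrite subr_eq0 !tnth_mktuple; move: ij; rewrite -(inj_eq val_inj) neq_ltn => /orP[] lt_ij.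
        by apply: contra_neq (dx _ _ lt_ij (ltn_ord j)) => ->.
      by rewrite eq_sym; apply: contra_neq (dx _ _ lt_ij (ltn_ord i)) => ->.
    have yij : (tnth (y k) i - tnth (y k) j) @[k --> \oo] -->
        (tnth (seidl_tuple n T x) i - tnth (seidl_tuple n T x) j).
      by apply: cvgB; exact: ycvg.
    move=> /(cvgr_neq0 _ yij) /=; apply: filterS => k /= + _.
    by rewrite subr_eq0.
  have hE : {near \oo, (fun k => cost_fun w n (y k)) =1 (fun k => h k x)}.
    apply: filterS ydist => k yk; have [_ yab hk] := yP k.
    rewrite hk cap_cost_fin// => i j ij.
    have /andP[ai ib] := yab i; have /andP[aj jb] := yab j.
    have := yk (i, j) ij; rewrite /= neq_lt => /orP[lt_ij|lt_ji]; first exact: w_fin.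
    by rewrite wC; exact: w_fin.
  exact: cvg_trans (near_eq_cvg hE) (cost_fun_cvg w n y _ w_cont w_ge0 ycvg).
apply: (@le_trans _ _ (\int[rho]_x limn_einf (h ^~ x))%E).
  apply: ae_ge0_le_integral => //.
  - exact: (measurableT_comp mc measurable_seidl_tuple).
  - move=> x _; rewrite limn_einf_lim; apply: lime_ge; first exact: is_cvg_einfs.
    by apply: nearW => k; apply: le_ereal_inf_tmp => _ [m _ <-]; exact: h0.
  - exact: measurable_limn_einf.
  - by apply: filterS hlim => x hx _; have [-> _] := cvg_limn_einf_sup hx.
apply: (le_trans (fatou rho measurableT mh (fun N x _ => h0 N x))).
by apply: limn_einf_le => N; have [_ _ _ leN _] := KhP N; exact: leN.
Unshelve. all: by end_near. Qed.

End Optimal.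

(** * Finiteness off the diagonal *)

Definition image_measure {R : realType} d1 d2 (X : measurableType d1) (Y : measurableType d2)
    (mu : {measure set X -> \bar R}) (phi : X -> Y) (mphi : measurable_fun setT phi) :
    {measure set Y -> \bar R} :=
  @measure_function_pushforward__canonical__measure_function_Measure _ _ _ _ _ mu phi mphi.

(** Serves to retype measures such as [uniform_prob] from [measurableTypeR R] to [R]. *)
Lemma measurable_idR {R : realType} : measurable_fun setT (idfun : measurableTypeR R -> R).
Proof. exact: (@measurable_id _ _ setT). Qed.

Lemma probability_of_measure {R : realType} d (X : measurableType d)
    (mu : {measure set X -> \bar R}) (x0 : X) :
  mu setT = 1%E -> exists P : probability X R, forall A, P A = mu A.
Proof.
move=> mu1; exists (mnormalize mu (\d_x0)) => A.
by rewrite /= /mnormalize mu1 onee_eq0/= invr1 mule1.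
Qed.

Lemma uniform_prob_itv {R : realType} (p q : R) (pq : p < q) (A : set R) :
  `[p, q]%classic `<=` A -> uniform_prob pq A = 1%E.
Proof. by move=> pqA; rewrite /uniform_prob integral_uniform_pdf1. Qed.

Lemma uniform_prob_set1 {R : realType} (p q : R) (pq : p < q) (x : R) :
  uniform_prob pq [set x] = 0%E.
Proof. by rewrite /uniform_prob integral_set1. Qed.

Section SingularMixture.
Context {R : realType} (p q : R) (r : nat -> R).
Hypothesis r_gt0 : forall k, 0 < r k.
Hypothesis r_le : forall k, p + r k <= q.

Let pr k : p < p + r k. Proof. by rewrite ltrDl. Qed.

(** Mix the uniform laws on [[p, p + r k]] with weights [2 ^ -(k + 1)]: the [k]-th component alone
    gives the required mass, however fast [r] decreases. *)
Lemma singular_mixture : exists rho : probability R R,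
  [/\ nonatomic rho, rho `[p, q]%classic = 1%E &
      forall k, (((2 ^ k.+1)%:R^-1)%:E <= rho `[p, (p + r k)%R]%classic)%E].
Proof.
have half_ge0 k : 0 <= (2 ^ k.+1)%:R^-1 :> R by rewrite invr_ge0.
pose m k : {measure set (measurableTypeR R) -> \bar R} := mscale (NngNum (half_ge0 k)) (uniform_prob (pr k)).
pose mu : {measure set R -> \bar R} := image_measure _ _ _ _ (mseries m 0) _ measurable_idR.
have sum1 : (\sum_(0 <= k <oo) ((2 ^ k.+1)%:R^-1)%:E = 1 :> \bar R)%E.
  apply/cvg_lim => //; have := @cvg_geometric_eseries_half R 1 0.
  rewrite expr0 divr1; apply: cvg_trans; apply: near_eq_cvg; apply: nearW => k /=.
  by rewrite /eseries /=; apply: eq_bigr => i _; rewrite div1r addn1.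
have full A : `[p, q]%classic `<=` A -> mu A = 1%E.
  move=> pqA; rewrite /mu /= /pushforward /mseries -sum1; apply: eq_eseriesr => k _.
  rewrite /m /= /mscale /= uniform_prob_itv ?mule1//.
  by apply: subset_trans pqA; apply: subset_itv; rewrite bnd_simp.
have [rho rhoE] := probability_of_measure _ _ mu (0 : R) (full setT (@subsetT _ _)).
exists rho; split.
- move=> x; rewrite rhoE /mu /= /pushforward /mseries eseries0// => k _ _.
  by rewrite /m /= /mscale /= uniform_prob_set1 mule0.
- by rewrite rhoE full.
- move=> k; rewrite rhoE /mu /= /pushforward /mseries.
  have -> : ((2 ^ k.+1)%:R^-1)%:E = m k `[p, p + r k]%classic.
    by rewrite /m /= /mscale /= uniform_prob_itv ?mule1.
  apply: le_trans (nneseries_lim_ge k.+1 _); last by move=> *; exact: measure_ge0.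
  by rewrite big_nat_recr//= leeDr// sume_ge0.
Qed.

End SingularMixture.

Lemma cost_fun2_ge {R : realType} (w : R -> R -> \bar R) (x : 2.-tuple R) :
  (forall u v, (0 <= w u v)%E) ->
  (w (tnth x ord0) (tnth x (lift ord0 ord0)) <= cost_fun w 2 x)%E.
Proof.
move=> w0; rewrite /cost_fun (bigD1 (ord0, lift ord0 ord0))//=.
by rewrite leeDl// sume_ge0.
Qed.

Section Finiteness.
Context {R : realType} (a b : R) (w : R -> R -> \bar R).
Hypothesis w_cont : continuous (fun p : R * R => w p.1 p.2).
Hypothesis wC : forall x y, w x y = w y x.
Hypothesis w_ge0 : forall x y, (0 <= w x y)%E.
Hypothesis w_cross : crossing_minimal w.
Hypothesis finite_cost : forall rho : probability R R, prob_on a b rho -> nonatomic rho ->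
  exists2 g : {measure set (2.-tuple R) -> \bar R}, Pi 2 rho g & (\int[g]_x cost_fun w 2 x < +oo)%E.

(** A tube argument: by continuity the cost exceeds [M] near each point [(p, y)], and compactness of
    [[p, q]] gives a common radius. *)
Lemma infinite_row_radius (p q M : R) : p < q ->
  (forall y, p <= y <= q -> w p y = +oo%E) ->
  exists r, [/\ 0 < r, p + r <= q &
    forall x y, p <= x <= p + r -> p <= y <= q -> (M%:E <= w x y)%E].
Proof.
move=> pq winf.
have cpt : compact `[p, q]%classic by exact: segment_compact.
have /compact_near_coveringP/(_ _ (nbhs p) (fun x y => (M%:E < w y x)%E)) := cpt.
have near1 y : `[p, q]%classic y -> \forall y' \near y & x \near nbhs p, (M%:E < w y' x)%E.
  rewrite /= in_itv/= => pyq.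
  have nb : nbhs (w y p) [set u | (M%:E < u)%E].
    apply: open_nbhs_nbhs; split; first exact: open_ereal_gt_ereal.
    by rewrite /= wC winf// ltry.
  exact: (w_cont (y, p) _ nb).
move=> /(_ _ near1) /nbhs_ballP[e /= e0 eP].
exists (Num.min (e / 2) (q - p)); split.
- by rewrite lt_min divr_gt0//= subr_gt0.
- by rewrite -lerBrDl ge_min lexx orbT.
- move=> x y /andP[px xp] pyq; rewrite wC; apply: ltW; apply: (eP x).
    rewrite /ball /= ltr_norml; have : Num.min (e / 2) (q - p) <= e / 2 by rewrite ge_min lexx.
    by move: (Num.min _ _) xp => u xp ue; apply/andP; split; lra.
  by rewrite /= in_itv.
Qed.

(* If [w p] were infinite on [[p, q]], then [w >= 4 ^ k] near [p] within some radius
   [r k], and a measure giving that neighbourhood mass at least [2 ^ -(k + 1)] for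
   every [k] would have infinite cost. *)
Lemma no_infinite_row (p q : R) : a <= p -> p < q -> q <= b ->
  exists2 y, p <= y <= q & (w p y < +oo)%E.
Proof.
move=> ap pq qb; apply: contrapT => /forall2NP H.
have winf y : p <= y <= q -> w p y = +oo%E.
  by move=> pyq; have [//|/negP] := H y; rewrite -leNgt leye_eq => /eqP.
have [r rP] := choice (fun k : nat => infinite_row_radius p q (4 ^ k)%:R pq winf).
have r_gt0 k : 0 < r k by have [] := rP k.
have r_le k : p + r k <= q by have [] := rP k.
have [rho [rho_na rho_pq rho_r]] := singular_mixture p q r r_gt0 r_le.
have rho_ab : prob_on a b rho.
  apply/eqP; rewrite eq_le probability_le1//= -rho_pq; apply: measure_le => //.
  by apply: subset_itv; rewrite bnd_simp.
have [g g_Pi g_fin] := finite_cost rho rho_ab rho_na.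
pose i0 : 'I_2 := ord0; pose i1 : 'I_2 := lift ord0 ord0.
have mcoord (i : 'I_2) (A : set R) : measurable A -> measurable (Defs.coord 2 i @^-1` A).
  by move=> mA; rewrite -[X in measurable X]setTI; exact: (measurable_tnth i).
have mc : measurable_fun setT (cost_fun w 2).
  by apply: measurable_cost_fun; exact: continuous2_measurable.
have big k : (((2 ^ k)%:R / 2)%:E <= \int[g]_x cost_fun w 2 x)%E.
  pose E : set (2.-tuple R) := (Defs.coord 2 i0 @^-1` `[p, p + r k]%classic) `&`
                              (Defs.coord 2 i1 @^-1` `[p, q]%classic).
  have mE : measurable E by apply: measurableI; exact: mcoord.
  (* Both marginals are [rho], which is carried by [[p, q]], so constraining the second coordinate
     loses no mass. *)
  have gE : g E = rho `[p, p + r k]%classic.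
    rewrite -(g_Pi i0)//; apply/eqP; rewrite eq_le; apply/andP; split.
      by apply: measure_le => //; [exact: mcoord|move=> x []].
    pose Z : set (2.-tuple R) := Defs.coord 2 i1 @^-1` (~` `[p, q]%classic).
    have mZ : measurable Z by apply: mcoord; exact: measurableC.
    have Z0 : g Z = 0%E.
      rewrite (g_Pi i1); last exact: measurableC.
      by rewrite probability_setC// rho_pq subee.
    rewrite -(measureU0 mE mZ Z0); apply: measure_le; [exact: mcoord|exact: measurableU|].
    move=> x xr; have [xq|xq] := pselect ((Defs.coord 2 i1 @^-1` `[p, q]%classic) x); [by left|by right].
  have -> : ((2 ^ k)%:R / 2)%:E = ((4 ^ k)%N%:R%:E * ((2 ^ k.+1)%:R^-1)%:E)%E :> \bar R.
    rewrite -EFinM; congr EFin; rewrite (_ : 4 = 2 * 2)%N// expnMn expnS !natrM.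
    by rewrite !natrX; field; rewrite expf_neq0.
  apply: (@le_trans _ _ ((4 ^ k)%N%:R%:E * g E)%E).
    by rewrite gE lee_pmul2l ?lte_fin// ?ltr0n ?expn_gt0.
  rewrite -integral_cst//.
  apply: (@le_trans _ _ (\int[g]_(x in E) cost_fun w 2 x)%E).
    apply: ge0_le_integral => //=.
    - exact: measurable_funTS.
    - move=> x [/= x0 x1]; apply: le_trans (cost_fun2_ge w x w_ge0).
      by have [_ _] := rP k; apply.
  apply: ge0_subset_integral => // x _; exact: cost_fun_ge0.
have ge0 : (0 <= \int[g]_x cost_fun w 2 x)%E.
  by apply: integral_ge0 => x _; exact: cost_fun_ge0.
have fin : (\int[g]_x cost_fun w 2 x)%E \is a fin_num by rewrite ge0_fin_numE.
pose I := fine (\int[g]_x cost_fun w 2 x)%E.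
have I_ge0 : 0 <= I by exact: fine_ge0.
pose m := (Num.truncn (2 * I)).+1; have Im : 2 * I < m%:R by exact: truncnS_gt.
have := big m; rewrite -(fineK fin) lee_fin -/I ler_pdivrMr// => le1.
have : (m <= 2 ^ m)%N by apply: ltnW; exact: ltn_expl.
rewrite -(ler_nat R) => le2; have := le_trans le2 le1; by rewrite leNgt mulrC Im.
Qed.

(** Take [u] in [[x, y]] and [v] in [[y, b]] at finite cost from [x] and from [y]; the crossing
    inequality at [x <= u <= y <= v] bounds [w x y] by [w x u + w y v]. *)
Lemma crossing_finite x y : a <= x -> x < y -> y < b -> (w x y < +oo)%E.
Proof.
move=> ax xy yb.
have [u /andP[xu uy] wu] := no_infinite_row x y ax xy (ltW yb).
have [v /andP[yv vb] wv] := no_infinite_row y b (le_trans ax (ltW xy)) yb (lexx _).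
have [+ _] := w_cross x u y v xu uy yv.
move=> le1; apply: (@le_lt_trans _ _ (w x y + w u v)%E); first by rewrite leeDl.
by apply: (le_lt_trans le1); rewrite lte_add_pinfty.
Qed.

End Finiteness.

(** * Uniform averages of image measures *)

Section Mixture.
Context {R : realType} d1 d2 (X : measurableType d1) (Y : measurableType d2).
Context (U : {measure set Y -> \bar R}) (I : finType) (i0 : I) (phi : I -> Y -> X).
Hypothesis mphi : forall i, measurable_fun setT (phi i).

Let card_inv_ge0 : 0 <= #|I|%:R^-1 :> R. Proof. by rewrite invr_ge0. Qed.

(** The enumeration of [I] is there because [msum] is indexed by natural numbers; [i0] is the
    default of [nth]. *)
Definition mixture : {measure set X -> \bar R} :=
  mscale (NngNum card_inv_ge0)
    (msum (fun k => image_measure _ _ _ _ U _ (mphi (nth i0 (enum I) k))) #|I|).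

Let sum_enum (F : I -> \bar R) : (\sum_(k < #|I|) F (nth i0 (enum I) k) = \sum_i F i)%E.
Proof.
rewrite -(big_mkord xpredT (fun k => F (nth i0 (enum I) k))) cardE.
by rewrite -(big_nth i0 xpredT F) big_enum.
Qed.

Lemma mixtureE A : mixture A = ((#|I|%:R^-1)%:E * \sum_i U (phi i @^-1` A))%E.
Proof.
rewrite /mixture /= /mscale /msum /=; congr (_ * _)%E.
by rewrite -(sum_enum (fun i => U (phi i @^-1` A))).
Qed.

Lemma integral_mixture (f : X -> \bar R) : measurable_fun setT f -> (forall x, (0 <= f x)%E) ->
  (\int[mixture]_x f x = (#|I|%:R^-1)%:E * \sum_i \int[U]_y f (phi i y))%E.
Proof.
move=> mf f0; rewrite /mixture ge0_integral_mscale//=; congr (_ * _)%E.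
rewrite ge0_integral_measure_sum//.
rewrite -(sum_enum (fun i => \int[U]_y f (phi i y))%E); apply: eq_bigr => k _.
by rewrite ge0_integral_pushforward.
Qed.

End Mixture.

(** * From optimality to the crossing inequalities *)

Definition clampR {R : realType} (lo hi x : R) : R := Num.max lo (Num.min hi x).

Lemma clampR_id {R : realType} (lo hi x : R) : lo <= x -> x <= hi -> clampR lo hi x = x.
Proof. by move=> lx xh; rewrite /clampR (min_idPr xh) (max_idPr lx). Qed.

Lemma clampR_ge {R : realType} (lo hi x : R) : lo <= clampR lo hi x.
Proof. by rewrite /clampR le_max lexx. Qed.

Lemma clampR_le {R : realType} (lo hi x : R) : lo <= hi -> clampR lo hi x <= hi.
Proof. by move=> lh; rewrite /clampR ge_max lh ge_min lexx. Qed.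

Lemma clampR_nd {R : realType} (lo hi : R) : {homo clampR lo hi : x y / x <= y}.
Proof. by move=> x y xy; rewrite /clampR ge_max le_max lexx/= le_max; apply/orP; right; rewrite le_min !ge_min lexx xy orbT. Qed.

Lemma measurable_clampR {R : realType} (lo hi : R) : measurable_fun setT (clampR lo hi).
Proof. by apply: nondecreasing_measurable => //; exact: clampR_nd. Qed.

Lemma cost_fun2 {R : realType} (w : R -> R -> \bar R) (x : 2.-tuple R) :
  (cost_fun w 2 x = w (tnth x ord0) (tnth x (lift ord0 ord0))
                  + w (tnth x (lift ord0 ord0)) (tnth x ord0))%E.
Proof.
rewrite /cost_fun -(pair_big_dep xpredT (fun i j : 'I_2 => i != j)
   (fun i j => w (tnth x i) (tnth x j))) /=.
under eq_bigr => i _ do rewrite big_mkcond /=.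
by rewrite !big_ord_recl !big_ord0 /= !(adde0, add0e).
Qed.

Section FourPoints.
Context {R : realType} (a b x1 x2 x3 x4 e : R) (w : R -> R -> \bar R).
Hypothesis e_gt0 : 0 < e.
Hypothesis ax1 : a <= x1.
Hypothesis x12 : x1 + e < x2.
Hypothesis x23 : x2 + e < x3.
Hypothesis x34 : x3 + e < x4.
Hypothesis x4b : x4 + e <= b.
Hypothesis w_cont : continuous (fun p : R * R => w p.1 p.2).
Hypothesis wC : forall x y, w x y = w y x.
Hypothesis w_ge0 : forall x y, (0 <= w x y)%E.

Local Ltac flra := move: ax1 x12 x23 x34 x4b e_gt0 => ? ? ? ? ? ?; lra.

Let U : {measure set R -> \bar R} := image_measure _ _ _ _ (uniform_prob e_gt0) _ measurable_idR.

Let U_full A : `[0, e]%classic `<=` A -> U A = 1%E.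
Proof. by move=> eA; rewrite /U /= /pushforward uniform_prob_itv. Qed.

Let U_set1 x : U [set x] = 0%E.
Proof. by rewrite /U /= /pushforward uniform_prob_set1. Qed.

Let U_eq A B : (forall t, 0 <= t <= e -> A t <-> B t) -> U A = U B.
Proof.
move=> AB; rewrite /U /= /pushforward /uniform_prob !preimage_id.
rewrite integral_uniform_pdf [RHS]integral_uniform_pdf.
suff -> : A `&` `[0, e]%classic = B `&` `[0, e]%classic by [].
by apply/seteqP; split => t /= [At]; rewrite in_itv/= => te; split => //; apply/(AB _ te).
Qed.

Let x := pts4 x1 x2 x3 x4.
Let shift i t := x i + t.

Let mshift i : measurable_fun setT (shift i).
Proof. by apply: measurable_funD. Qed.

Let i0 : 'I_4 := ord0.
Let mix := mixture _ _ _ _ U _ i0 shift mshift.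

Let sum4 (F : 'I_4 -> \bar R) : (\sum_i F i =
  F ord0 + (F (lift ord0 ord0) + (F (lift ord0 (lift ord0 ord0)) + F (lift ord0 (lift ord0 (lift ord0 ord0))))))%E.
Proof. by rewrite !big_ord_recl big_ord0 adde0. Qed.

Let mixE A : (mix A = (4^-1)%:E * (U [set t | A (x1 + t)%R] + (U [set t | A (x2 + t)%R]
   + (U [set t | A (x3 + t)%R] + U [set t | A (x4 + t)%R]))))%E.
Proof. by rewrite /mix mixtureE sum4 card_ord. Qed.

Let x_range i : a <= x i /\ x i + e <= b.
Proof.
have e0 := e_gt0.
have key (y : R) : [\/ y = x1, y = x2, y = x3 | y = x4] -> a <= y /\ y + e <= b.
  by case=> ->; split; flra.
by apply: key; case: i => -[|[|[|[|//]]]] /= ?; [apply: Or41|apply: Or42|apply: Or43|apply: Or44].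
Qed.

Let d1 := (x2 + e + x3) / 2.

(** Exchanges by translation the interval at [x1] with that at [x3], and the one at [x2] with that
    at [x4]. In the gaps, clamping keeps [T] monotone on both sides of [d1], the middle of the
    central gap, and inside [[a, b]]. *)
Let T y := if y < d1 then
    (if y < x2 then clampR x3 (x3 + e) (y + (x3 - x1)) else clampR x4 (x4 + e) (y + (x4 - x2)))
  else (if y < x4 then clampR x1 (x1 + e) (y - (x3 - x1)) else clampR x2 (x2 + e) (y - (x4 - x2))).

Let mT : measurable_fun setT T.
Proof.
have mcl (lo hi c : R) : measurable_fun setT (fun y : R => clampR lo hi (y + c)).
  by apply: (measurableT_comp (measurable_clampR lo hi)); exact: measurable_funD.
by rewrite /T; apply: measurable_fun_ifT; [exact: measurable_fun_ltr| |];
  apply: measurable_fun_ifT; try exact: measurable_fun_ltr; exact: mcl.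
Qed.

Let Tx1 t : 0 <= t <= e -> T (x1 + t) = x3 + t.
Proof.
move=> /andP[t0 te]; rewrite /T !ifT ?clampR_id /d1//; flra.
Qed.

Let Tx2 t : 0 <= t <= e -> T (x2 + t) = x4 + t.
Proof.
move=> /andP[t0 te]; rewrite /T ifT; last by rewrite /d1; flra.
rewrite ifF; last by apply/negbTE; rewrite -leNgt; flra.
rewrite clampR_id; flra.
Qed.

Let Tx3 t : 0 <= t <= e -> T (x3 + t) = x1 + t.
Proof.
move=> /andP[t0 te]; rewrite /T ifF; last by apply/negbTE; rewrite -leNgt /d1; flra.
rewrite ifT; last by flra.
rewrite clampR_id; flra.
Qed.

Let Tx4 t : 0 <= t <= e -> T (x4 + t) = x2 + t.
Proof.
move=> /andP[t0 te]; rewrite /T ifF; last by apply/negbTE; rewrite -leNgt /d1; flra.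
rewrite ifF; last by apply/negbTE; rewrite -leNgt; flra.
rewrite clampR_id; flra.
Qed.

Let d k : R := if k is k'.+1 then (if k' is _.+1 then b else d1) else a.

Lemma four_points_probability : exists rho : probability R R,
  [/\ forall A, rho A = mix A, prob_on a b rho, nonatomic rho & is_seidl_map a b 2 rho T].
Proof.
have e0 := e_gt0.
have full A : `[a, b]%classic `<=` A -> mix A = 1%E.
  move=> abA.
  rewrite /mix mixtureE card_ord (eq_bigr (fun=> 1%E)); last first.
    move=> i _; apply: U_full => t /=; rewrite in_itv/= => te; apply: abA; rewrite /= in_itv/=.
    by have [? ?] := x_range i; rewrite /shift; apply/andP; split; flra.
  by rewrite sumEFin sumr_const card_ord -EFinM mulVf.
have [rho rhoE] := probability_of_measure _ _ mix (0 : R) (full setT (@subsetT _ _)).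
have empty A : (forall t, 0 <= t <= e -> ~ A t) -> U A = 0%E.
  by move=> H; rewrite (U_eq A set0) ?measure0// => t /H.
exists rho; split => //.
- by rewrite /prob_on rhoE full.
- move=> y; rewrite rhoE /mix mixtureE big1 ?mule0// => i _.
  rewrite (_ : _ @^-1` _ = [set y - x i]) ?U_set1//.
  by apply/seteqP; split => t /=; rewrite /shift => H; flra.
have lo A : mix (`[a, d1]%classic `&` A) =
    ((4^-1)%:E * (U [set t | A (x1 + t)%R] + U [set t | A (x2 + t)%R]))%E.
  rewrite mixE; congr (_ * _)%E.
  rewrite (U_eq _ [set t | A (x1 + t)]); last first.
    by move=> t te /=; rewrite in_itv/=; split => [[]//|At]; split => //; rewrite /d1; apply/andP; split; flra.
  rewrite (U_eq [set t | _ (x2 + t)] [set t | A (x2 + t)]); last first.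
    by move=> t te /=; rewrite in_itv/=; split => [[]//|At]; split => //; rewrite /d1; apply/andP; split; flra.
  rewrite (empty [set t | _ (x3 + t)]); last by move=> t te /= []; rewrite in_itv/= /d1; flra.
  rewrite (empty [set t | _ (x4 + t)]); last by move=> t te /= []; rewrite in_itv/= /d1; flra.
  by rewrite !adde0.
have hi A : mix (`[d1, b]%classic `&` A) =
    ((4^-1)%:E * (U [set t | A (x3 + t)%R] + U [set t | A (x4 + t)%R]))%E.
  rewrite mixE; congr (_ * _)%E.
  rewrite (empty [set t | _ (x1 + t)]); last by move=> t te /= []; rewrite in_itv/= /d1; flra.
  rewrite (empty [set t | _ (x2 + t)]); last by move=> t te /= []; rewrite in_itv/= /d1; flra.
  rewrite (U_eq _ [set t | A (x3 + t)]); last first.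
    by move=> t te /=; rewrite in_itv/=; split => [[]//|At]; split => //; rewrite /d1; apply/andP; split; flra.
  rewrite (U_eq [set t | _ (x4 + t)] [set t | A (x4 + t)]); last first.
    by move=> t te /=; rewrite in_itv/=; split => [[]//|At]; split => //; rewrite /d1; apply/andP; split; flra.
  by rewrite !add0e.
have half : ((4^-1)%:E * (1 + 1) = (2%:R^-1)%:E :> \bar R)%E.
  by rewrite -EFinD -EFinM; congr EFin; field.
exists d; split => //.
- by case=> [|[|//]] _; rewrite /d /d1; flra.
- case=> [|[|//]] _; rewrite rhoE -[X in mix X]setIT /d.
  + by rewrite lo !U_full.
  + by rewrite hi !U_full.
split => //.
- move=> y _; rewrite in_itv/= /T.
  have cl l : a <= l -> l + e <= b -> forall z, a <= clampR l (l + e) z <= b.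
    move=> al lb z; rewrite (le_trans al (clampR_ge _ _ _))//=.
    by rewrite (le_trans (clampR_le _ _ _ _) lb)//; flra.
  by case: ifP => _; case: ifP => _; apply: cl; flra.
- have cl l l' z z' : l + e <= l' -> clampR l (l + e) z <= clampR l' (l' + e) z'.
    move=> ll; apply: le_trans (clampR_ge _ _ _); apply: le_trans ll; apply: clampR_le; flra.
  case=> [|[|//]] _ y z; rewrite !in_itv/= => /andP[ay yd] /andP[az zd] yz; rewrite /T.
  + rewrite yd zd; case: (ltP y x2) => yx; case: (ltP z x2) => zx.
    - by apply: clampR_nd; flra.
    - by apply: cl; flra.
    - flra.
    - by apply: clampR_nd; flra.
  + rewrite [y < d1]ltNge (ltW ay) [z < d1]ltNge (ltW az) /=.
    case: (ltP y x4) => yx; case: (ltP z x4) => zx.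
    - by apply: clampR_nd; flra.
    - by apply: cl; flra.
    - flra.
    - by apply: clampR_nd; flra.
- case=> [|//] _ A mA; rewrite !rhoE /d lo hi; congr (_ * (_ + _))%E.
  + by apply: U_eq => t te /=; rewrite Tx1.
  + by apply: U_eq => t te /=; rewrite Tx2.
- move=> A mA; rewrite !rhoE /d lo hi; congr (_ * (_ + _))%E.
  + by apply: U_eq => t te /=; rewrite Tx3.
  + by apply: U_eq => t te /=; rewrite Tx4.
Qed.

Hypothesis opt : forall (rho : probability R R) (S : R -> R), prob_on a b rho -> nonatomic rho ->
  is_seidl_map a b 2 rho S -> forall gam : {measure set (2.-tuple R) -> \bar R}, Pi 2 rho gam ->
  (\int[rho]_y cost_fun w 2 (seidl_tuple 2 S y) <= \int[gam]_y cost_fun w 2 y)%E.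

Let c2 u v := (w u v + w v u)%E.

Let mc : measurable_fun setT (cost_fun w 2).
Proof. by apply: measurable_cost_fun; exact: continuous2_measurable. Qed.

Let c_ge0 y : (0 <= cost_fun w 2 y)%E. Proof. exact: cost_fun_ge0. Qed.

Let U_ae : {ae U, forall t, 0 <= t <= e}.
Proof.
exists (~` `[0, e]%classic); split; first exact: measurableC.
  by rewrite (U_eq _ set0) ?measure0// => t te; split => // nt; apply: nt; exact: te.
by move=> t nt; exact: nt.
Qed.

(** The competitor pairs [x_i + t] with [y_i + t], where [y] rearranges [x]. On the Seidl side each
    pair arises from both of its ends and in both orders, hence the factor 4. Real bounds are used
    since costs may be infinite. *)
Lemma four_points_le (y1 y2 y3 y4 k1 k2 : R) :
  perm_eq [:: y1; y2; y3; y4] [:: x1; x2; x3; x4] -> 0 <= k1 ->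
  (forall t, (0 <= t <= e)%R -> k1%:E <= w (x1 + t)%R (x3 + t)%R + w (x2 + t)%R (x4 + t)%R)%E ->
  (forall t, (0 <= t <= e)%R ->
    c2 (x1 + t)%R (y1 + t)%R + (c2 (x2 + t)%R (y2 + t)%R +
      (c2 (x3 + t)%R (y3 + t)%R + c2 (x4 + t)%R (y4 + t)%R)) <= (4 * k2)%:E)%E -> k1 <= k2.
Proof.
move=> xy k1_ge0 lower upper.
have [rho [rhoE rho_ab rho_na rho_T]] := four_points_probability.
pose y := pts4 y1 y2 y3 y4.
pose phi i t : 2.-tuple R := [tuple x i + t; y i + t].
have mphi i : measurable_fun setT (phi i).
  apply/measurable_fun_tnthP => -[[|[|//]] ?] /=.
  - by apply: (eq_measurable_fun (fun t => x i + t)) => //; exact: measurable_funD.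
  - by apply: (eq_measurable_fun (fun t => y i + t)) => //; exact: measurable_funD.
pose gam := mixture _ _ _ _ U _ i0 phi mphi.
have gam_Pi : Pi 2 rho gam.
  move=> [[|[|//]] ?] A mA; rewrite rhoE /gam mixtureE card_ord ?mixE; congr (_ * _)%E.
  - by rewrite sum4.
  - rewrite sum4; pose G (z : R) : \bar R := U [set t | A (z + t)].
    transitivity (\sum_(z <- [:: y1; y2; y3; y4]) G z)%E.
      by rewrite !big_cons big_nil adde0.
    by rewrite (perm_big _ xy) /= !big_cons big_nil adde0.
have := opt rho T rho_ab rho_na rho_T gam gam_Pi.
have mTt : measurable_fun setT (seidl_tuple 2 T).
  exact: (measurable_seidl_tuple a b 2 rho T rho_T).
have mcT : measurable_fun setT (fun z => cost_fun w 2 (seidl_tuple 2 T z)).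
  exact: (measurableT_comp mc mTt).
rewrite (eq_measure_integral mix); last by move=> A mA _; exact: rhoE.
rewrite [X in (X <= _)%E](integral_mixture _ _ _ _ U _ i0 shift mshift)//.
rewrite [X in (_ <= X)%E](integral_mixture _ _ _ _ U _ i0 phi mphi)//.
rewrite card_ord lee_pmul2l ?lte_fin ?invr_gt0//.
have msh i : measurable_fun setT (fun t => cost_fun w 2 (seidl_tuple 2 T (shift i t))).
  exact: (measurableT_comp mcT (mshift i)).
have mph i : measurable_fun setT (fun t => cost_fun w 2 (phi i t)).
  exact: (measurableT_comp mc (mphi i)).
rewrite -(ge0_integral_sum U measurableT msh)// -(ge0_integral_sum U measurableT mph)//.
have U1 : U setT = 1%E by exact: U_full.
move=> le1.
suff : ((4 * k1)%:E <= (4 * k2)%:E)%E by rewrite lee_fin ler_pM2l.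
have int_cst k : (\int[U]_t k%:E = k%:E)%E by rewrite integral_cst// U1 mule1.
rewrite -int_cst -[leRHS]int_cst; apply: le_trans (le_trans le1 _).
- apply: ae_ge0_le_integral => //.
  + by move=> t _; rewrite lee_fin mulr_ge0.
  + by move=> t _; apply: sume_ge0.
  + exact: emeasurable_sum.
  apply: filterS U_ae => t te _; rewrite sum4 !cost_fun2 !tnth_mktuple /= /shift /x /pts4 /=.
  rewrite Tx1// Tx2// Tx3// Tx4//.
  rewrite (wC (x3 + t)) (wC (x4 + t)) addeA [X in (_ <= X + X)%E]addeACA.
  have le_k := lower t te; rewrite (_ : (4 * k1)%:E = k1%:E + k1%:E + (k1%:E + k1%:E))%E.
    by rewrite !leeD.
  by rewrite -!EFinD; congr EFin; ring.
- apply: ae_ge0_le_integral => //.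
  + by move=> t _; apply: sume_ge0.
  + exact: emeasurable_sum.
  + move=> t _; have te : 0 <= (0 : R) <= e by rewrite lexx ltW.
    by apply: le_trans (upper 0 te); rewrite /c2 !adde_ge0.
  apply: filterS U_ae => t te _; rewrite sum4 !cost_fun2 /phi.
  exact: upper.
Qed.

End FourPoints.

Lemma ereal_between {R : realType} (L H : \bar R) : (0 <= L)%E -> (L < H)%E ->
  exists k2 k1 : R, [/\ (L < k2%:E)%E, k2 < k1 & (k1%:E < H)%E].
Proof.
case: L => [l| |]//; last by rewrite lt_irreflexive_infty || (move=> _; case: H).
move=> l0; case: H => [h| |]//; rewrite ?lte_fin => lh.
- exists (l + (h - l) / 3), (l + (h - l) / 3 * 2); rewrite !lte_fin; split; lra.
- by exists (l + 1), (l + 2); rewrite !lte_fin ltry; split => //; lra.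
Qed.

Section CrossingFromOptimality.
Context {R : realType} (a b : R) (w : R -> R -> \bar R).
Hypothesis ab : a < b.
Hypothesis w_cont : continuous (fun p : R * R => w p.1 p.2).
Hypothesis wC : forall x y, w x y = w y x.
Hypothesis w_ge0 : forall x y, (0 <= w x y)%E.
Hypothesis opt : forall (rho : probability R R) (S : R -> R), prob_on a b rho -> nonatomic rho ->
  is_seidl_map a b 2 rho S -> forall gam : {measure set (2.-tuple R) -> \bar R}, Pi 2 rho gam ->
  (\int[rho]_y cost_fun w 2 (seidl_tuple 2 S y) <= \int[gam]_y cost_fun w 2 y)%E.

Let w_cvg (X : Type) (G : set_system X) {FG : Filter G} (u v : X -> R) (x y : R) :
  u @ G --> x -> v @ G --> y -> w (u k) (v k) @[k --> G] --> w x y.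
Proof.
move=> ux vy.
have uv : (u k, v k) @[k --> G] --> (x, y) by exact: cvg_real_pair.
exact: (cvg_comp _ _ uv (w_cont (x, y))).
Qed.

Let w2_cvg (p q r s : R) :
  (w (p + t)%R (q + t)%R + w (r + t)%R (s + t)%R)%E @[t --> nbhs (0 : R)] --> (w p q + w r s)%E.
Proof.
have sh (z : R) : z + t @[t --> nbhs (0 : R)] --> z.
  by rewrite -[X in _ --> X]addr0; apply: cvgD; [exact: cvg_cst|exact: cvg_id].
by apply: cvgeD; [by apply: ge0_adde_def; rewrite inE|exact: w_cvg|exact: w_cvg].
Qed.

(** A strict violation leaves room for two reals between the sides and persists under small
    translations, which contradicts [four_points_le]. The last hypothesis says that the
    rearrangement costs four copies of the pairing of [p] with [q] and [r] with [s]. *)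
Let crossing_open_aux (x1 x2 x3 x4 y1 y2 y3 y4 p q r s : R) :
  a <= x1 -> x1 < x2 -> x2 < x3 -> x3 < x4 -> x4 < b ->
  perm_eq [:: y1; y2; y3; y4] [:: x1; x2; x3; x4] ->
  (forall t, let c2 u v := (w u v + w v u)%E in
    c2 (x1 + t)%R (y1 + t)%R + (c2 (x2 + t)%R (y2 + t)%R +
      (c2 (x3 + t)%R (y3 + t)%R + c2 (x4 + t)%R (y4 + t)%R)) =
    (w (p + t)%R (q + t)%R + w (r + t)%R (s + t)%R + (w (p + t)%R (q + t)%R + w (r + t)%R (s + t)%R))
  + (w (p + t)%R (q + t)%R + w (r + t)%R (s + t)%R + (w (p + t)%R (q + t)%R + w (r + t)%R (s + t)%R)))%E ->
  (w x1 x3 + w x2 x4 <= w p q + w r s)%E.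
Proof.
move=> ax1 x12 x23 x34 x4b yx c2E; rewrite leNgt; apply/negP => lt1.
have [k2 [k1 [lt_k2 k21 lt_k1]]] := ereal_between _ _ (adde_ge0 (w_ge0 p q) (w_ge0 r s)) lt1.
have k1_ge0 : 0 <= k1.
  by apply: le_trans (ltW k21); rewrite -lee_fin; apply: le_trans (ltW lt_k2); rewrite adde_ge0.
have nb1 : nbhs (w x1 x3 + w x2 x4)%E [set u | (k1%:E < u)%E].
  by apply: open_nbhs_nbhs; split => //; exact: open_ereal_gt_ereal.
have nb2 : nbhs (w p q + w r s)%E [set u | (u < k2%:E)%E].
  by apply: open_nbhs_nbhs; split => //; exact: open_ereal_lt_ereal.
have /nbhs_ballP[dl1 /= dl1_gt0 dl1P] := w2_cvg x1 x3 x2 x4 _ nb1.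
have /nbhs_ballP[dl2 /= dl2_gt0 dl2P] := w2_cvg p q r s _ nb2.
pose dl := Num.min dl1 dl2.
have dl0 : 0 < dl by rewrite lt_min dl1_gt0.
have dlP t : ball (0 : R) dl t ->
    (k1%:E < w (x1 + t)%R (x3 + t)%R + w (x2 + t)%R (x4 + t)%R)%E
    /\ (w (p + t)%R (q + t)%R + w (r + t)%R (s + t)%R < k2%:E)%E.
  by rewrite /ball /= lt_min => /andP[b1 b2]; split; [exact: dl1P|exact: dl2P].
(* Half of each gap keeps the intervals disjoint and below [b]; half of [dl] keeps the translations
   in the open ball. *)
pose e := Num.min (dl / 2) (Num.min ((x2 - x1) / 2) (Num.min ((x3 - x2) / 2)
  (Num.min ((x4 - x3) / 2) ((b - x4) / 2)))).
have e0 : 0 < e by rewrite !lt_min; do !(apply/andP; split); lra.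
have [e1 e2 e3 e4 e5] : [/\ e <= dl / 2, e <= (x2 - x1) / 2, e <= (x3 - x2) / 2,
    e <= (x4 - x3) / 2 & e <= (b - x4) / 2].
  by rewrite /e; split; rewrite !ge_min lexx ?orbT.
have inball t : 0 <= t <= e -> ball (0 : R) dl t.
  by move=> /andP[t0 te]; rewrite /ball /= sub0r normrN ger0_norm//; lra.
suff : k1 <= k2 by lra.
apply: (four_points_le a b x1 x2 x3 x4 e w e0 _ _ _ _ _ w_cont wC w_ge0 opt y1 y2 y3 y4) => //; try lra.
- by move=> t /inball/dlP[/ltW].
- move=> t /inball/dlP[_ /ltW le2]; rewrite c2E.
  rewrite (_ : (4 * k2)%:E = k2%:E + k2%:E + (k2%:E + k2%:E))%E; first by rewrite !leeD.
  by rewrite -!EFinD; congr EFin; ring.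
Qed.

Lemma crossing_open (x1 x2 x3 x4 : R) :
  a <= x1 -> x1 < x2 -> x2 < x3 -> x3 < x4 -> x4 < b ->
  (w x1 x3 + w x2 x4 <= w x1 x2 + w x3 x4)%E /\
  (w x1 x3 + w x2 x4 <= w x1 x4 + w x2 x3)%E.
Proof.
move=> ax1 x12 x23 x34 x4b; split.
- apply: (crossing_open_aux x1 x2 x3 x4 x2 x1 x4 x3) => //.
    by apply/seq.permP => P /=; lia.
  move=> t /=; rewrite (wC (x2 + t)) (wC (x4 + t) (x3 + t)) addeA addeACA.
  by rewrite [X in (X + X)%E]addeACA.
- apply: (crossing_open_aux x1 x2 x3 x4 x4 x3 x2 x1) => //.
    by apply/seq.permP => P /=; lia.
  move=> t /=; rewrite (wC (x3 + t)) (wC (x4 + t)) addeA [X in (_ + X)%E]addeC.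
  by rewrite [X in (X + X)%E]addeACA.
Qed.

Lemma crossing_closed (x1 x2 x3 x4 : R) :
  a <= x1 -> x1 <= x2 -> x2 <= x3 -> x3 <= x4 -> x4 <= b ->
  (w x1 x3 + w x2 x4 <= w x1 x2 + w x3 x4)%E /\
  (w x1 x3 + w x2 x4 <= w x1 x4 + w x2 x3)%E.
Proof.
move=> ax1 x12 x23 x34 x4b.
(* Moving towards the points at fractions [m / 5] of [[a, b]], [m = 1, ..., 4], makes the four
   points strictly increasing and interior; the weight [1 / (k + 1)] tends to zero. *)
pose y (x : R) (m : nat) (k : nat) := x + k.+1%:R^-1 * (a + (b - a) * (m%:R / 5) - x).
have t0 k : 0 < k.+1%:R^-1 :> R by rewrite invr_gt0.
have t1 k : k.+1%:R^-1 <= 1 :> R by rewrite invf_le1// ler1n.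
have ycvg x m : y x m k @[k --> \oo] --> x.
  rewrite -[X in _ --> X]addr0 /y; apply: cvgD; first exact: cvg_cst.
  rewrite -[X in _ --> X](mul0r (a + (b - a) * (m%:R / 5) - x)); apply: cvgMl.
  exact: cvg_harmonic.
have y2cvg x m x' m' z l z' l' :
    (w (y x m k) (y x' m' k) + w (y z l k) (y z' l' k))%E @[k --> \oo] --> (w x x' + w z z')%E.
  by apply: cvgeD; [by apply: ge0_adde_def; rewrite inE|exact: w_cvg|exact: w_cvg].
have yP k : (w (y x1 1%N k) (y x3 3%N k) + w (y x2 2%N k) (y x4 4%N k) <=
             w (y x1 1%N k) (y x2 2%N k) + w (y x3 3%N k) (y x4 4%N k))%E /\
            (w (y x1 1%N k) (y x3 3%N k) + w (y x2 2%N k) (y x4 4%N k) <=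
             w (y x1 1%N k) (y x4 4%N k) + w (y x2 2%N k) (y x3 3%N k))%E.
  have ab' := ab; apply: crossing_open; rewrite /y; move: (k.+1%:R^-1) (t0 k) (t1 k) => t {}t0 {}t1; nra.
by split; rewrite -(cvg_lim _ (y2cvg x1 1%N x3 3%N x2 2%N x4 4%N))//;
  [rewrite -(cvg_lim _ (y2cvg x1 1%N x2 2%N x3 3%N x4 4%N))//|
   rewrite -(cvg_lim _ (y2cvg x1 1%N x4 4%N x2 2%N x3 3%N))//];
  (apply: lee_lim; [exact: cvgP (y2cvg _ _ _ _ _ _ _ _)|exact: cvgP (y2cvg _ _ _ _ _ _ _ _)|
   apply: nearW => k; have [] := yP k]).
Qed.

End CrossingFromOptimality.

(** * Uncrossing two configurations *)

(** Order statistics are handled through counts: sorting, merging and dealing out all reduce to this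
    equivalence. *)
Lemma nth_sort_le {R : realType} (x : seq R) (k : nat) (s : R) : (k < size x)%N ->
  ((sort <=%R x)`_k <= s) = (k < cnt x s)%N.
Proof.
move=> kx; rewrite /cnt -(count_sort <=%R); apply/idP/idP => [le_s|].
  rewrite ltnNge; apply/negP => le_k.
  have : (count (fun y : R => (y <= s)%R) (sort <=%R x) <= k < size (sort <=%R x))%N by rewrite le_k size_sort.
  by move=> /(nth_count_gt 0 (sort_le_sorted _)); rewrite ltNge le_s.
by move=> /(nth_count_le 0 (sort_le_sorted _)).
Qed.

Lemma sum_ltn_double n N : (N <= n.*2)%N -> (\sum_(i < n) (i.*2 < N) = uphalf N)%N.
Proof.
elim: n N => [|n IH] N; first by rewrite leqn0 big_ord0 => /eqP ->.
rewrite big_ord_recr /= doubleS => NN.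
have [lt1|le1] := ltnP n.*2 N; last by rewrite addn0 IH.
have E : (\sum_(i < n) (i.*2 < N) = \sum_(i < n) (i.*2 < n.*2))%N.
  by apply: eq_bigr => i _; rewrite ltn_double ltn_ord (leq_trans _ lt1)// ltnS leq_double ltnW.
rewrite E IH ?leqnn// uphalf_double.
have [->|->] : N = n.*2.+1 \/ N = n.*2.+2 by lia.
  by rewrite /= doubleK addn1.
by rewrite /= uphalf_double addn1.
Qed.

Lemma sum_ltn_doubleS n N : (N <= n.*2)%N -> (\sum_(i < n) (i.*2.+1 < N) = N./2)%N.
Proof.
case: N => [|N] NN; first by rewrite big1.
under eq_bigr => i _ do rewrite ltnS.
rewrite sum_ltn_double; first by [].
exact: ltnW.
Qed.

Section Uncross.
Context {R : realType} (n : nat).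
Implicit Types x y : n.-tuple R.

Definition merged x y : seq R := sort <=%R (tval x ++ tval y).

Definition uncross (j : bool) x y : n.-tuple R := [tuple (merged x y)`_(j + i.*2) | i < n].

Lemma size_merged x y : size (merged x y) = n.*2.
Proof. by rewrite /merged size_sort size_cat !size_tuple addnn. Qed.

Lemma cnt_merged x y s : cnt (tval x ++ tval y) s = (cnt x s + cnt y s)%N.
Proof. by rewrite /cnt count_cat. Qed.

Lemma cnt_le_size x s : (cnt x s <= n)%N.
Proof. by rewrite -[leqRHS](size_tuple x) count_size. Qed.

(** The even ranks below the merged count are its upper half and the odd ranks its lower half, so
    the two dealt-out configurations have counts differing by at most one. *)
Lemma cnt_uncross j x y s :
  cnt (uncross j x y) s = if j then (cnt x s + cnt y s)./2 else uphalf (cnt x s + cnt y s).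
Proof.
have NN : (cnt x s + cnt y s <= n.*2)%N by rewrite -addnn leq_add// cnt_le_size.
rewrite cntE; under eq_bigr => i _.
  rewrite tnth_mktuple nth_sort_le; last first.
    rewrite size_cat !size_tuple addnn; have := ltn_ord i; case: (j) => /=; lia.
  rewrite cnt_merged; over.
by case: j => /=; [exact: sum_ltn_doubleS|exact: sum_ltn_double].
Qed.

Lemma mem_uncross j x y : {subset uncross j x y <= tval x ++ tval y}.
Proof.
move=> t /tnthP[i ->]; rewrite tnth_mktuple -(mem_sort <=%R) mem_nth//.
by rewrite -/(merged x y) size_merged; have := ltn_ord i; case: (j) => /=; lia.
Qed.

Lemma sum_uncross (F : R -> \bar R) x y :
  (\sum_(i < n) F (tnth (uncross false x y) i) + \sum_(i < n) F (tnth (uncross true x y) i) =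
   \sum_(i < n) F (tnth x i) + \sum_(i < n) F (tnth y i))%E.
Proof.
transitivity (\sum_(t <- merged x y) F t)%E; last first.
  rewrite (perm_big (tval x ++ tval y)) /=; last by rewrite perm_sort.
  by rewrite big_cat /= !big_tuple.
rewrite -big_split /= (big_nth 0) size_merged.
under eq_bigr => i _ do rewrite !tnth_mktuple /= add0n add1n.
elim: (n) => [|m IH]; first by rewrite big_ord0 big_geq.
by rewrite big_ord_recr /= IH doubleS !big_nat_recr//= -addeA.
Qed.

(** Alternation in terms of counts: they differ by at most one, and the difference never has
    opposite signs at two thresholds. The last clause is what makes the events [ranked] nested
    across thresholds. *)
Definition interleaved x y := forall s t,
  [/\ (cnt x s <= (cnt y s).+1)%N, (cnt y s <= (cnt x s).+1)%N &
      ~ ((cnt y s < cnt x s)%N /\ (cnt x t < cnt y t)%N)].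

(** Counts are constant between grid points, both zero before the first and both [n] from the last
    one on. *)
Lemma cnt_on_grid (z : seq R) x y s : sorted <%R z -> {subset x <= z} -> {subset y <= z} ->
  cnt x s = cnt y s \/
  exists2 p, (p < (size z).-1)%N & cnt x s = cnt x z`_p /\ cnt y s = cnt y z`_p.
Proof.
move=> zs xz yz; have zs' : sorted <=%R z by apply: sub_sorted zs => ? ? /ltW.
set k := count (fun t => t <= s) z.
have above t : t \in z -> (t <= s) = (index t z < k)%N.
  move=> tz; have tz' : (index t z < size z)%N by rewrite index_mem.
  rewrite -{1}(nth_index 0 tz); have := nth_sort_le z (index t z) s tz'.
  by rewrite sort_le_id.
case Ek : k => [|p].
  left; rewrite [LHS](_ : _ = 0%N) ?[RHS](_ : _ = 0%N)//; apply/eqP; rewrite -leqn0 leqNgt -has_count;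
    apply/negP => /hasP[t tx /=]; rewrite above ?Ek//; [exact: yz|exact: xz].
have [pL|Lp] := ltnP p (size z).-1; [right; exists p => //|left].
  have pz : (p < size z)%N by lia.
  have E (u : n.-tuple R) : {subset u <= z} -> cnt u s = cnt u z`_p.
    move=> uz; apply: eq_in_count => t tu /=; have tz := uz _ tu.
    rewrite above// Ek ltnS -{2}(nth_index 0 tz) (lt_sorted_leq_nth 0)// inE// index_mem//.
  by rewrite !E.
have E (u : n.-tuple R) : {subset u <= z} -> cnt u s = n.
  move=> uz; rewrite /cnt -[RHS](size_tuple u); apply/eqP; rewrite -all_count.
  apply/allP => t tu /=; have tz := uz _ tu; rewrite above// Ek ltnS.
  have : (index t z < size z)%N by rewrite index_mem.
  by move=> it; apply: leq_trans Lp; rewrite -ltnS prednK//; exact: leq_ltn_trans it.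
by rewrite !E.
Qed.

End Uncross.

Section UncrossCost.
Context {R : realType} (a b : R) (w : R -> R -> \bar R) (n : nat).
Hypothesis wC : forall x y, w x y = w y x.
Hypothesis w_ge0 : forall x y, (0 <= w x y)%E.
Hypothesis w_cross : crossing_minimal w.
Hypothesis w_fin : forall x y, a <= x -> x < y -> y < b -> (w x y < +oo)%E.
Variables x y : n.-tuple R.
Hypothesis x_ab : forall i, a <= tnth x i < b.
Hypothesis y_ab : forall i, a <= tnth y i < b.
Hypothesis cost_fin : (cost_fun w n x + cost_fun w n y < +oo)%E.

Let c_ge0 (u : n.-tuple R) : (0 <= cost_fun w n u)%E. Proof. exact: cost_fun_ge0. Qed.

Lemma cost_fun_lty_pair (u : n.-tuple R) i j : (cost_fun w n u < +oo)%E -> i != j ->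
  (w (tnth u i) (tnth u j) < +oo)%E.
Proof.
move=> uf ij; apply: le_lt_trans uf.
by rewrite /cost_fun (bigD1 (i, j))//= leeDl// sume_ge0.
Qed.

(** The uncrossed pair is balanced and keeps the sum of the counts, so its cost is the affine bound
    summed over [x] and [y]. Equal costs force [x] and [y] to attain that bound, hence to be
    balanced for the same [m1] and [m2]. *)
Lemma uncross_cost :
  (cost_fun w n (uncross n false x y) + cost_fun w n (uncross n true x y)
     <= cost_fun w n x + cost_fun w n y)%E /\
  (crossing_strict a b w ->
   (cost_fun w n x + cost_fun w n y <=
     cost_fun w n (uncross n false x y) + cost_fun w n (uncross n true x y))%E ->
   interleaved n x y).
Proof.
pose z := sort <=%R (undup (tval x ++ tval y)).
have zs : sorted <%R z by rewrite /z sort_lt_sorted undup_uniq.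
have mem_z t : (t \in z) = (t \in tval x ++ tval y) by rewrite /z mem_sort mem_undup.
have xz : {subset x <= z} by move=> t tx; rewrite mem_z mem_cat; apply/orP; left.
have yz : {subset y <= z} by move=> t ty; rewrite mem_z mem_cat; apply/orP; right.
have uz j : {subset uncross n j x y <= z} by move=> t /mem_uncross; rewrite mem_z.
have z_ab t : t \in z -> a <= t < b.
  by rewrite mem_z mem_cat => /orP[] /tnthP[i ->].
have z_ge t : t \in z -> a <= t by move=> /z_ab/andP[].
have z_lt t : t \in z -> t < b by move=> /z_ab/andP[].
have xf : (cost_fun w n x < +oo)%E by apply: le_lt_trans cost_fin; rewrite leeDl.
have yf : (cost_fun w n y < +oo)%E by apply: le_lt_trans cost_fin; rewrite leeDr.
pose S := fine (cost_fun w n x + cost_fun w n y)%E.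
have SE : (cost_fun w n x + cost_fun w n y)%E = S%:E by rewrite fineK// ge0_fin_numE// adde_ge0.
(* Besides the grid bound, [K] exceeds the total cost [S], so a configuration of capped cost at most
   [S] contains no infinite pair. *)
pose K := Num.max (grid_bound w z) (S + 1).
have K_ge : grid_bound w z <= K by rewrite le_max lexx.
have K_gt : S < K by rewrite lt_max ltrDl ltr01 orbT.
have K0 : 0 <= K by apply: le_trans K_ge; exact: grid_bound_ge0.
pose N p := (cnt x z`_p + cnt y z`_p)%N.
pose m1 p : int := ((N p)./2)%:Z.
(* Rounding up instead of down changes the difference of the halves by [odd (N p) - odd (N q)]; the
   lower of the two values is taken. *)
pose m2 p q : int := ((N p)./2)%:Z - ((N q)./2)%:Z + (if odd (N q) && ~~ odd (N p) then -1 else 0).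
have [C [be [dual_le dual_eq dual_strict]]] := dual_cap_cost a b w wC w_ge0 w_cross w_fin z n K m1 m2
  zs z_ge z_lt K_ge.
have ubal j : balanced_on z m1 m2 (uncross n j x y).
  by split => [p pz|p q pz qz pq]; rewrite /consecutive /m1 /m2 !cnt_uncross -?/(N p) -?/(N q);
    case: j; rewrite ?uphalf_half; case: (odd (N p)); try case: (odd (N q)) => /=; lia.
have capE (u : n.-tuple R) : (cost_fun w n u < +oo)%E -> (cap_cost w K n u)%:E = cost_fun w n u.
  by move=> uf; apply: cap_cost_fin => // i j ij; exact: cost_fun_lty_pair.
have sumE : cap_cost w K n (uncross n false x y) + cap_cost w K n (uncross n true x y) =
    (C + \sum_(p < (size z).-1) be p * (cnt x z`_p)%:R) +
    (C + \sum_(p < (size z).-1) be p * (cnt y z`_p)%:R).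
  rewrite !dual_eq; try by [exact: uz|exact: ubal].
  set u0 := uncross n false x y; set u1 := uncross n true x y.
  have cu s : (cnt u0 s + cnt u1 s = cnt x s + cnt y s)%N by rewrite !cnt_uncross; lia.
  rewrite addrACA [RHS]addrACA -!big_split /=; congr (_ + _); apply: eq_bigr => p _.
  by rewrite -!mulrDr -!natrD cu.
have capS : cap_cost w K n x + cap_cost w K n y = S.
  by apply: EFin_inj; rewrite EFinD !capE.
have le1 : cap_cost w K n (uncross n false x y) + cap_cost w K n (uncross n true x y) <= S.
  by rewrite sumE -capS lerD// dual_le.
have cap0 (u : n.-tuple R) : 0 <= cap_cost w K n u by apply: sumr_ge0 => *; exact: cap_ge0.
have small (u : n.-tuple R) : cap_cost w K n u < K -> (cap_cost w K n u)%:E = cost_fun w n u.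
  move=> uK; apply: cap_cost_fin => // i j ij; rewrite ltNge leye_eq; apply/negP => woo.
  move: uK; rewrite ltNge => /negP; apply.
  rewrite /cap_cost (bigD1 (i, j))//= {1}/cap woo lerDl sumr_ge0// => *; exact: cap_ge0.
have uE j : (cap_cost w K n (uncross n j x y))%:E = cost_fun w n (uncross n j x y).
  apply: small; apply: le_lt_trans K_gt; apply: le_trans le1.
  by case: j; rewrite ?lerDl ?lerDr.
split; first by rewrite -!uE -EFinD SE lee_fin.
move=> strict; rewrite SE -!uE -EFinD lee_fin => ge1.
have [lx ly] := (dual_le x xz, dual_le y yz).
have bx : balanced_on z m1 m2 x by apply: dual_strict => //; lra.
have by_ : balanced_on z m1 m2 y by apply: dual_strict => //; lra.
have close p : (p < (size z).-1)%N -> (cnt x z`_p <= (cnt y z`_p).+1)%N /\ (cnt y z`_p <= (cnt x z`_p).+1)%N.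
  move=> pz; have := proj1 bx p pz; have := proj1 by_ p pz; rewrite /consecutive; lia.
move=> s t; split.
- have [->//|[p pz [-> ->]]] := cnt_on_grid n z x y s zs xz yz.
  by have [] := close p pz.
- have [->//|[p pz [-> ->]]] := cnt_on_grid n z x y s zs xz yz.
  by have [] := close p pz.
- move=> [lt_s lt_t].
  have [sE|[p pz [sx sy]]] := cnt_on_grid n z x y s zs xz yz; first by rewrite sE ltnn in lt_s.
  have [tE|[q qz [tx ty]]] := cnt_on_grid n z x y t zs xz yz; first by rewrite tE ltnn in lt_t.
  rewrite sx sy in lt_s; rewrite tx ty in lt_t.
  have [pq|pq] := eqVneq p q; first by rewrite pq in lt_s; lia.
  have := proj2 bx p q pz qz pq; have := proj2 by_ p q pz qz pq; rewrite /consecutive.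
  lia.
Qed.

End UncrossCost.

(** * Measurability of counts and of uncrossed configurations *)

Lemma measurable_fun_le_sets {R : realType} d (X : measurableType d) (f : X -> R) :
  (forall s, measurable [set x | f x <= s]) -> measurable_fun setT f.
Proof.
move=> mf; apply: (measurability (@RGenOInfty.G R)); first exact: RGenOInfty.measurableE.
move=> _ [_ [s ->] <-]; rewrite setTI.
rewrite [X in measurable X](_ : _ = ~` [set x | f x <= s]); first exact: measurableC.
apply/seteqP; split => x /=; rewrite in_itv/= andbT ltNge => H.
  exact/negP.
exact/negP.
Qed.

Lemma measurable_cnt {R : realType} n (s : R) :
  measurable_fun setT (fun x : n.-tuple R => (cnt x s)%:R : R).
Proof.
under eq_fun => x do rewrite cntE natr_sum.
apply: measurable_sum => i.
rewrite (_ : (fun x : n.-tuple R => (tnth x i <= s)%R%:R : R) = \1_((fun x : n.-tuple R => tnth x i) @^-1` `]-oo, s]%classic)).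
  apply: measurable_indic; rewrite -[X in measurable X]setTI.
  exact: (measurable_tnth i).
apply/funext => x; rewrite indicE; have [xs|xs] := boolP (tnth x i <= s).
  by rewrite mem_set//= in_itv.
by rewrite memNset//= in_itv; apply/negP.
Qed.

Lemma measurable_cnt_gt {R : realType} n (s : R) (k : nat) :
  measurable [set x : n.-tuple R | (k < cnt x s)%N].
Proof.
rewrite [X in measurable X](_ : _ = setT `&` (fun x : n.-tuple R => (cnt x s)%:R : R) @^-1` `]k%:R, +oo[%classic).
  by apply: measurable_cnt.
by rewrite setTI; apply/seteqP; split => x /=; rewrite in_itv/= andbT ltr_nat.
Qed.

Lemma measurable_uncross {R : realType} n j :
  measurable_fun setT (fun p : n.-tuple R * n.-tuple R => uncross n j p.1 p.2).
Proof.
apply/measurable_fun_tnthP => i; apply: measurable_fun_le_sets => s.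
pose g (p : n.-tuple R * n.-tuple R) : R := (cnt p.1 s)%:R + (cnt p.2 s)%:R.
have mg : measurable_fun setT g.
  apply: measurable_funD.
    exact: (measurableT_comp (measurable_cnt n s) measurable_fst).
  exact: (measurableT_comp (measurable_cnt n s) measurable_snd).
rewrite [X in measurable X](_ : _ = setT `&` g @^-1` `](j + i.*2)%:R, +oo[%classic).
  exact: mg.
rewrite setTI; apply/seteqP; split => p /=; rewrite in_itv/= andbT tnth_mktuple nth_sort_le.
- by rewrite cnt_merged /g -natrD ltr_nat.
- by rewrite size_cat !size_tuple addnn; have := ltn_ord i; case: (j) => /=; lia.
- by rewrite cnt_merged /g -natrD ltr_nat.
- by rewrite size_cat !size_tuple addnn; have := ltn_ord i; case: (j) => /=; lia.
Qed.

Lemma cost_fun_reindex {R : realType} (w : R -> R -> \bar R) n (x : n.-tuple R) (h : 'I_n -> 'I_n) :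
  injective h -> cost_fun w n [tuple tnth x (h i) | i < n] = cost_fun w n x.
Proof.
move=> hi; rewrite /cost_fun [RHS](reindex_inj (h := fun p => (h p.1, h p.2))) /=; last first.
  by move=> [i j] [i' j'] [/hi -> /hi ->].
by apply: eq_big => [[i j]|[i j] _] /=; rewrite ?(inj_eq hi)// !tnth_mktuple.
Qed.

(** The almost everywhere nonnegative difference [f - g] has zero integral; finiteness of the
    integral of [f] permits the subtraction. *)
Lemma ae_ge_of_integral_le {R : realType} d (X : measurableType d) (mu : {measure set X -> \bar R})
    (f g : X -> \bar R) :
  measurable_fun setT f -> measurable_fun setT g ->
  (forall x, (0 <= f x)%E) -> (forall x, (0 <= g x)%E) ->
  {ae mu, forall x, (g x <= f x)%E} -> (\int[mu]_x f x < +oo)%E ->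
  (\int[mu]_x f x <= \int[mu]_x g x)%E -> {ae mu, forall x, (f x <= g x)%E}.
Proof.
move=> mf mg f0 g0 gf f_fin fg.
have gf' : (\int[mu]_x g x <= \int[mu]_x f x)%E.
  by apply: ae_ge0_le_integral => //; apply: filterS gf.
have eq_int : (\int[mu]_x f x = \int[mu]_x g x)%E by apply/eqP; rewrite eq_le fg.
have fint : mu.-integrable setT f.
  apply/integrableP; split => //.
  by under eq_integral => x _ do rewrite gee0_abs//; exact: f_fin.
have gint : mu.-integrable setT g.
  apply/integrableP; split => //.
  by under eq_integral => x _ do rewrite gee0_abs//; rewrite -eq_int.
have ffin := integrable_ae measurableT fint; have gfin := integrable_ae measurableT gint.
have mfg : measurable_fun setT (f \- g)%E by exact: emeasurable_funB.
have abs0 : (\int[mu]_x `|(f \- g) x| = 0)%E.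
  transitivity (\int[mu]_x (f \- g) x)%E.
    apply: ae_eq_integral => //; first exact: measurableT_comp.
    apply: filterS3 gf ffin gfin => x gfx /(_ I) fx /(_ I) gx _.
    by rewrite gee0_abs// sube_ge0 ?gx ?orbT.
  rewrite integralB// -eq_int subee// ge0_fin_numE// integral_ge0//.
have /(ae_eq_integral_abs mu measurableT mfg) ae0 := abs0.
apply: filterS3 ae0 ffin gfin => x /(_ I) fg0 /(_ I) fx /(_ I) gx.
by rewrite -sube_le0; rewrite /= in fg0; rewrite fg0.
Qed.

(** * Interleaving of independent samples *)

Section SquareMeasure.
Context {R : realType} d (X : measurableType d) (P : probability X R).

Definition square_measure : {measure set (X * X) -> \bar R} := (P \x P)%E.

Lemma square_measureX (A B : set X) : measurable A -> measurable B ->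
  square_measure (A `*` B) = (P A * P B)%E.
Proof. by move=> mA mB; exact: product_measure1E. Qed.

Lemma square_measure_fst (A : set X) : measurable A -> square_measure (fst @^-1` A) = P A.
Proof.
move=> mA; rewrite (_ : fst @^-1` A = A `*` setT); last first.
  by apply/seteqP; split => [[x y] /= Ax|[x y] []].
by rewrite square_measureX// probability_setT mule1.
Qed.

Lemma square_measure_snd (A : set X) : measurable A -> square_measure (snd @^-1` A) = P A.
Proof.
move=> mA; rewrite (_ : snd @^-1` A = setT `*` A); last first.
  by apply/seteqP; split => [[x y] /= Ax|[x y] []].
by rewrite square_measureX// probability_setT mul1e.
Qed.

Lemma ae_square (Q : X -> Prop) : {ae P, forall x, Q x} ->
  {ae square_measure, forall p, Q p.1 /\ Q p.2}.
Proof.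
move=> [A [mA A0 QA]].
have mfst : measurable (fst @^-1` A : set (X * X)).
  by rewrite -[X in measurable X]setTI; exact: measurable_fst.
have msnd : measurable (snd @^-1` A : set (X * X)).
  by rewrite -[X in measurable X]setTI; exact: measurable_snd.
exists (fst @^-1` A `|` snd @^-1` A); split; first exact: measurableU.
  by rewrite measureU0//= ?square_measure_fst ?square_measure_snd.
move=> [x y] /= /not_andP[nQ|nQ]; [left|right]; exact: QA.
Qed.

Lemma integral_square_fst (f : X -> \bar R) : measurable_fun setT f -> (forall x, (0 <= f x)%E) ->
  (\int[square_measure]_p f p.1 = \int[P]_x f x)%E.
Proof.
move=> mf f0.
rewrite [RHS](eq_measure_integral (image_measure _ _ _ _ square_measure _ measurable_fst)); last first.
  by move=> A mA _; exact: (esym (square_measure_fst A mA)).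
by rewrite ge0_integral_pushforward.
Qed.

Lemma integral_square_snd (f : X -> \bar R) : measurable_fun setT f -> (forall x, (0 <= f x)%E) ->
  (\int[square_measure]_p f p.2 = \int[P]_x f x)%E.
Proof.
move=> mf f0.
rewrite [RHS](eq_measure_integral (image_measure _ _ _ _ square_measure _ measurable_snd)); last first.
  by move=> A mA _; exact: (esym (square_measure_snd A mA)).
by rewrite ge0_integral_pushforward.
Qed.

End SquareMeasure.

Section Interleaving.
Context {R : realType} (a b : R) (w : R -> R -> \bar R) (n : nat) (rho : probability R R).
Hypothesis ab : a < b.
Hypothesis w_cont : continuous (fun p : R * R => w p.1 p.2).
Hypothesis wC : forall x y, w x y = w y x.
Hypothesis w_ge0 : forall x y, (0 <= w x y)%E.
Hypothesis w_cross : crossing_minimal w.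
Hypothesis w_strict : crossing_strict a b w.
Hypothesis w_fin : forall x y, a <= x -> x < y -> y < b -> (w x y < +oo)%E.
Hypothesis rho_ab : prob_on a b rho.
Hypothesis rho_na : nonatomic rho.
Variable P : probability (n.+1.-tuple R) R.
Hypothesis P_Pi : Pi n.+1 rho P.
Hypothesis P_fin : (\int[P]_x cost_fun w n.+1 x < +oo)%E.
Hypothesis P_min : forall gam : {measure set (n.+1.-tuple R) -> \bar R}, Pi n.+1 rho gam ->
  (\int[P]_x cost_fun w n.+1 x <= \int[gam]_x cost_fun w n.+1 x)%E.

Local Notation P2 := (square_measure _ _ P).
Local Notation c := (cost_fun w n.+1).
Local Notation X := (n.+1.-tuple R).

Let mc : measurable_fun setT c.
Proof. by apply: measurable_cost_fun; exact: continuous2_measurable. Qed.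

Let c0 x : (0 <= c x)%E. Proof. exact: cost_fun_ge0. Qed.

Let un j (p : X * X) := uncross n.+1 j p.1 p.2.

Let mun j : measurable_fun setT (un j). Proof. exact: measurable_uncross. Qed.

(** The sum [i + jr.2] is that of ['I_n.+1], hence modulo [n + 1]. *)
Let phi (jr : bool * 'I_n.+1) (p : X * X) : X := [tuple tnth (un jr.1 p) (i + jr.2) | i < n.+1].

Let mphi jr : measurable_fun setT (phi jr).
Proof.
apply/measurable_fun_tnthP => i.
apply: (eq_measurable_fun (fun p => tnth (un jr.1 p) (i + jr.2))).
  by move=> p _; rewrite /phi [RHS]tnth_mktuple.
exact: (measurableT_comp (measurable_tnth (i + jr.2)) (mun jr.1)).
Qed.

(* Cyclic shifts of the two dealt-out halves average to a plan with the right marginals. *)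
Let gam := mixture _ _ _ _ P2 _ (false, ord0) phi mphi.

Let sum_bool (F : bool -> \bar R) : (\sum_j F j = F false + F true)%E.
Proof. by rewrite big_bool addeC. Qed.

Let cardE : #|{: bool * 'I_n.+1}|%:R = 2 * n.+1%:R :> R.
Proof. by rewrite card_prod card_bool card_ord natrM. Qed.

(** The shifts replace a fixed coordinate by all coordinates of both halves; together these are the
    coordinates of the two samples, each distributed as [rho]. *)
Let gam_Pi : Pi n.+1 rho gam.
Proof.
move=> i A mA; rewrite /gam mixtureE cardE.
pose F t : \bar R := (\1_A t)%:E.
have F0 t : (0 <= F t)%E by rewrite lee_fin.
have mF : measurable_fun setT F by apply/measurable_EFinP; exact: measurable_indic.
have P2E (h : X * X -> R) : measurable_fun setT h -> P2 (h @^-1` A) = (\int[P2]_p F (h p))%E.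
  move=> mh; rewrite -[LHS](_ : \int[P2]_p (\1_(h @^-1` A) p)%:E = _)%E //.
  by rewrite integral_indic ?setIT// -[X in measurable X]setTI; exact: mh.
have mU j k : measurable_fun setT (fun p => tnth (un j p) k).
  exact: (measurableT_comp (measurable_tnth k) (mun j)).
have m1 k : measurable_fun setT (fun p : X * X => tnth p.1 k).
  exact: (measurableT_comp (measurable_tnth k) measurable_fst).
have m2 k : measurable_fun setT (fun p : X * X => tnth p.2 k).
  exact: (measurableT_comp (measurable_tnth k) measurable_snd).
have -> : (\sum_jr P2 (phi jr @^-1` (Defs.coord n.+1 i @^-1` A)) =
    \int[P2]_p \sum_(k < n.+1) F (tnth (un false p) k) + \int[P2]_p \sum_(k < n.+1) F (tnth (un true p) k))%E.
  rewrite -(pair_big xpredT xpredT (fun j r => P2 (phi (j, r) @^-1` (Defs.coord n.+1 i @^-1` A)))) /=.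
  rewrite sum_bool; congr (_ + _)%E.
  + rewrite ge0_integral_sum//; last by move=> k; exact: (measurableT_comp mF (mU _ _)).
    rewrite [RHS](reindex_inj (addrI i)) /=; apply: eq_bigr => r _; rewrite -P2E//.
    by congr (P2 _); apply/seteqP; split => p /=; rewrite /Defs.coord /phi tnth_mktuple /=.
  + rewrite ge0_integral_sum//; last by move=> k; exact: (measurableT_comp mF (mU _ _)).
    rewrite [RHS](reindex_inj (addrI i)) /=; apply: eq_bigr => r _; rewrite -P2E//.
    by congr (P2 _); apply/seteqP; split => p /=; rewrite /Defs.coord /phi tnth_mktuple /=.
have msum (h : 'I_n.+1 -> X * X -> R) : (forall k, measurable_fun setT (h k)) ->
    measurable_fun setT (fun p => \sum_(k < n.+1) F (h k p))%E.
  by move=> mh; apply: emeasurable_sum => k; exact: (measurableT_comp mF (mh k)).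
rewrite -ge0_integralD//; first last.
- by apply: msum => k; exact: mU.
- by move=> p _; exact: sume_ge0.
- by apply: msum => k; exact: mU.
- by move=> p _; exact: sume_ge0.
under eq_integral => p _ do rewrite sum_uncross.
rewrite ge0_integralD//; first last.
- exact: msum.
- by move=> p _; exact: sume_ge0.
- exact: msum.
- by move=> p _; exact: sume_ge0.
rewrite !ge0_integral_sum//; first last.
- by move=> k; exact: (measurableT_comp mF (m1 _)).
- by move=> k; exact: (measurableT_comp mF (m2 _)).
have mcoord k : measurable (Defs.coord n.+1 k @^-1` A).
  by rewrite -[X in measurable X]setTI; exact: (measurable_tnth k).
rewrite (eq_bigr (fun=> rho A)); last first.
  move=> k _; rewrite -(P2E _ (m1 k)) -(P_Pi k)//; exact: (square_measure_fst _ _ P _ (mcoord k)).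
rewrite [X in (_ + X)%E](eq_bigr (fun=> rho A)); last first.
  move=> k _; rewrite -(P2E _ (m2 k)) -(P_Pi k)//; exact: (square_measure_snd _ _ P _ (mcoord k)).
have rho_f : rho A = (fine (rho A))%:E by rewrite fineK// rho_fin.
rewrite rho_f !sumEFin sumr_const card_ord -EFinD -EFinM; congr EFin.
have : n.+1%:R != 0 :> R by rewrite pnatr_eq0.
by rewrite -[fine _ *+ _]mulr_natl; move: n.+1%:R => N N0; field.
Qed.

Let cost_gam : (\int[gam]_x c x = ((2 * n.+1%:R)^-1)%:E *
  (\sum_(r < n.+1) \int[P2]_p c (un false p) + \sum_(r < n.+1) \int[P2]_p c (un true p)))%E.
Proof.
rewrite /gam integral_mixture// cardE; congr (_ * _)%E.
rewrite -(pair_big xpredT xpredT (fun j r => (\int[P2]_p c (phi (j, r) p))%E)) /= sum_bool.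
by congr (_ + _)%E; apply: eq_bigr => r _; apply: eq_integral => p _;
  rewrite cost_fun_reindex//; exact: addIr.
Qed.

(** Pointwise the uncrossed pair is no dearer than the two samples, while minimality of [P] against
    [gam] reverses this for the integrals. So the costs agree almost everywhere and the strict part
    of [uncross_cost] applies. *)
Lemma ae_interleaved : {ae P2, forall p, interleaved n.+1 p.1 p.2}.
Proof.
have Pint : P.-integrable setT c.
  apply/integrableP; split => //.
  by under eq_integral => x _ do rewrite gee0_abs//; exact: P_fin.
have good : {ae P, forall x, (forall i, a <= tnth x i < b) /\ (c x < +oo)%E}.
  have g1 : {ae P, forall x, forall i, a <= tnth x i < b}.
    exact: (gam_out a b n.+1 rho P rho_ab rho_na P_Pi).
  have g2 := integrable_ae measurableT Pint.
  by apply: filterS2 g1 g2 => x xab /(_ I); rewrite ge0_fin_numE.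
have good2 := ae_square _ _ P _ good.
pose f (p : X * X) := (c p.1 + c p.2)%E.
pose g (p : X * X) := (c (un false p) + c (un true p))%E.
have mc1 : measurable_fun setT (fun p : X * X => c p.1) by exact: (measurableT_comp mc measurable_fst).
have mc2 : measurable_fun setT (fun p : X * X => c p.2) by exact: (measurableT_comp mc measurable_snd).
have mcu j : measurable_fun setT (fun p => c (un j p)) by exact: (measurableT_comp mc (mun j)).
have mf : measurable_fun setT f by exact: emeasurable_funD.
have mg : measurable_fun setT g by exact: emeasurable_funD.
have f0 p : (0 <= f p)%E by rewrite adde_ge0.
have g0 p : (0 <= g p)%E by rewrite adde_ge0.
have gf : {ae P2, forall p, (g p <= f p)%E}.
  apply: filterS good2 => p [[x_ab x_fin] [y_ab y_fin]].
  by have [] := uncross_cost a b w n.+1 wC w_ge0 w_cross w_fin p.1 p.2 x_ab y_ab (lte_add_pinfty x_fin y_fin).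
have intf : (\int[P2]_p f p = \int[P]_x c x + \int[P]_x c x)%E.
  by rewrite ge0_integralD// integral_square_fst// integral_square_snd.
have intg : (\int[P2]_p g p = \int[P2]_p c (un false p) + \int[P2]_p c (un true p))%E.
  by rewrite ge0_integralD.
have f_fin : (\int[P2]_p f p < +oo)%E by rewrite intf lte_add_pinfty.
have gf' : (\int[P2]_p g p <= \int[P2]_p f p)%E.
  by apply: ae_ge0_le_integral => //; apply: filterS gf.
have g_fin := le_lt_trans gf' f_fin.
have fg : (\int[P2]_p f p <= \int[P2]_p g p)%E.
  have := P_min gam gam_Pi; rewrite cost_gam intf intg.
  have I0 j : (0 <= \int[P2]_p c (un j p))%E by exact: integral_ge0.
  have If : (0 <= \int[P]_x c x)%E by exact: integral_ge0.
  have I0f : (\int[P2]_p c (un false p))%E \is a fin_num.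
    by rewrite ge0_fin_numE//; apply: le_lt_trans g_fin; rewrite intg leeDl.
  have I1f : (\int[P2]_p c (un true p))%E \is a fin_num.
    by rewrite ge0_fin_numE//; apply: le_lt_trans g_fin; rewrite intg leeDr.
  have Iff : (\int[P]_x c x)%E \is a fin_num by rewrite ge0_fin_numE.
  have /fineK <- := I0f; have /fineK <- := I1f; have /fineK <- := Iff.
  move: (fine (\int[P2]_p c (un false p))%E) (fine (\int[P2]_p c (un true p))%E)
    (fine (\int[P]_x c x)%E) => i1 i0 i2.
  rewrite !sumEFin !sumr_const card_ord -!EFinD -EFinM !lee_fin.
  rewrite (_ : (2 * n.+1%:R)^-1 * (i1 *+ n.+1 + i0 *+ n.+1) = (i1 + i0) / 2); first lra.
  have : n.+1%:R != 0 :> R by rewrite pnatr_eq0.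
  by rewrite -mulrnDl -[(_ + _) *+ _]mulr_natl; move: n.+1%:R => N N0; field.
have fg_ae := ae_ge_of_integral_le _ _ _ f g mf mg f0 g0 gf f_fin fg.
apply: filterS2 good2 fg_ae => p [[x_ab x_fin] [y_ab y_fin]] fgp.
by have [_] := uncross_cost a b w n.+1 wC w_ge0 w_cross w_fin p.1 p.2 x_ab y_ab (lte_add_pinfty x_fin y_fin); apply.
Qed.

End Interleaving.

(** * Law of the ordered sample *)

(** The product condition makes everything after a value below 1 vanish, so each sequence reads
    [1, ..., 1, c, 0, ..., 0] and is determined by its sum. One inequality suffices, the roles being
    symmetric. *)
Lemma step_sequence_unique {R : realType} (n : nat) (v v' : nat -> R) :
  (forall k, 0 <= v k <= 1) -> (forall k, 0 <= v' k <= 1) ->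
  (forall k, v k.+1 <= v k) -> (forall k, v' k.+1 <= v' k) ->
  (forall k, (1 - v k) * v k.+1 = 0) -> (forall k, (1 - v' k) * v' k.+1 = 0) ->
  \sum_(k < n) v k = \sum_(k < n) v' k ->
  forall k, (k < n)%N -> v' k <= v k.
Proof.
move=> v01 v'01 vd v'd vs v's sumE k kn; rewrite leNgt; apply/negP => lt_k.
have mono (u : nat -> R) : (forall j, u j.+1 <= u j) -> forall i j, (i <= j)%N -> u j <= u i.
  move=> ud i j /subnK <-; elim: (j - i)%N => [|k' IH]; first by rewrite add0n.
  by rewrite addSn; exact: le_trans (ud _) IH.
(* If [v k < v' k], then [v'] is 1 before [k] and [v] is 0 after [k]; the sequences are thus ordered
   everywhere, and equal sums make them equal. *)
have le_all j : v j <= v' j.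
  have [jk|kj|->] := ltngtP j k; last exact: ltW.
  - have : v' j = 1.
      have /eqP := v's j; rewrite mulf_eq0 => /orP[|/eqP v'0j]; first by rewrite subr_eq0 => /eqP.
      by have := mono _ v'd _ _ jk; rewrite v'0j; have /andP[] := v01 k; lra.
    by move=> ->; have /andP[] := v01 j.
  - have : v k.+1 = 0.
      have /eqP := vs k; rewrite mulf_eq0 => /orP[|/eqP//]; rewrite subr_eq0 => /eqP vk.
      by have /andP[] := v'01 k; lra.
    by have := mono _ vd _ _ kj; have /andP[] := v'01 j; lra.
have sum0 : \sum_(j < n) (v' j - v j) = 0 by rewrite sumrB sumE subrr.
have /(_ (Ordinal kn) isT) : forall i : 'I_n, xpredT i -> v' i - v i = 0.
  by apply: psumr_eq0P sum0 => j _; rewrite subr_ge0.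
move=> /= /eqP; rewrite subr_eq0 => /eqP; lra.
Qed.

Lemma square_null {R : realType} d (X : measurableType d) (P : probability X R)
    (Q : X * X -> Prop) (A B : set X) :
  {ae square_measure _ _ P, forall p, Q p} -> measurable A -> measurable B ->
  (forall x y, A x -> B y -> ~ Q (x, y)) -> (P A * P B = 0)%E.
Proof.
move=> [N [mN N0 QN]] mA mB nQ; apply/eqP; rewrite eq_le mule_ge0// andbT.
rewrite -square_measureX// -N0; apply: measure_le => //; first exact: measurableX.
by move=> [x y] [/= Ax By]; apply: QN => /=; exact: nQ.
Qed.

(** The product encodes nestedness: one of the two differences is null. An event of least mass is
    then contained in every other one up to a null set. *)
Lemma nested_bigcap {R : realType} d (X : measurableType d) (P : probability X R)
    n (V : 'I_n -> set X) (i0 : 'I_n) :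
  (forall i, measurable (V i)) ->
  (forall i j, (P (V i `\` V j) * P (V j `\` V i) = 0)%E) ->
  (forall i, (P (V i0) <= P (V i))%E) -> P [set x | forall i, V i x] = P (V i0).
Proof.
move=> mV nest le0.
have null i : P (V i0 `\` V i) = 0%E.
  have /eqP := nest i0 i; rewrite mule_eq0 => /orP[/eqP//|/eqP null].
  have mI : measurable (V i `&` V i0) by exact: measurableI.
  have PVi : P (V i) = P (V i `&` V i0).
    rewrite -[in LHS](setUIDK (V i) (V i0)) measureU0//; exact: measurableD.
  have PV0 : P (V i0) = (P (V i0 `&` V i) + P (V i0 `\` V i))%E.
    rewrite -[in LHS](setUIDK (V i0) (V i)) measureU//; [exact: measurableI|exact: measurableD|].
    by rewrite setDE setIACA setICr setI0.
  have := le0 i; rewrite PVi PV0 setIC -[leRHS]adde0 leeD2lE; last exact: fin_num_measure.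
  by move=> le; apply/eqP; rewrite eq_le le measure_ge0.
have mcap : measurable [set x | forall i, V i x].
  rewrite (_ : [set x | _] = \bigcap_(i in [set: 'I_n]) V i); first exact: fin_bigcap_measurable.
  by apply/seteqP; split => x H i //; exact: H.
apply/eqP; rewrite eq_le; apply/andP; split; first by apply: measure_le => // x; apply.
pose D := \big[setU/set0]_(i < n) (V i0 `\` V i).
have [mD D0] : measurable D /\ P D = 0%E.
  apply: (big_ind (fun A => measurable A /\ P A = 0%E)) => [|A B [mA A0] [mB B0]|i _].
  - by rewrite measure0.
  - by rewrite measureU0//; split => //; exact: measurableU.
  - by split => //; exact: measurableD.
rewrite -(measureU0 mcap mD D0); apply: measure_le => //; first exact: measurableU.
move=> x V0x; have [Vx|/existsNP[i nV]] := pselect (forall i, V i x); [by left|right].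
by rewrite /D (bigD1 i)//=; left.
Qed.

(** The event that the entry of rank [k], counted from 0, is at most [s]. *)
Definition ranked {R : realType} n (s : R) (k : nat) : set (n.-tuple R) :=
  [set x | (k < cnt x s)%N].

(** Both sides are the expected number of coordinates at most [s]. *)
Lemma sum_ranked {R : realType} n (rho : probability R R) (P : probability (n.-tuple R) R) s :
  Pi n rho P -> (\sum_(k < n) P (ranked n s k) = n%:R%:E * rho `]-oo, s]%classic)%E.
Proof.
move=> P_Pi.
have mcoord (i : 'I_n) : measurable (Defs.coord n i @^-1` `]-oo, s]%classic).
  by rewrite -[X in measurable X]setTI; exact: (measurable_tnth i).
transitivity (\int[P]_x \sum_(k < n) (\1_(ranked n s k) x)%:E)%E.
  rewrite ge0_integral_sum//.
  - by apply: eq_bigr => k _; rewrite integral_indic ?setIT//; exact: measurable_cnt_gt.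
  - by move=> k; apply/measurable_EFinP; apply: measurable_indic; exact: measurable_cnt_gt.
transitivity (\int[P]_x \sum_(i < n) (\1_(Defs.coord n i @^-1` `]-oo, s]%classic) x)%:E)%E.
  apply: eq_integral => x _; rewrite !sumEFin; congr EFin.
  transitivity ((cnt x s)%:R : R).
    rewrite (eq_bigr (fun k : 'I_n => (k < cnt x s)%N%:R)); last first.
      by move=> k _; rewrite indicE; case: (boolP (k < cnt x s)%N) => H;
        [rewrite mem_set|rewrite memNset//; apply/negP].
    rewrite -natr_sum; congr (_%:R); rewrite -(big_mkord xpredT (fun k => (k < cnt x s)%N : nat)).
    have cn := cnt_le_size n x s.
    rewrite (big_cat_nat (n := cnt x s))//= [X in (_ + X)%N]big_nat [X in (_ + X)%N]big1 ?addn0.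
      rewrite big_nat (eq_bigr (fun=> 1%N)); last by move=> i /andP[_ ->].
      by rewrite -big_nat sum_nat_const_nat subn0 muln1.
    by move=> i /andP[ci _]; rewrite ltnNge ci.
  rewrite cntE natr_sum; apply: eq_bigr => i _; rewrite indicE.
  by case: (boolP (tnth x i <= s)) => H;
    [rewrite mem_set//= in_itv|rewrite memNset//= in_itv/=; apply/negP].
rewrite ge0_integral_sum//; last first.
  by move=> k; apply/measurable_EFinP; apply: measurable_indic.
rewrite (eq_bigr (fun=> rho `]-oo, s]%classic)); last first.
  by move=> i _; rewrite integral_indic ?setIT//; exact: P_Pi.
have rho_f : rho `]-oo, s]%classic = (fine (rho `]-oo, s]%classic))%:E.
  by rewrite fineK// fin_num_measure.
by rewrite rho_f sumEFin sumr_const card_ord -EFinM mulr_natl.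
Qed.

Section RankLaws.
Context {R : realType} (n : nat) (P : probability (n.-tuple R) R).
Hypothesis P_int : {ae square_measure _ _ P, forall p, interleaved n p.1 p.2}.

(** Samples from the two differences would have counts ordered oppositely at [s] and at [t], which
    interleaving forbids. *)
Lemma ranked_nested s t k l :
  (P (ranked n s k `\` ranked n t l) * P (ranked n t l `\` ranked n s k) = 0)%E.
Proof.
apply: square_null P_int _ _ _; try by apply: measurableD; exact: measurable_cnt_gt.
rewrite /ranked => x y [/= xs /negP xt] [/= yt /negP ys] /(_ s t)[_ _]; apply.
by rewrite /=; split; lia.
Qed.

(** Samples from the two events would have counts at [s] differing by at least two. *)
Lemma ranked_gap s k : (P (~` ranked n s k) * P (ranked n s k.+1) = 0)%E.
Proof.
apply: square_null P_int _ _ _; [|exact: measurable_cnt_gt|].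
  by apply: measurableC; exact: measurable_cnt_gt.
rewrite /ranked => x y /= /negP xs ys /(_ s s)[_ + _] /=; lia.
Qed.

End RankLaws.

Lemma ranked_law {R : realType} n (rho : probability R R) (P P' : probability (n.-tuple R) R) :
  Pi n rho P -> Pi n rho P' ->
  {ae square_measure _ _ P, forall p, interleaved n p.1 p.2} ->
  {ae square_measure _ _ P', forall p, interleaved n p.1 p.2} ->
  forall s k, (k < n)%N -> (P' (ranked n s k) <= P (ranked n s k))%E.
Proof.
move=> P_Pi P'_Pi iP iP' s k kn.
have mV j : measurable (ranked n s j) by exact: measurable_cnt_gt.
have fV (Q : probability (n.-tuple R) R) j : Q (ranked n s j) = (fine (Q (ranked n s j)))%:E.
  by rewrite fineK// fin_num_measure.
rewrite [leRHS]fV [leLHS]fV lee_fin.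
have b01 (Q : probability (n.-tuple R) R) j : 0 <= fine (Q (ranked n s j)) <= 1.
  by rewrite -!lee_fin -fV measure_ge0 probability_le1.
have dec (Q : probability (n.-tuple R) R) j : fine (Q (ranked n s j.+1)) <= fine (Q (ranked n s j)).
  by rewrite -lee_fin -!fV; apply: measure_le => // x /=; exact: ltnW.
have gap (Q : probability (n.-tuple R) R) j : {ae square_measure _ _ Q, forall p, interleaved n p.1 p.2} ->
    (1 - fine (Q (ranked n s j))) * fine (Q (ranked n s j.+1)) = 0.
  move=> iQ; apply: EFin_inj; rewrite EFinM EFinB -!fV.
  by have := ranked_gap n Q iQ s j; rewrite probability_setC.
apply: (step_sequence_unique n (fun j => fine (P (ranked n s j))) (fun j => fine (P' (ranked n s j)))) => //=.
- by move=> j; exact: gap.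
- by move=> j; exact: gap.
- apply: EFin_inj; rewrite -!sumEFin.
  under eq_bigr do rewrite -fV; under [RHS]eq_bigr do rewrite -fV.
  by rewrite (sum_ranked _ _ _ _ P_Pi) (sum_ranked _ _ _ _ P'_Pi).
Qed.

Section LowerBoxes.
Context {R : realType} (n : nat).

Definition lower_box (s : 'I_n -> R) : set (n.-tuple R) := [set x | forall i, tnth x i <= s i].

(** A half-space [x_i <= s] is the increasing union of lower boxes whose other bounds are the
    integers [k]. *)
Lemma lower_box_generates :
  (measurable : set (set (n.-tuple R))) = <<s range lower_box >>.
Proof.
apply/seteqP; split; last first.
  apply: smallest_sub; first exact: sigma_algebra_measurable.
  move=> _ [s _ <-].
  rewrite (_ : lower_box s = \bigcap_(i in [set: 'I_n]) ((fun x : n.-tuple R => tnth x i) @^-1` `]-oo, s i]%classic)).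
    apply: fin_bigcap_measurable => // i _.
    by rewrite -[X in measurable X]setTI; exact: (measurable_tnth i).
  by apply/seteqP; split => x H i; have := H i; rewrite /= in_itv/= // => /(_ I).
have mt (i : 'I_n) : measurable_fun setT
    ((fun x => tnth x i) : g_sigma_algebraType (range lower_box) -> R).
  apply: measurable_fun_le_sets => s.
  rewrite [X in measurable X](_ : _ =
      \bigcup_k (lower_box (fun j => if j == i then s else k%:R) : set (g_sigma_algebraType _))).
    by apply: bigcup_measurable => k _; apply: sub_sigma_algebra; exists (fun j => if j == i then s else k%:R).
  apply/seteqP; split => x /=; last by move=> [k _ /(_ i)]; rewrite eqxx.
  move=> xs; pose M := \sum_j `|tnth x j|; exists (Num.truncn M).+1 => // j.
  case: eqP => [->//|_]; apply: le_trans (ltW (truncnS_gt _)).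
  by rewrite /M (bigD1 j)//=; apply: le_trans (ler_norm _) _; rewrite lerDl sumr_ge0.
apply: smallest_sub; first exact: smallest_sigma_algebra.
move=> A; rewrite -bigcup_seq => -[i _ [B mB <-]]; rewrite setTI.
have := mt i measurableT B mB; rewrite setTI; exact.
Qed.

Lemma lower_box_unique (m1 m2 : {measure set (n.-tuple R) -> \bar R}) :
  (m1 setT < +oo)%E -> (forall s, m1 (lower_box s) = m2 (lower_box s)) ->
  forall A, measurable A -> m1 A = m2 A.
Proof.
move=> fin eqm; apply: (measure_unique (range lower_box) (fun k => lower_box (fun=> k%:R))).
- exact: lower_box_generates.
- move=> _ _ [s _ <-] [t _ <-]; exists (fun i => Num.min (s i) (t i)) => //.
  apply/seteqP; split => x /=.
    by move=> H; split => i; have := H i; rewrite le_min => /andP[].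
  by move=> [Hs Ht] i; rewrite le_min Hs Ht.
- by move=> k; exists (fun=> k%:R).
- apply/seteqP; split => // x _; pose M := \sum_j `|tnth x j|; exists (Num.truncn M).+1 => // j.
  apply: le_trans (ltW (truncnS_gt _)).
  by rewrite /M (bigD1 j)//=; apply: le_trans (ler_norm _) _; rewrite lerDl sumr_ge0.
- by move=> _ [s _ <-].
- move=> k; apply: le_lt_trans fin; apply: measure_le => //.
  by rewrite lower_box_generates; apply: sub_sigma_algebra; exists (fun=> k%:R).
Qed.

End LowerBoxes.

Definition sorted_tuple {R : realType} n (x : n.-tuple R) : n.-tuple R :=
  [tuple (sort <=%R x)`_i | i < n].

Lemma tnth_sorted_tuple_le {R : realType} n (x : n.-tuple R) i s :
  (tnth (sorted_tuple n x) i <= s) = (i < cnt x s)%N.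
Proof. by rewrite tnth_mktuple nth_sort_le// size_tuple. Qed.

Lemma measurable_sorted_tuple {R : realType} n : measurable_fun setT (@sorted_tuple R n).
Proof.
apply/measurable_fun_tnthP => i; apply: measurable_fun_le_sets => s /=.
rewrite [X in measurable X](_ : _ = ranked n s i); first exact: measurable_cnt_gt.
by apply/seteqP; split => x; rewrite /= tnth_sorted_tuple_le.
Qed.

(** The mass that the sorted sample gives to a lower box is the least mass among finitely many
    nested events [ranked], and these masses are the same under [P] and [P']. *)
Lemma sorted_tuple_law {R : realType} n (rho : probability R R) (P P' : probability (n.+1.-tuple R) R) :
  Pi n.+1 rho P -> Pi n.+1 rho P' ->
  {ae square_measure _ _ P, forall p, interleaved n.+1 p.1 p.2} ->
  {ae square_measure _ _ P', forall p, interleaved n.+1 p.1 p.2} ->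
  forall A, measurable A ->
  P (sorted_tuple n.+1 @^-1` A) = P' (sorted_tuple n.+1 @^-1` A).
Proof.
move=> P_Pi P'_Pi iP iP' A mA.
have m0 := @measurable_sorted_tuple R n.+1.
apply: (lower_box_unique n.+1 (image_measure _ _ _ _ P _ m0) (image_measure _ _ _ _ P' _ m0)) => //.
  by rewrite /= /pushforward preimage_setT probability_setT ltry.
move=> s; rewrite /= /pushforward.
pose V (i : 'I_n.+1) := ranked n.+1 (s i) i.
have mV i : measurable (V i) by exact: measurable_cnt_gt.
have -> : sorted_tuple n.+1 @^-1` lower_box n.+1 s = [set x | forall i, V i x].
  by apply/seteqP; split => x H i; have := H i; rewrite /V /ranked /= tnth_sorted_tuple_le.
have PP' i : P (V i) = P' (V i).
  by apply/eqP; rewrite eq_le; apply/andP; split; apply: (ranked_law n.+1 rho).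
pose i0 := [arg min_(i < ord0) P (V i)]%O.
have le0 i : (P (V i0) <= P (V i))%E by rewrite /i0; case: arg_minP => // j _; apply.
rewrite (nested_bigcap _ _ P _ V i0)//; last by move=> i j; exact: ranked_nested.
rewrite (nested_bigcap _ _ P' _ V i0)//; first by move=> i j; exact: ranked_nested.
by move=> i; rewrite -!PP'.
Qed.

(** * Symmetric measures and their sorted samples *)

Lemma measurable_perm_tuple {R : realType} n (s : {perm 'I_n}) :
  measurable_fun setT (@perm_tuple R n s).
Proof.
apply/measurable_fun_tnthP => i.
apply: (eq_measurable_fun (fun x : n.-tuple R => tnth x (s i))).
  by move=> x _; rewrite /= tnth_mktuple.
exact: measurable_tnth.
Qed.

Lemma perm_tupleM {R : realType} n (s t : {perm 'I_n}) (x : n.-tuple R) :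
  perm_tuple n s (perm_tuple n t x) = perm_tuple n (s * t)%g x.
Proof. by apply: eq_from_tnth => i; rewrite !tnth_mktuple permM. Qed.

Lemma sorted_tuple_perm {R : realType} n (x : n.-tuple R) :
  exists s : {perm 'I_n}, sorted_tuple n x = perm_tuple n s x.
Proof.
have : perm_eq (sorted_tuple n x) x.
  rewrite (_ : tval (sorted_tuple n x) = sort <=%R x); first by rewrite perm_sort.
  apply: (@eq_from_nth _ 0); first by rewrite size_tuple size_sort size_tuple.
  move=> i; rewrite size_tuple => ni.
  by rewrite -[i]/(nat_of_ord (Ordinal ni)) -tnth_nth tnth_mktuple.
by move=> /perm.tuple_permP[s sE]; exists s; apply: val_inj.
Qed.

(** Sorting is a permutation depending on the point; it drops out once indicators are summed over
    all permutations. Repeating [P A] on the left avoids a division. *)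
Lemma symmetric_measure_sorted {R : realType} n (P : probability (n.-tuple R) R) A :
  symmetric_measure n P -> measurable A ->
  (\sum_(s : {perm 'I_n}) P A = \sum_(s : {perm 'I_n}) P (sorted_tuple n @^-1` (perm_tuple n s @^-1` A)))%E.
Proof.
move=> symP mA.
have mp s : measurable (perm_tuple n s @^-1` A).
  by rewrite -[X in measurable X]setTI; exact: measurable_perm_tuple.
have mo s : measurable (sorted_tuple n @^-1` (perm_tuple n s @^-1` A)).
  by rewrite -[X in measurable X]setTI; exact: measurable_sorted_tuple.
transitivity (\int[P]_x \sum_(s : {perm 'I_n}) (\1_(perm_tuple n s @^-1` A) x)%:E)%E.
  rewrite ge0_integral_sum//; last by move=> s; apply/measurable_EFinP; exact: measurable_indic.
  by apply: eq_bigr => s _; rewrite integral_indic ?setIT// symP.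
transitivity (\int[P]_x \sum_(s : {perm 'I_n}) (\1_(sorted_tuple n @^-1` (perm_tuple n s @^-1` A)) x)%:E)%E; last first.
  rewrite ge0_integral_sum//; last by move=> s; apply/measurable_EFinP; exact: measurable_indic.
  by apply: eq_bigr => s _; rewrite integral_indic ?setIT.
apply: eq_integral => x _; have [t tE] := sorted_tuple_perm n x.
rewrite (reindex_inj (mulIg t)) /=; apply: eq_bigr => s _.
rewrite !indicE; congr (_%:R%:E); congr nat_of_bool; apply/idP/idP; rewrite !inE /=;
  by rewrite tE perm_tupleM.
Qed.

Lemma symmetric_unique {R : realType} n (rho : probability R R) (P P' : probability (n.+1.-tuple R) R) :
  symmetric_measure n.+1 P -> symmetric_measure n.+1 P' -> Pi n.+1 rho P -> Pi n.+1 rho P' ->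
  {ae square_measure _ _ P, forall p, interleaved n.+1 p.1 p.2} ->
  {ae square_measure _ _ P', forall p, interleaved n.+1 p.1 p.2} ->
  forall A, measurable A -> P A = P' A.
Proof.
move=> symP symP' P_Pi P'_Pi iP iP' A mA.
have : (\sum_(s : {perm 'I_n.+1}) P A = \sum_(s : {perm 'I_n.+1}) P' A)%E.
  rewrite !symmetric_measure_sorted//; apply: eq_bigr => s _.
  apply: (sorted_tuple_law n rho) => //.
  by rewrite -[X in measurable X]setTI; exact: measurable_perm_tuple.
have f (Q : probability (n.+1.-tuple R) R) : Q A = (fine (Q A))%:E.
  by rewrite fineK// fin_num_measure.
rewrite (f P) (f P') !sumEFin !sumr_const => -[] /eqP.
by rewrite eqrMn2r => /orP[/eqP/card0_eq/(_ 1%g)|/eqP ->].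
Qed.

(** * Reduction to a nonnegative cost on the plane *)

(** The integral of [f] may be infinite, so additivity is applied to positive and negative parts;
    the negative part of [f - C] is at most [C], and its finite integral can be cancelled. *)
Lemma integral_shift {R : realType} d (X : measurableType d) (mu : {measure set X -> \bar R})
    (D : set X) (f : X -> \bar R) (C : R) :
  measurable D -> mu D = 1%E -> 0 <= C -> measurable_fun D f ->
  (forall x, D x -> (0 <= f x)%E) ->
  (\int[mu]_(x in D) (f x - C%:E) + C%:E = \int[mu]_(x in D) f x)%E.
Proof.
move=> mD D1 C0 mf f0; set h := (fun x => f x - C%:E)%E.
have mh : measurable_fun D h by exact: emeasurable_funB.
have mhp : measurable_fun D h^\+%E by exact: measurable_funepos.
have mhn : measurable_fun D h^\-%E by exact: measurable_funeneg.
have key : (\int[mu]_(x in D) h^\+ x + C%:E = \int[mu]_(x in D) f x + \int[mu]_(x in D) h^\- x)%E.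
  rewrite -[X in (_ + X)%E](_ : \int[mu]_(x in D) C%:E = _)%E; last first.
    by rewrite integral_cst// D1 mule1.
  rewrite -!ge0_integralD//.
  apply: eq_integral => x /set_mem Dx; rewrite funeposE funenegE /h.
  move: (f0 x Dx); case: (f x) => [r| |] // r0.
    rewrite -EFinB -!EFin_max -!EFinD; congr EFin.
    have [h0|/ltW h0] := leP 0 (r - C).
      by rewrite (_ : Num.max (- (r - C)) 0 = 0) ?max_r ?oppr_le0//; lra.
    by rewrite (_ : Num.max (- (r - C)) 0 = - (r - C)) ?max_l ?oppr_ge0//; lra.
  by rewrite addye//= maxNye adde0.
have neg_le : (\int[mu]_(x in D) h^\- x <= C%:E)%E.
  rewrite -[leRHS]mule1 -D1 -integral_cst//; apply: ge0_le_integral => //=.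
  move=> x Dx; rewrite funenegE /h ge_max lee_fin C0 andbT.
  move: (f0 x Dx); case: (f x) => [r| |] // r0; last by rewrite leNye.
  by rewrite -EFinB -EFinN !lee_fin; move: r0; rewrite lee_fin; lra.
have neg_fin : (\int[mu]_(x in D) h^\- x)%E \is a fin_num.
  rewrite ge0_fin_numE; first exact: le_lt_trans neg_le (ltry _).
  exact: integral_ge0.
by rewrite integralE addeAC key addeK.
Qed.

Definition extend {R : realType} (a b : R) (w : R -> R -> \bar R) (M x y : R) : \bar R :=
  (w (clampR a b x) (clampR a b y) + M%:E)%E.

Lemma clampR_continuous {R : realType} (a b : R) : continuous (clampR a b).
Proof.
move=> x; apply: continuous_max; first exact: cst_continuous.
by apply: continuous_min; [exact: cst_continuous|move=> ?].
Qed.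

Section Extension.
Context {R : realType} (a b : R) (w : R -> R -> \bar R).
Hypothesis ab : a < b.
Hypothesis w_cont : {within `[a, b]%classic `*` `[a, b]%classic,
  continuous (fun p : R * R => w p.1 p.2)}.
Hypothesis wC : forall x y, x \in `[a, b] -> y \in `[a, b] -> w x y = w y x.
Hypothesis w_noo : forall x y, x \in `[a, b] -> y \in `[a, b] -> w x y != -oo%E.

Let cl_in x : clampR a b x \in `[a, b].
Proof. by rewrite in_itv/= clampR_ge clampR_le// ltW. Qed.

Let clampw_continuous : continuous (fun p : R * R => w (clampR a b p.1) (clampR a b p.2)).
Proof.
move=> p U nU.
have /subspace_continuousP/(_ (clampR a b p.1, clampR a b p.2)) := w_cont.
have pA : (`[a, b]%classic `*` `[a, b]%classic) (clampR a b p.1, clampR a b p.2) by split; exact: cl_in.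
move=> /(_ pA U nU) nb.
have cv : (clampR a b q.1, clampR a b q.2) @[q --> p] --> (clampR a b p.1, clampR a b p.2).
  have c1 : q.1 @[q --> p] --> p.1 by case: (p) => ? ?; exact: cvg_fst.
  have c2 : q.2 @[q --> p] --> p.2 by case: (p) => ? ?; exact: cvg_snd.
  apply: cvg_real_pair.
    exact: (cvg_comp _ _ c1 (clampR_continuous a b p.1)).
  exact: (cvg_comp _ _ c2 (clampR_continuous a b p.2)).
have := cv _ nb; rewrite /nbhs /=; apply: filterS => q /=; apply.
by split; exact: cl_in.
Qed.

(** Near each point the cost exceeds some [- k], as it is nowhere [-oo]; compactness makes one [k]
    work everywhere. *)
Lemma bounded_below : exists2 M : R, 0 <= M &
  forall x y, x \in `[a, b] -> y \in `[a, b] -> (- M%:E <= w x y)%E.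
Proof.
have cpt : compact (`[a, b]%classic `*` `[a, b]%classic : set (R * R)).
  by apply: compact_setX; exact: segment_compact.
have /compact_near_coveringP/(_ nat \oo
  (fun k (p : R * R) => (- (k%:R : R)%:E < w (clampR a b p.1) (clampR a b p.2))%E)) := cpt.
have near1 (p : R * R) : (`[a, b]%classic `*` `[a, b]%classic) p ->
    \forall q \near p & k \near \oo, (- (k%:R : R)%:E < w (clampR a b q.1) (clampR a b q.2))%E.
  move=> [p1 p2].
  have [r rw] : exists r : nat, (- (r%:R : R)%:E < w (clampR a b p.1) (clampR a b p.2))%E.
    have := w_noo _ _ (cl_in p.1) (cl_in p.2).
    case: (w _ _) => [u| |] // _; last by exists 0%N; rewrite ltry.
    exists (Num.truncn `|u|).+1; rewrite -EFinN lte_fin ltrNl.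
    by apply: le_lt_trans (truncnS_gt _); rewrite -normrN ler_norm.
  have nb : nbhs (w (clampR a b p.1) (clampR a b p.2)) [set u | (- (r%:R : R)%:E < u)%E].
    apply: open_nbhs_nbhs; split; last exact: rw.
    exact: open_ereal_gt_ereal.
  have nq := clampw_continuous p _ nb.
  exists ([set q : R * R | (- (r%:R : R)%:E < w (clampR a b q.1) (clampR a b q.2))%E], [set k | (r <= k)%N]).
    by split; [exact: nq|exists r].
  move=> [q k] [/= qr rk]; apply: le_lt_trans qr.
  by rewrite -?EFinN lee_fin lerN2 ler_nat.
move=> /(_ _ near1) [k _ /(_ k (leqnn k)) H].
exists k%:R => // x y xab yab; apply: ltW.
have := H (x, y) (conj xab yab); rewrite /= !clampR_id//.
all: by move: xab yab; rewrite !in_itv/= => /andP[? ?] /andP[].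
Qed.

Variable M : R.
Hypothesis M0 : 0 <= M.
Hypothesis wM : forall x y, x \in `[a, b] -> y \in `[a, b] -> (- M%:E <= w x y)%E.
Local Notation we := (extend a b w M).

Lemma extend_continuous : continuous (fun p : R * R => we p.1 p.2).
Proof.
move=> p; apply: cvgeD; first exact: fin_num_adde_defl.
  exact: clampw_continuous.
exact: cvg_cst.
Qed.

Lemma extendC x y : we x y = we y x.
Proof. by rewrite /extend wC. Qed.

Lemma extend_ge0 x y : (0 <= we x y)%E.
Proof. by rewrite /extend -leeBlDr// sub0e wM. Qed.

Lemma extend_in x y : x \in `[a, b] -> y \in `[a, b] -> we x y = (w x y + M%:E)%E.
Proof.
by rewrite !in_itv/= => /andP[ax xb] /andP[ay yb]; rewrite /extend !clampR_id.
Qed.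

Lemma extend_le_sum x y x' y' u v u' v' :
  (we x y + we x' y' <= we u v + we u' v')%E =
  (w (clampR a b x) (clampR a b y) + w (clampR a b x') (clampR a b y') <=
   w (clampR a b u) (clampR a b v) + w (clampR a b u') (clampR a b v'))%E.
Proof. by rewrite /extend addeACA [leRHS]addeACA leeD2rE. Qed.

Let npairs n : nat := #|[pred p : 'I_n * 'I_n | p.1 != p.2]|.

Lemma measurable_Ibox n : measurable (Ibox a b n : set (n.-tuple R)).
Proof.
rewrite (_ : Ibox a b n = \bigcap_(i in [set: 'I_n]) ((fun x : n.-tuple R => tnth x i) @^-1` `[a, b]%classic)).
  apply: fin_bigcap_measurable => // i _.
  by rewrite -[X in measurable X]setTI; exact: (measurable_tnth i).
by apply/seteqP; split => x H i; [move=> _; exact: H|exact: (H i I)].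
Qed.

Section FixedMarginal.
Context (n : nat) (rho : probability R R).
Hypothesis n_gt0 : (0 < n)%N.
Hypothesis rho_ab : prob_on a b rho.

Lemma Pi_Ibox (g : {measure set (n.-tuple R) -> \bar R}) : Pi n rho g -> g (~` Ibox a b n) = 0%E.
Proof.
move=> g_Pi; rewrite (_ : ~` _ = \big[setU/set0]_(i < n) (Defs.coord n i @^-1` (~` `[a, b]%classic))).
  have mi i : measurable (Defs.coord n i @^-1` (~` `[a, b]%classic)).
    by rewrite -[X in measurable X]setTI; apply: (measurable_tnth i) => //; exact: measurableC.
  have [//] : measurable (\big[setU/set0]_(i < n) (Defs.coord n i @^-1` (~` `[a, b]%classic))) /\
      g (\big[setU/set0]_(i < n) (Defs.coord n i @^-1` (~` `[a, b]%classic))) = 0%E.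
  apply: (big_ind (fun A => measurable A /\ g A = 0%E)) => [|A B [mA A0] [mB B0]|i _].
  - by rewrite measure0.
  - by rewrite measureU0//; split => //; exact: measurableU.
  - split => //; rewrite g_Pi; last exact: measurableC.
    by rewrite probability_setC// rho_ab subee.
apply/seteqP; split => x.
  by move=> /existsNP[i xi]; rewrite (bigD1 i)//=; left.
rewrite -bigcup_seq => -[i _ xi] H; apply: xi; exact: H.
Qed.

(** The plan has mass one, all inside the box, so the shift adds [M] per ordered pair of indices.
    This constant is the same for all plans, so minimizers are unaffected. *)
Lemma cost_extend (g : {measure set (n.-tuple R) -> \bar R}) : Pi n rho g ->
  (\int[g]_x cost_fun we n x = cost a b w n g + (M *+ npairs n)%:E)%E.
Proof.
move=> g_Pi; have mI := measurable_Ibox n.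
have mc : measurable_fun setT (cost_fun we n).
  by apply: measurable_cost_fun; apply: continuous2_measurable; exact: extend_continuous.
have c0 (x : n.-tuple R) : (0 <= cost_fun we n x)%E by apply: cost_fun_ge0; exact: extend_ge0.
have g0 := Pi_Ibox g g_Pi.
have g1 : g (Ibox a b n) = 1%E.
  have := measureU0 mI (measurableC mI) g0.
  by rewrite setUv (Pi_setT n rho g n_gt0 g_Pi).
rewrite (ge0_negligible_integral (N := ~` Ibox a b n))//; last exact: measurableC.
rewrite setTD setCK.
rewrite -(integral_shift _ _ g (Ibox a b n) _ (M *+ npairs n))//.
- congr (_ + _)%E; rewrite /cost; apply: eq_integral => x /set_mem xI.
  rewrite /cost_fun (eq_bigr (fun p => w (tnth x p.1) (tnth x p.2) + M%:E)%E); last first.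
    by move=> p _; rewrite extend_in//; exact: xI.
  have -> : (M *+ npairs n)%:E = (\sum_(p : 'I_n * 'I_n | p.1 != p.2) M%:E)%E.
    by rewrite sumEFin sumr_const.
  by rewrite big_split /=; apply: addeK; rewrite sumEFin.
- by rewrite mulrn_wge0.
- exact: measurable_funTS.
Qed.

Lemma is_minimizer_extend (g : {measure set (n.-tuple R) -> \bar R}) : Pi n rho g ->
  is_minimizer a b w n rho g <->
  (forall gam : {measure set (n.-tuple R) -> \bar R}, Pi n rho gam ->
    (\int[g]_x cost_fun we n x <= \int[gam]_x cost_fun we n x)%E).
Proof.
move=> g_Pi; split.
  move=> [_ gE] gam gam_Pi; rewrite !cost_extend// leeD2rE// gE.
  by apply: ereal_inf_lbound; exists gam.
move=> H; split => //; apply/eqP; rewrite eq_le; apply/andP; split.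
  apply: le_ereal_inf_tmp => _ [gam gam_Pi <-].
  by have := H gam gam_Pi; rewrite !cost_extend// leeD2rE.
by apply: ereal_inf_lbound; exists g.
Qed.

Lemma finite_cost_extend : (F_OT a b w n rho < +oo)%E ->
  exists2 g : {measure set (n.-tuple R) -> \bar R}, Pi n rho g &
    (\int[g]_x cost_fun we n x < +oo)%E.
Proof.
move=> /ereal_inf_lt[_ [g g_Pi <-] gfin]; exists g => //.
by rewrite cost_extend// lte_add_pinfty// ltry.
Qed.

End FixedMarginal.
End Extension.

(** * Crossing inequalities and the two well-ordering conditions *)

Lemma inord4_neq (j k : nat) : (j < 4)%N -> (k < 4)%N -> j != k -> inord j != inord k :> 'I_4.
Proof. by move=> j4 k4 jk; rewrite -val_eqE /= !inordK. Qed.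

Lemma pts4_inord {R : realType} (x1 x2 x3 x4 : R) (k : nat) : (k < 4)%N ->
  pts4 x1 x2 x3 x4 (inord k) = nth 0 [:: x1; x2; x3; x4] k.
Proof. by move=> k4; rewrite /pts4 inordK. Qed.

Lemma tperm13_inord : let s := tperm (inord 1) (inord 3) : {perm 'I_4} in
  [/\ s (inord 0) = inord 0, s (inord 1) = inord 3, s (inord 2) = inord 2 & s (inord 3) = inord 1].
Proof. by split; rewrite ?tpermL ?tpermR ?tpermD ?inord4_neq. Qed.

Lemma tperm12_inord : let s := tperm (inord 1) (inord 2) : {perm 'I_4} in
  [/\ s (inord 0) = inord 0, s (inord 1) = inord 2, s (inord 2) = inord 1 & s (inord 3) = inord 3].
Proof. by split; rewrite ?tpermL ?tpermR ?tpermD ?inord4_neq. Qed.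

Section Orderings.
Context {R : realType} (a b : R) (w : R -> R -> \bar R) (M : R).
Hypothesis ab : a < b.
Hypothesis wC : forall x y, x \in `[a, b] -> y \in `[a, b] -> w x y = w y x.
Local Notation we := (extend a b w M).

Lemma well_ordering_crossing : well_ordering a b w -> crossing_minimal we.
Proof.
move=> wo x1 x2 x3 x4 x12 x23 x34.
have cl_in x : clampR a b x \in `[a, b] by rewrite in_itv/= clampR_ge clampR_le// ltW.
rewrite !extend_le_sum.
rewrite (wo _ _ _ _ (cl_in x1) (cl_in x2) (cl_in x3) (cl_in x4)); try exact: clampR_nd.
have [s0 s1 s2 s3] := tperm13_inord.
split.
  by apply: (bigmin_inf 1%g) => //; rewrite !perm1 !pts4_inord.
apply: (bigmin_inf (tperm (inord 1) (inord 3))) => //; rewrite s0 s1 s2 s3 !pts4_inord//=.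
by rewrite [w (clampR a b x2) _]wC.
Qed.

Lemma crossing_well_ordering :
  (forall x1 x2 x3 x4, a <= x1 -> x1 <= x2 -> x2 <= x3 -> x3 <= x4 -> x4 <= b ->
    (we x1 x3 + we x2 x4 <= we x1 x2 + we x3 x4)%E /\
    (we x1 x3 + we x2 x4 <= we x1 x4 + we x2 x3)%E) -> well_ordering a b w.
Proof.
move=> cross x1 x2 x3 x4 x1ab x2ab x3ab x4ab x12 x23 x34.
have [/andP[ax1 x1b] /andP[ax4 x4b]] : (a <= x1 <= b) /\ (a <= x4 <= b).
  by move: x1ab x4ab; rewrite !in_itv.
have [] := cross _ _ _ _ ax1 x12 x23 x34 x4b.
have [/andP[ax2 x2b] /andP[ax3 x3b]] : (a <= x2 <= b) /\ (a <= x3 <= b).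
  by move: x2ab x3ab; rewrite !in_itv.
rewrite !extend_le_sum !clampR_id// => le1 le2.
have [s0 s1 s2 s3] := tperm12_inord.
apply/eqP; rewrite eq_le; apply/andP; split; last first.
  by apply: (bigmin_inf (tperm (inord 1) (inord 2))) => //; rewrite s0 s1 s2 s3 !pts4_inord.
apply/bigmin_geP; split; first exact: leey.
move=> s _.
have neq (j k : nat) : (j < 4)%N -> (k < 4)%N -> j != k -> s (inord j) != s (inord k).
  by move=> j4 k4 jk; rewrite (inj_eq perm_inj) inord4_neq.
have : uniq [:: s (inord 0); s (inord 1); s (inord 2); s (inord 3)].
  by rewrite /= !inE !negb_or !neq.
have e21 := wC _ _ x2ab x1ab; have e31 := wC _ _ x3ab x1ab; have e41 := wC _ _ x4ab x1ab.
have e32 := wC _ _ x3ab x2ab; have e42 := wC _ _ x4ab x2ab; have e43 := wC _ _ x4ab x3ab.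
(* By symmetry the 24 arrangements reduce to three pairings: the crossing one and the right-hand
   sides of the two crossing inequalities. *)
move: (s (inord 0)) (s (inord 1)) (s (inord 2)) (s (inord 3)) => i j k l.
rewrite /pts4; case: i => -[|[|[|[|//]]]] ?; case: j => -[|[|[|[|//]]]] ? //;
  case: k => -[|[|[|[|//]]]] ? //; case: l => -[|[|[|[|//]]]] ? //= _;
  by rewrite ?e21 ?e31 ?e41 ?e32 ?e42 ?e43 // [leRHS]addeC.
Qed.

(** Equality of finite costs would make two sums of Dirac masses coincide, but they take different
    values on a suitable singleton. *)
Lemma strictly_well_ordering_crossing : strictly_well_ordering a b w -> crossing_strict a b we.
Proof.
move=> [wo strict] x1 x2 x3 x4 ax1 x12 x23 x34 x4b fin.
have [c1 c2] := well_ordering_crossing wo x1 x2 x3 x4 x12 x23 x34.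
have x1ab : x1 \in `[a, b] by rewrite in_itv/=; apply/andP; split; lra.
have x2ab : x2 \in `[a, b] by rewrite in_itv/=; apply/andP; split; lra.
have x3ab : x3 \in `[a, b] by rewrite in_itv/=; apply/andP; split; lra.
have x4ab : x4 \in `[a, b] by rewrite in_itv/=; apply/andP; split; lra.
have shift u v u' v' : u \in `[a, b] -> v \in `[a, b] -> u' \in `[a, b] -> v' \in `[a, b] ->
    (we u v + we u' v' = w u v + w u' v' + (M + M)%:E)%E.
  by move=> ? ? ? ?; rewrite !extend_in// addeACA.
have noo : (w x1 x3 + w x2 x4)%E <> +oo%E.
  by move: fin; rewrite shift// => + E; rewrite E.
have dir1 (x : R) : \d_x [set x] = 1%E :> \bar R by rewrite diracE mem_set.
have dir0 (x y : R) : x != y -> \d_x [set y] = 0%E :> \bar R.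
  by move=> /eqP xy; rewrite diracE memNset.
have eq_w A B : (A + (M + M)%:E = B + (M + M)%:E)%E -> A = B.
  by move=> AB; rewrite -[A](@addeK _ (M + M)%:E)// AB addeK.
have [s0 s1 s2 s3] := tperm13_inord.
have st y := strict _ _ _ _ x1ab x2ab x3ab x4ab x12 x23 x34 y.
split => [lt23|lt12 lt34]; rewrite lt_neqAle ?c1 ?c2 andbT; apply/eqP; rewrite !shift// => /eq_w E.
- have := st 1%g; rewrite /= !perm1 !pts4_inord//= => /(_ E)[//|D|D].
    have := D [set x3] (measurable_set1 _).
    rewrite (dir0 x2 x3) ?lt_eqF// dir1 adde0.
    have [->|n13] := eqVneq x1 x3; first by rewrite dir1 => /eqP; rewrite -EFinD eqe; lra.
    by rewrite dir0// add0e => /eqP; rewrite onee_eq0.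
  have := D [set x1] (measurable_set1 _).
  rewrite dir1 !dir0 ?gt_eqF//; [|exact: lt_le_trans (le_lt_trans x12 lt23) x34|exact: le_lt_trans x12 lt23].
  by rewrite !adde0 => /eqP; rewrite onee_eq0.
- have := st (tperm (inord 1) (inord 3)); rewrite /= s0 s1 s2 s3 !pts4_inord//= [w x3 x2]wC//.
  move=> /(_ E)[//|D|D].
    have := D [set x4] (measurable_set1 _).
    rewrite dir1 !dir0 ?lt_eqF//; last exact: le_lt_trans (le_trans x12 x23) lt34.
    by rewrite !add0e => /eqP; rewrite eq_sym onee_eq0.
  have := D [set x1] (measurable_set1 _).
  rewrite dir1 !dir0 ?gt_eqF//; last exact: lt_le_trans lt12 x23.
  by rewrite !adde0 => /eqP; rewrite onee_eq0.
Qed.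

End Orderings.

(** * Seidl plans and their symmetrizations *)

Section SeidlPlans.
Context {R : realType} (a b : R) (n : nat) (rho : probability R R) (T : R -> R).
Hypothesis ab : a < b.
Hypothesis n_gt0 : (0 < n)%N.
Hypothesis rho_ab : prob_on a b rho.
Hypothesis rho_na : nonatomic rho.
Hypothesis seidlT : is_seidl_map a b n rho T.

Let mT := measurable_seidl_tuple a b n rho T seidlT.

Let mcoord (i : 'I_n) (A : set R) : measurable A -> measurable (Defs.coord n i @^-1` A).
Proof. by move=> mA; rewrite -[X in measurable X]setTI; exact: (measurable_tnth i). Qed.

Lemma seidl_plan_Pi g : is_seidl_plan n rho T g -> Pi n rho g.
Proof.
move=> gE i A mA; rewrite gE; last exact: mcoord.
rewrite -[RHS](seidl_iter_invariant a b rho n T ab rho_ab rho_na n_gt0 seidlT i A mA).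
by congr (rho _); apply/seteqP; split => x; rewrite /= /Defs.coord tnth_mktuple.
Qed.

Lemma seidl_plan_integral g (f : n.-tuple R -> \bar R) : is_seidl_plan n rho T g ->
  measurable_fun setT f -> (forall x, (0 <= f x)%E) ->
  (\int[g]_x f x = \int[rho]_x f (seidl_tuple n T x))%E.
Proof.
move=> gE mf f0; rewrite (eq_measure_integral (image_measure _ _ _ _ rho _ mT)).
  by rewrite ge0_integral_pushforward.
by move=> A mA _; exact: gE.
Qed.

Variable gs : {measure set (n.-tuple R) -> \bar R}.
Hypothesis gsE : is_seidl_symmetrization n rho T gs.

Let phi (s : {perm 'I_n}) x := perm_tuple n s (seidl_tuple n T x).

Let mphi s : measurable_fun setT (phi s).
Proof. exact: (measurableT_comp (measurable_perm_tuple n s) mT). Qed.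

Let sum_perm (r : R) : (((n`!%:R)^-1)%:E * \sum_(s : {perm 'I_n}) r%:E = r%:E)%E.
Proof.
rewrite sumEFin sumr_const card_Sn -EFinM; congr EFin.
by rewrite -[r *+ _]mulr_natl mulKf// pnatr_eq0 -lt0n fact_gt0.
Qed.

Lemma seidl_symmetrization_symmetric : symmetric_measure n gs.
Proof.
move=> t A mA; rewrite !gsE//; last first.
  by rewrite -[X in measurable X]setTI; exact: measurable_perm_tuple.
congr (_ * _)%E; rewrite [RHS](reindex_inj (mulgI t)) /=; apply: eq_bigr => s _.
by congr (rho _); apply/seteqP; split => x /=; rewrite perm_tupleM.
Qed.

Lemma seidl_symmetrization_Pi : Pi n rho gs.
Proof.
move=> i A mA; rewrite gsE; last exact: mcoord.
have rf : rho A = (fine (rho A))%:E by rewrite fineK// fin_num_measure.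
rewrite rf -(sum_perm (fine (rho A))); congr (_ * _)%E; apply: eq_bigr => s _; rewrite -rf.
rewrite -[RHS](seidl_iter_invariant a b rho n T ab rho_ab rho_na n_gt0 seidlT (s i) A mA).
by congr (rho _); apply/seteqP; split => x; rewrite /= /Defs.coord !tnth_mktuple.
Qed.

Lemma seidl_symmetrization_cost (w : R -> R -> \bar R) :
  measurable_fun setT (cost_fun w n) -> (forall x, (0 <= cost_fun w n x)%E) ->
  (\int[rho]_x cost_fun w n (seidl_tuple n T x) < +oo)%E ->
  (\int[gs]_x cost_fun w n x = \int[rho]_x cost_fun w n (seidl_tuple n T x))%E.
Proof.
move=> mc c0 fin; rewrite (eq_measure_integral (mixture _ _ _ _ rho _ 1%g phi mphi)); last first.
  by move=> A mA _; rewrite gsE//; apply: esym; rewrite -card_Sn; exact: mixtureE.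
rewrite integral_mixture// card_Sn.
have ifin : (\int[rho]_x cost_fun w n (seidl_tuple n T x))%E \is a fin_num.
  by rewrite ge0_fin_numE//; apply: integral_ge0.
rewrite -[RHS](fineK ifin) -[RHS]sum_perm fineK//; congr (_ * _)%E; apply: eq_bigr => s _.
by apply: eq_integral => x _; rewrite /phi cost_fun_reindex//; exact: perm_inj.
Qed.

End SeidlPlans.

Theorem theorem2p2 (R : realType) (a b : R) (w : R -> R -> \bar R) :
  a < b ->
  {within `[a, b]%classic `*` `[a, b]%classic, continuous (fun p : R * R => w p.1 p.2)} ->
  (forall x y, x \in `[a, b] -> y \in `[a, b] -> w x y = w y x) ->
  (forall x y, x \in `[a, b] -> y \in `[a, b] -> w x y != -oo%E) ->
  (forall n : nat, (0 < n)%N -> forall rho : probability R R,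
     prob_on a b rho -> nonatomic rho -> (F_OT a b w n rho < +oo)%E) ->
  ((forall n : nat, (0 < n)%N -> forall rho : probability R R,
      prob_on a b rho -> nonatomic rho ->
      forall T : R -> R, is_seidl_map a b n rho T ->
      forall g : {measure set (n.-tuple R) -> \bar R},
        is_seidl_plan n rho T g -> is_minimizer a b w n rho g)
    <-> well_ordering a b w)
  /\
  (strictly_well_ordering a b w ->
   forall n : nat, (0 < n)%N -> forall rho : probability R R,
     prob_on a b rho -> nonatomic rho ->
     forall T : R -> R, is_seidl_map a b n rho T ->
     forall gs : {measure set (n.-tuple R) -> \bar R},
       is_seidl_symmetrization n rho T gs ->
       [/\ symmetric_measure n gs, is_minimizer a b w n rho gs &
           forall g : {measure set (n.-tuple R) -> \bar R},
             symmetric_measure n g -> is_minimizer a b w n rho g ->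
             forall A : set (n.-tuple R), measurable A -> g A = gs A]).
Proof.
move=> ab w_cont wC w_noo F_fin.
have [M M0 wM] := bounded_below a b w ab w_cont w_noo.
pose we := extend a b w M.
have we_cont : continuous (fun p : R * R => we p.1 p.2) := extend_continuous a b w ab w_cont M.
have weC : forall x y, we x y = we y x := extendC a b w ab wC M.
have we_ge0 : forall x y, (0 <= we x y)%E := extend_ge0 a b w ab M wM.
have mc n : measurable_fun setT (cost_fun we n).
  by apply: measurable_cost_fun; exact: continuous2_measurable.
have c0 n (x : n.-tuple R) : (0 <= cost_fun we n x)%E by exact: cost_fun_ge0.
have minP n rho g n0 rab := is_minimizer_extend a b w ab w_cont M M0 wM n rho n0 rab g.
have finP n rho (n0 : (0 < n)%N) (rab : prob_on a b rho) (rna : nonatomic rho) :=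
  finite_cost_extend a b w ab w_cont M M0 wM n rho n0 rab (F_fin n n0 rho rab rna).
have we_fin : well_ordering a b w -> forall x y, a <= x -> x < y -> y < b -> (we x y < +oo)%E.
  move=> wo; apply: crossing_finite => //; first exact: well_ordering_crossing.
  by move=> rho rab rna; exact: finP.
have optimal n rho T gam : well_ordering a b w -> (0 < n)%N -> prob_on a b rho -> nonatomic rho ->
    is_seidl_map a b n rho T -> Pi n rho gam ->
    (\int[rho]_x cost_fun we n (seidl_tuple n T x) <= \int[gam]_x cost_fun we n x)%E.
  move=> wo n0 rab rna sT; apply: (seidl_optimal a b) => //; first exact: well_ordering_crossing.
  exact: we_fin.
split; [split|].
- move=> sopt; apply: (crossing_well_ordering a b w M wC).
  apply: (crossing_closed a b we) => // rho S rab rna sS gam gam_Pi.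
  have mS := measurable_seidl_tuple a b 2 rho S sS.
  have gE : is_seidl_plan 2 rho S (image_measure _ _ _ _ rho _ mS) by [].
  have g_Pi := seidl_plan_Pi a b 2 rho S ab isT rab rna sS _ gE.
  rewrite -(seidl_plan_integral a b 2 rho S sS _ _ gE)//.
  by apply: (proj1 (minP 2%N rho _ isT rab g_Pi)) => //; exact: (sopt 2%N isT rho rab rna S sS).
- move=> wo n n0 rho rab rna T sT g gE.
  have g_Pi := seidl_plan_Pi a b n rho T ab n0 rab rna sT _ gE.
  apply/(minP n rho g n0 rab g_Pi) => gam gam_Pi.
  by rewrite (seidl_plan_integral a b n rho T sT _ _ gE)//; exact: optimal.
- move=> swo; have wo := proj1 swo.
  move=> n n0 rho rab rna T sT gs gsE.
  have gs_Pi := seidl_symmetrization_Pi a b n rho T ab n0 rab rna sT gs gsE.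
  have gs_sym := seidl_symmetrization_symmetric n rho T gs gsE.
  (* A competitor of finite cost makes the minimum finite, as the subtraction of integrals in the
     comparison of samples requires. *)
  have [g0 g0_Pi g0_fin] := finP n rho n0 rab rna.
  have s_fin := le_lt_trans (optimal n rho T g0 wo n0 rab rna sT g0_Pi) g0_fin.
  have gs_min : is_minimizer a b w n rho gs.
    apply/(minP n rho gs n0 rab gs_Pi) => gam gam_Pi.
    by rewrite (seidl_symmetrization_cost a b n rho T sT gs gsE)//; exact: optimal.
  split => // g g_sym g_min A mA.
  have g_Pi := proj1 g_min.
  case: n n0 sT gs gsE gs_Pi gs_sym gs_min g g_sym g_min g_Pi g0 g0_Pi g0_fin s_fin A mA => // n n0 sT.
  move=> gs gsE gs_Pi gs_sym gs_min g g_sym g_min g_Pi g0 g0_Pi g0_fin _ A mA.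
  (* Applied both to the given minimizer and to the symmetrized Seidl plan; the repackaging as a
     probability is needed to form the product of two independent samples. *)
  have inter (h : {measure set (n.+1.-tuple R) -> \bar R}) : Pi n.+1 rho h -> symmetric_measure n.+1 h ->
      is_minimizer a b w n.+1 rho h ->
      exists P : probability (n.+1.-tuple R) R, [/\ forall B, P B = h B, Pi n.+1 rho P,
        symmetric_measure n.+1 P & {ae square_measure _ _ P, forall p, interleaved n.+1 p.1 p.2}].
    move=> h_Pi h_sym h_min.
    have [P PE] := probability_of_measure _ _ h [tuple 0 | i < n.+1] (Pi_setT n.+1 rho h n0 h_Pi).
    have P_Pi : Pi n.+1 rho P by move=> i B mB; rewrite /= PE h_Pi.
    have intE : (\int[P]_x cost_fun we n.+1 x = \int[h]_x cost_fun we n.+1 x)%E.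
      by apply: eq_measure_integral => B _ _; exact: PE.
    have h_opt := proj1 (minP n.+1 rho h n0 rab h_Pi) h_min.
    exists P; split => //; first by move=> s B mB; rewrite /= !PE h_sym.
    apply: (ae_interleaved a b we n rho) => //.
    - exact: well_ordering_crossing.
    - exact: strictly_well_ordering_crossing.
    - exact: we_fin.
    - by rewrite intE; apply: le_lt_trans (h_opt g0 g0_Pi) g0_fin.
    - by move=> gam gam_Pi; rewrite intE; exact: h_opt.
  have [P [PE P_Pi P_sym P_int]] := inter g g_Pi g_sym g_min.
  have [Q [QE Q_Pi Q_sym Q_int]] := inter gs gs_Pi gs_sym gs_min.
  by rewrite -PE -QE; exact: (symmetric_unique n rho).
Qed.
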